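(* Let $\Gamma$ be a projective Anosov subgroup of $\mathrm{SL}(n,\mathbb{R})$. Then $h_{12}(\Gamma)\le\delta_{12}(\Gamma)$ and $h_{1n}(\Gamma)=\delta_{1n}(\Gamma)$. Moreover, if $\Gamma$ is Zariski dense in $\mathrm{SL}(n,\mathbb{R})$, then $h_{12}(\Gamma)=\delta_{12}(\Gamma)$.
   Context: For $g\in\mathrm{SL}(n,\mathbb{R})$, $\mu_i(g)$ is the logarithm of the $i$-th eigenvalue (decreasing order) of $\sqrt{gg^T}$, and $\lambda_i(g)$ is the logarithm of the $i$-th largest modulus of the complex eigenvalues of $g$ (with multiplicity). A finitely generated $\Gamma\subset\mathrm{SL}(n,\mathbb{R})$ is projective Anosov if there are $C,C'>0$ with $\mu_1(g)-\mu_2(g)\ge C|g|-C'$ for all $g\in\Gamma$ ($|g|$ the word length). Define $\delta_{1j}(\Gamma)=\limsup_{R\to\infty}\frac1R\log\#\{\gamma\in\Gamma:\mu_1(\gamma)-\mu_j(\gamma)\le R\}$ and $h_{1j}(\Gamma)=\limsup_{R\to\infty}\frac1R\log\#\{[\gamma]\text{ conjugacy class in }\Gamma:\lambda_1(\gamma)-\lambda_j(\gamma)\le R\}$, for $j=2$ and $j=n$. *)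

(* Defs.v *)
From HB Require Import structures.
From mathcomp Require Import all_boot all_order all_algebra.
From mathcomp Require Import boolp classical_sets cardinality reals ereal exp.
From mathcomp Require Import complex.
Set Implicit Arguments. Unset Strict Implicit. Unset Printing Implicit Defensive.
Import Order.TTheory GRing.Theory Num.Theory.
Local Open Scope classical_set_scope.
Local Open Scope ring_scope.

Section AnosovDefs.
Variable R : realType.

Definition cplx_mx (n : nat) (A : 'M[R]_n) : 'M[R[i]]_n :=
  map_mx (fun x : R => x%:C%C) A.

(** the complex eigenvalues of A, with multiplicity (roots of the
    characteristic polynomial, which splits over the algebraically closed R[i]) *)
Definition eig_seq (n : nat) (A : 'M[R]_n) : seq R[i] :=
  sval (closed_field_poly_normal (char_poly (cplx_mx A))).

Definition eig_moduli (n : nat) (A : 'M[R]_n) : seq R :=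
  sort (fun x y : R => y <= x) (map (@ComplexField.Normc.normc R) (eig_seq A)).

Definition lambda (n : nat) (A : 'M[R]_n) (i : nat) : R :=
  ln (nth 0 (eig_moduli A) i.-1).

(** eigenvalues of sqrt(A A^T) in decreasing order = square roots of the
    (nonnegative real) eigenvalues of A A^T in decreasing order *)
Definition sing_values (n : nat) (A : 'M[R]_n) : seq R :=
  map Num.sqrt (eig_moduli (A *m A^T)).

Definition mu (n : nat) (A : 'M[R]_n) (i : nat) : R :=
  ln (nth 0 (sing_values A) i.-1).

Definition is_letter (n : nat) (S : seq 'M[R]_n) (x : 'M[R]_n) : bool :=
  has (fun s => (x == s) || (x == invmx s)) S.

Definition is_word (n : nat) (S : seq 'M[R]_n) (w : seq 'M[R]_n) : bool :=
  all (is_letter S) w.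

Definition word_prod (n : nat) (w : seq 'M[R]_n) : 'M[R]_n :=
  foldr (fun x y => x *m y) 1%:M w.

Definition gen_group (n : nat) (S : seq 'M[R]_n) : set 'M[R]_n :=
  [set g | exists w, is_word S w /\ word_prod w = g].

Definition is_wlen (n : nat) (S : seq 'M[R]_n) (g : 'M[R]_n) (k : nat) : Prop :=
  (exists w, [/\ is_word S w, word_prod w = g & size w = k]) /\
  (forall w, is_word S w -> word_prod w = g -> (k <= size w)%N).

Definition proj_anosov (n : nat) (S : seq 'M[R]_n) : Prop :=
  exists C C' : R, [/\ 0 < C, 0 < C' &
    forall g k, is_wlen S g k -> mu g 1 - mu g 2 >= C * k%:R - C'].

(** cardinality of an arbitrary set, as an extended real (+oo if infinite) *)
Definition ecard (T : Type) (A : set T) : \bar R :=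
  ereal_inf [set (n%:R)%:E | n in [set n : nat | (A #= `I_n)%card]].

Definition growth_rate (N : R -> \bar R) : \bar R :=
  ereal_inf [set ereal_sup
     [set (match N r with EFin x => (ln x / r)%:E | _ => +oo%E end)
        | r in [set r | M <= r]] | M in [set: R]].

Definition conj_class (n : nat) (Gamma : set 'M[R]_n) (g : 'M[R]_n)
  : set 'M[R]_n :=
  [set x | exists2 e, Gamma e & x = e *m g *m invmx e].

Definition delta1 (n : nat) (Gamma : set 'M[R]_n) (j : nat) : \bar R :=
  growth_rate (fun r => ecard [set g | Gamma g /\ mu g 1 - mu g j <= r]).

Definition h1 (n : nat) (Gamma : set 'M[R]_n) (j : nat) : \bar R :=
  growth_rate (fun r => ecard [set C : set 'M[R]_n |
     exists g, [/\ Gamma g, C = conj_class Gamma g & lambda g 1 - lambda g j <= r]]).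

Inductive polyfun (n : nat) : ('M[R]_n -> R) -> Prop :=
| polyfun_const (c : R) : polyfun (fun _ => c)
| polyfun_coord (i j : 'I_n) : polyfun (fun A => A i j)
| polyfun_add p q : polyfun p -> polyfun q -> polyfun (fun A => p A + q A)
| polyfun_mul p q : polyfun p -> polyfun q -> polyfun (fun A => p A * q A).

Definition zariski_dense_SL (n : nat) (Gamma : set 'M[R]_n) : Prop :=
  forall p, polyfun p -> (forall g, Gamma g -> p g = 0) ->
    forall g : 'M[R]_n, \det g = 1 -> p g = 0.

End AnosovDefs.

(* Main.v *)
Require Import Defs.
From mathcomp Require Import all_boot all_order all_algebra.
From mathcomp Require Import boolp classical_sets cardinality reals ereal.
From mathcomp Require Import sequences exp complex.
From mathcomp Require Import ring lra zify.
Set Implicit Arguments. Unset Strict Implicit. Unset Printing Implicit Defensive.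
Import Order.TTheory GRing.Theory Num.Theory.
Local Open Scope ring_scope.

(** Write |A| for a matrix norm, wedge(A) for the size of its 2 x 2 minors, and
    kappa(g) = ln |g| + ln |g^-1|, which is mu_1(g) - mu_n(g) up to a constant.

    The gap mu_1 - mu_2 makes every product of successive letters of a long geodesic
    word close to a matrix of rank one.  The loss ln (|g||h| / |gh|) is then controlled
    by the alignment of the image of g with the kernel of h; along a geodesic the
    alignment moves by amounts which decay geometrically, up to a factor growing
    with the loss already incurred, and this feedback is summable.  Hence
    |gh| >= c |g||h| along geodesics, and along concatenations of two geodesics at a
    nearest point.  So kappa is additive up to a constant on word geodesics, the group
    has nearest-point projections onto geodesics with a Morse-type stability, and each
    g is conjugate, as g = eta g' eta^-1, with 2 kappa(eta) + kappa(g') <= kappa(g) + C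
    and kappa(g'^2) >= 2 kappa(g') - C.  The second inequality bounds a trace below by
    |g'|, so mu_1(g') <= lambda_1(g') + C, and similarly for g'^-1; since
    lambda_1 + lambda_2 <= mu_1 + mu_2, every class has a representative with
    mu_1 - mu_j <= lambda_1 - lambda_j + C, for j = 2 and j = n.  This gives h <= delta.

    Conversely g' may be taken among the linearly many rotations of a shortest word of
    the class, so for j = n the number of g with mu_1 - mu_n <= r is at most
    (r + 1) sum_q N(q) H(r + K - 2q) up to a constant, N and H being the two counting
    functions; hence delta <= max (h, delta / 2), and delta <= h as delta is finite.
    For j = 2 one multiplies g first by an element f of a finite set with
    |tr wedge^2 (g f)| >= a |wedge^2 g|, which Zariski density provides; this turns
    lambda_1 + lambda_2 into mu_1 + mu_2 up to a constant. *)

(** * Norms, minors and rank-one approximation *)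

(** The hypothesis is only a gap between two singular values, growing with word length:
    hyperbolicity of the group and limit maps to projective space are not given. The argument
    therefore stays finitary. A matrix close to rank one plays the role of an attracting point, and
    the inequality |gh| >= c |g||h| that of transversality of limit points. Adding ln |g^-1| to ln
    |g| makes kappa symmetric and subadditive, hence a left-invariant length for which only
    near-additivity along word geodesics has to be proved.

    The cases j = n and j = 2 differ because lambda_n(g) = - lambda_1(g^-1): for j = n only first
    eigenvalues occur, and these are within reach of rank-one estimates applied to g and g^-1. For j
    = 2 the sum lambda_1 + lambda_2 belongs to the second exterior power, where the group has no
    gap; it may fall far below mu_1 + mu_2, and the Anosov hypothesis does not bound that loss. This
    loss is harmless for h <= delta, which uses lambda_1 + lambda_2 <= mu_1 + mu_2, and is the whole
    difficulty of the converse. *)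

Section EntrywiseNorm.
Variable R : realType.

(** The entrywise l1 norm is submultiplicative and exactly multiplicative on outer products
    ([nm_outer]), which keeps all rank-one estimates algebraic. *)
Definition nm (m n : nat) (A : 'M[R]_(m, n)) : R := \sum_i \sum_j `|A i j|.

Lemma nm_ge0 m n (A : 'M[R]_(m, n)) : 0 <= nm A.
Proof. by apply: sumr_ge0 => i _; apply: sumr_ge0. Qed.
Hint Resolve nm_ge0 : core.

Lemma le_nm m n (A : 'M[R]_(m, n)) i j : `|A i j| <= nm A.
Proof.
rewrite /nm (bigD1 i) //= (bigD1 j) //= -addrA lerDl addr_ge0 ?sumr_ge0 //.
by move=> k _; apply: sumr_ge0.
Qed.

Lemma nm_row m n (A : 'M[R]_(m, n)) : nm A = \sum_i nm (row i A).
Proof.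
apply: eq_bigr => i _; rewrite /nm big_ord1.
by apply: eq_bigr => j _; rewrite mxE.
Qed.

Lemma nm_row_le m n (A : 'M[R]_(m, n)) i : nm (row i A) <= nm A.
Proof.
by rewrite [leRHS]nm_row (bigD1 i) //= lerDl; apply: sumr_ge0 => k _.
Qed.

Lemma nmT m n (A : 'M[R]_(m, n)) : nm A^T = nm A.
Proof.
rewrite /nm exchange_big; apply: eq_bigr => i _; apply: eq_bigr => j _.
by rewrite mxE.
Qed.

Lemma nmD m n (A B : 'M[R]_(m, n)) : nm (A + B) <= nm A + nm B.
Proof.
rewrite /nm -big_split; apply: ler_sum => i _; rewrite -big_split.
by apply: ler_sum => j _; rewrite mxE ler_normD.
Qed.

Lemma nmN m n (A : 'M[R]_(m, n)) : nm (- A) = nm A.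
Proof. by apply: eq_bigr => i _; apply: eq_bigr => j _; rewrite mxE normrN. Qed.

Lemma nmB m n (A B : 'M[R]_(m, n)) : nm (A - B) <= nm A + nm B.
Proof. by rewrite -(nmN B) nmD. Qed.

Lemma nmZ m n a (A : 'M[R]_(m, n)) : nm (a *: A) = `|a| * nm A.
Proof.
rewrite /nm mulr_sumr; apply: eq_bigr => i _; rewrite mulr_sumr.
by apply: eq_bigr => j _; rewrite mxE normrM.
Qed.

Lemma nmM m n p (A : 'M[R]_(m, n)) (B : 'M[R]_(n, p)) :
  nm (A *m B) <= nm A * nm B.
Proof.
rewrite {1 2}/nm mulr_suml; apply: ler_sum => i _.
apply: (@le_trans _ _ (\sum_j \sum_k `|A i k| * `|B k j|)).
  apply: ler_sum => j _; rewrite mxE (le_trans (ler_norm_sum _ _ _)) //.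
  by apply: ler_sum => k _; rewrite normrM.
rewrite exchange_big mulr_suml; apply: ler_sum => k _ /=.
rewrite -mulr_sumr ler_wpM2l // /nm (bigD1 k) //= lerDl.
by apply: sumr_ge0 => j _; apply: sumr_ge0.
Qed.

Lemma nm_outer m n (u : 'cV[R]_m) (v : 'rV[R]_n) : nm (u *m v) = nm u * nm v.
Proof.
rewrite /nm big_ord1 mulr_suml; apply: eq_bigr => i _.
rewrite big_ord1 mulr_sumr; apply: eq_bigr => j _.
by rewrite mxE big_ord1 normrM.
Qed.

Lemma nm1 n : nm (1%:M : 'M[R]_n) = n%:R.
Proof.
rewrite -[n in RHS]card_ord -sum1_card natr_sum; apply: eq_bigr => i _.
rewrite (bigD1 i) //= big1 ?mxE ?eqxx ?normr1 ?addr0 // => j ne_ji.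
by rewrite mxE eq_sym (negPf ne_ji) normr0.
Qed.

Lemma nm_delta n (j : 'I_n) : nm (delta_mx j 0 : 'cV[R]_n) = 1.
Proof.
rewrite /nm (bigD1 j) //= big_ord1 !mxE !eqxx normr1 big1 ?addr0 // => i neij.
by rewrite big_ord1 !mxE (negPf neij) normr0.
Qed.

Lemma nm_eq0 m n (A : 'M[R]_(m, n)) : (nm A == 0) = (A == 0).
Proof.
apply/eqP/eqP => [A0 | ->].
  apply/matrixP => i j; apply/eqP; rewrite mxE -normr_eq0 eq_le normr_ge0.
  by rewrite -A0 le_nm.
by rewrite /nm big1 // => i _; rewrite big1 // => j _; rewrite mxE normr0.
Qed.

Lemma nm_gt0 m n (A : 'M[R]_(m, n)) : (0 < nm A) = (A != 0).
Proof. by rewrite lt_neqAle nm_ge0 andbT eq_sym nm_eq0. Qed.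

Lemma unitmx_nm_gt0 n (A : 'M[R]_n) : (0 < n)%N -> A \in unitmx -> 0 < nm A.
Proof.
case: n A => // n A _ uA; rewrite nm_gt0; apply/eqP => A0.
by move: uA; rewrite A0 unitmxE det0 unitr0.
Qed.

Lemma trmx_bound n (A : 'M[R]_n) : `|\tr A| <= nm A.
Proof.
apply: le_trans (ler_norm_sum _ _ _) _; apply: ler_sum => i _.
by rewrite (bigD1 i) //= lerDl; apply: sumr_ge0.
Qed.

Lemma max_row m n (A : 'M[R]_(m, n)) : (0 < m)%N ->
  exists i, nm A <= m%:R * nm (row i A).
Proof.
case: m A => // m A _; have [i _ imax] := @Order.TotalTheory.arg_maxP _ _ _
  ord0 xpredT (fun i => nm (row i A)) isT.
exists i; rewrite nm_row mulr_natl -[X in _ *+ X]card_ord -sumr_const.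
by apply: ler_sum => k _; apply: imax.
Qed.

Lemma max_entry n (v : 'rV[R]_n) : (0 < n)%N ->
  exists j, nm v <= n%:R * `|v 0 j|.
Proof.
move=> n0; have [j] := max_row v^T n0; rewrite nmT => h; exists j.
by apply: le_trans h _; rewrite {1}/nm !big_ord1 !mxE.
Qed.

Definition minor2 m n (A : 'M[R]_(m, n)) i j k l : R :=
  A i k * A j l - A i l * A j k.

Definition wedge_nm m n (A : 'M[R]_(m, n)) : R :=
  \sum_i \sum_j \sum_k \sum_l `|minor2 A i j k l|.

Lemma wedge_nm_ge0 m n (A : 'M[R]_(m, n)) : 0 <= wedge_nm A.
Proof. by do 4!(apply: sumr_ge0 => ? _). Qed.

Definition near_rank1 n (e : R) (A : 'M[R]_n) : Prop :=
  exists (u : 'cV_n) (v : 'rV_n), nm (A - u *m v) <= e * nm A.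

Lemma near_rank1W n (e f : R) (A : 'M[R]_n) :
  e <= f -> near_rank1 e A -> near_rank1 f A.
Proof.
move=> ef [u [v h]]; exists u, v; apply: le_trans h _.
by rewrite ler_wpM2r.
Qed.

Lemma near_rank1T n (e : R) (A : 'M[R]_n) : near_rank1 e A -> near_rank1 e A^T.
Proof.
move=> [u [v h]]; exists v^T, u^T.
by rewrite -trmx_mul -linearB /= !nmT.
Qed.

(* Cross approximation: with a_{ij} the largest entry, A - A_{*j} A_{i*} / a_{ij}
   has entries minor / a_{ij}. *)
Lemma near_rank1_wedge n (e : R) (A : 'M[R]_n) :
  (n ^ 2)%:R * wedge_nm A <= e * nm A ^+ 2 -> near_rank1 e A.
Proof.
case: n A => [|n] A hA.
  exists 0, 0; rewrite mul0mx subr0.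
  have nm00 (B : 'M[R]_0) : nm B = 0 by rewrite /nm big_ord0.
  by rewrite !nm00 mulr0.
have [A0|A0] := eqVneq A 0.
  have n0 : nm (0 : 'M[R]_n.+1) = 0 by apply/eqP; rewrite nm_eq0.
  by exists 0, 0; rewrite A0 mul0mx subr0 n0 mulr0.
have [i hi] := max_row A (ltn0Sn n).
have [j hj] := max_entry (row i A) (ltn0Sn n).
rewrite mxE in hj.
set a := A i j in hj.
have nA : 0 < nm A by rewrite nm_gt0.
have ha : nm A <= (n.+1 ^ 2)%:R * `|a|.
  by apply: le_trans hi _; rewrite natrX expr2 -mulrA ler_wpM2l.
have a0 : 0 < `|a|.
  by have := lt_le_trans nA ha; rewrite pmulr_rgt0 // ltr0n expn_gt0.
exists (a^-1 *: col j A), (row i A).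
have -> : A - (a^-1 *: col j A) *m row i A = \matrix_(k, l) (a^-1 * minor2 A k i l j).
  apply/matrixP => k l; rewrite !mxE big_ord1 !mxE /minor2 -/a.
  by field; rewrite -normr_gt0.
have hW : nm (\matrix_(k, l) (a^-1 * minor2 A k i l j)) <= `|a|^-1 * wedge_nm A.
  rewrite /nm /wedge_nm mulr_sumr; apply: ler_sum => k _.
  rewrite [X in _ <= _ * X](bigD1 i) //= mulrDr.
  have ge0 : 0 <= `|a|^-1 * \sum_(i0 < n.+1 | i0 != i)
      \sum_k0 \sum_l `|minor2 A k i0 k0 l|.
    rewrite mulr_ge0 ?invr_ge0 //.
    by do 3!(apply: sumr_ge0 => ? _).
  apply: le_trans _ (_ : `|a|^-1 * (\sum_k0 \sum_l `|minor2 A k i k0 l|) <= _);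
    last by rewrite lerDl.
  rewrite mulr_sumr; apply: ler_sum => l _.
  rewrite mxE normrM normfV ler_wpM2l ?invr_ge0 // (bigD1 j) //= lerDl.
  by apply: sumr_ge0.
apply: le_trans hW _; rewrite mulrC ler_pdivrMr //.
have w0 := wedge_nm_ge0 A.
rewrite -(ler_pM2l nA) ; apply: le_trans (_ : (n.+1 ^ 2)%:R * `|a| * wedge_nm A <= _).
  by rewrite ler_wpM2r.
rewrite mulrAC (le_trans (ler_wpM2r (ltW a0) hA)) //.
by rewrite le_eqVlt; apply/orP; left; apply/eqP; ring.
Qed.

End EntrywiseNorm.
#[global] Hint Extern 0 (is_true (@Order.le _ _ _ (nm _))) => exact: nm_ge0 : core.

(** * Quasi-multiplicativity of norms along chains *)

Section QuasiMultiplicativity.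
Variable R : realType.

Lemma geometric_small (t X : R) : 0 <= t < 1 ->
  exists N, forall k, (N <= k)%N -> X * t ^+ k < 1.
Proof.
move=> /andP[t0 t1].
have [->|tn0] := eqVneq t 0.
  by exists 1%N => -[|k] // _; rewrite expr0n mulr0 ltr01.
have tp : 0 < t by rewrite lt_def tn0.
pose s := t^-1 - 1; have s0 : 0 < s by rewrite subr_gt0 invf_gt1.
have bern k : 1 + k%:R * s <= t^-1 ^+ k.
  elim: k => [|k IH]; first by rewrite mul0r addr0 expr0.
  rewrite exprS; apply: le_trans (ler_wpM2l _ IH); last by rewrite invr_ge0.
  rewrite -[t^-1](subrK 1) -/s -natr1.
  have k0 : 0 <= k%:R :> R by [].
  by nra.
exists (Num.bound (`|X| / s)) => k hk.
have tk : 0 < t ^+ k by rewrite exprn_gt0.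
rewrite -ltr_pdivlMr // mul1r -exprVn.
apply: lt_le_trans (bern k); rewrite ltr_pwDl //.
apply: le_trans (ler_norm _) _; rewrite -ler_pdivrMr //.
have /archi_boundP/ltW/le_trans : 0 <= `|X| / s by rewrite divr_ge0 // ltW.
by apply; rewrite ler_nat.
Qed.

(** Models multiplication by a letter: it changes norms by a factor at most B in either
    direction. *)
Definition bounded_step n (B : R) (x : 'M[R]_n) : Prop :=
  exists y, [/\ x *m y = 1%:M, nm x <= B & nm y <= B].

Lemma bounded_stepT n B (x : 'M[R]_n) : bounded_step B x -> bounded_step B x^T.
Proof.
move=> [y [xy xB yB]]; exists y^T; rewrite !nmT -trmx_mul; split=> //.
by rewrite (mulmx1C xy) trmx1.
Qed.

Lemma bounded_step_nmr n m B (x : 'M[R]_n) (A : 'M_(m, n)) :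
  bounded_step B x -> nm A <= B * nm (A *m x).
Proof.
move=> [y [xy _ yB]]; rewrite -{1}(mulmx1 A) -xy mulmxA.
by apply: le_trans (nmM _ _) _; rewrite mulrC ler_wpM2r.
Qed.

Lemma bounded_step_nm n B (x : 'M[R]_n) : bounded_step B x -> nm x <= B.
Proof. by move=> [y []]. Qed.

(** The alignment of [Phi] with [A] is |Phi A| / |A|. If A = u v exactly, both A and A x have
    alignment |Phi u| / |u|, so multiplying by x changes nothing. The last term collects the errors
    due to F = A - u v, after clearing denominators. *)
Lemma alignment_step p n (B e : R) (Phi : 'M_(p, n)) (A x : 'M[R]_n) :
  1 <= B -> 0 <= e -> bounded_step B x -> near_rank1 e A ->
  nm (Phi *m A) * nm (A *m x) <=
    nm (Phi *m (A *m x)) * nm A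
    + (2 + 4 * B ^+ 2) * e * nm Phi * (nm A * nm (A *m x)).
Proof.
move=> B1 e0 hx [u [v hF]]; set F := A - u *m v in hF.
have defA : A = u *m v + F by rewrite /F addrC subrK.
have ha' := bounded_step_nmr A hx.
have hpf := nmM Phi A; have hp'f := nmM Phi (A *m x).
set a := nm A in hF ha' hpf *; set a' := nm (A *m x) in ha' hp'f *.
set f := nm Phi in hpf hp'f *; set p1 := nm (Phi *m A) in hpf *.
set p' := nm (Phi *m (A *m x)) in hp'f *.
have a0 : 0 <= a by apply: nm_ge0.
have a'0 : 0 <= a' by apply: nm_ge0.
have f0 : 0 <= f by apply: nm_ge0.
have p'0 : 0 <= p' by apply: nm_ge0.
have faa : 0 <= f * (a * a') by rewrite !mulr_ge0.
have p'a : 0 <= p' * a by rewrite mulr_ge0.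
have B2 : 0 <= B ^+ 2 by rewrite sqr_ge0.
(* For e >= 1 the error term alone dominates, since |Phi A| <= |Phi| |A|. *)
have [e1|e1] := lerP 1 e.
  have : p1 * a' <= f * (a * a') by rewrite mulrA ler_wpM2r.
  have : 1 <= (2 + 4 * B ^+ 2) * e by nra.
  by nra.
set E := nm F in hF; have E0 : 0 <= E by apply: nm_ge0.
have xB := bounded_step_nm hx.
have nmFx : nm (F *m x) <= B * E.
  by apply: le_trans (nmM _ _) _; rewrite mulrC ler_wpM2r // nm_ge0.
set q := nm (Phi *m u); set U := nm u; set V := nm v; set V' := nm (v *m x).
have q0 : 0 <= q by apply: nm_ge0.
have U0 : 0 <= U by apply: nm_ge0.
have V0 : 0 <= V by apply: nm_ge0.
have V'0 : 0 <= V' by apply: nm_ge0.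
have h1 : p1 <= q * V + f * E.
  rewrite /p1 defA mulmxDr; apply: le_trans (nmD _ _) _.
  by rewrite mulmxA nm_outer lerD2l nmM.
have h2 : q * V' <= p' + f * (B * E).
  rewrite /q /V' -nm_outer.
  have -> : Phi *m u *m (v *m x) = Phi *m (A *m x) - Phi *m (F *m x).
    by rewrite defA mulmxDl mulmxDr -!mulmxA addrK.
  apply: le_trans (nmB _ _) _; rewrite lerD2l.
  by apply: le_trans (nmM _ _) _; rewrite ler_wpM2l.
have h3 : a' <= U * V' + B * E.
  rewrite /a' {1}defA mulmxDl; apply: le_trans (nmD _ _) _.
  by rewrite -mulmxA nm_outer lerD2l.
have h4 : U * V <= a + E.
  rewrite /U /V -nm_outer; have -> : u *m v = A - F by rewrite defA addrK.
  exact: nmB.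
have h5 : q <= f * U by apply: nmM.
have Ea : E <= a by nra.
have fE : 0 <= f * E by rewrite mulr_ge0.
have s1 : p1 * a' <= q * V * a' + f * E * a' by nra.
have s2 : q * V * a' <= q * V' * (U * V) + q * V * (B * E).
  have qV : 0 <= q * V by rewrite mulr_ge0.
  have := ler_wpM2l qV h3; have -> : q * V' * (U * V) = q * V * (U * V') by ring.
  by rewrite mulrDr.
have s3 : q * V' * (U * V) <= (p' + f * (B * E)) * (a + E).
  by apply: ler_pM; rewrite ?mulr_ge0.
have s4 : q * V * (B * E) <= f * (a + E) * (B * E).
  have BE : 0 <= B * E by rewrite mulr_ge0 // (le_trans ler01).
  apply: ler_wpM2r => //; apply: le_trans (ler_wpM2r V0 h5) _.
  by rewrite -mulrA ler_wpM2l.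
have s5 : p' * E <= f * a' * E by rewrite ler_wpM2r.
have t1 : f * E * a' <= e * (f * (a * a')).
  have -> : e * (f * (a * a')) = (f * a') * (e * a) by ring.
  by rewrite mulrAC ler_wpM2l // mulr_ge0.
have t2 : f * (B * E) * (a + E) <= 2 * B ^+ 2 * e * (f * (a * a')).
  have : f * (B * E) * (a + E) <= f * (B * (e * a)) * (2 * (B * a')).
    apply: ler_pM; rewrite ?mulr_ge0 ?addr_ge0 // ?(le_trans ler01) //.
      by rewrite ler_wpM2l // ler_wpM2l // (le_trans ler01).
    by lra.
  by have -> : f * (B * (e * a)) * (2 * (B * a')) = 2 * B ^+ 2 * e * (f * (a * a')) by ring.
have -> : (2 + 4 * B ^+ 2) * e * f * (a * a') =
  2 * (e * (f * (a * a'))) + 2 * (2 * B ^+ 2 * e * (f * (a * a'))) by ring.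
have : f * (a + E) * (B * E) = f * (B * E) * (a + E) by ring.
have : f * a' * E = f * E * a' by ring.
have : (p' + f * (B * E)) * (a + E) = p' * a + p' * E + f * (B * E) * (a + E) by ring.
by lra.
Qed.

(** Descending from N to k, the errors of [alignment_step] form a geometric series with sum at most
    C t^k / (1 - t) up to the factor in front, so the bound is uniform in N. *)
Lemma alignment_stable p n (B C t : R) (N : nat) (Phi : 'M_(p, n)) (A : nat -> 'M[R]_n) :
  1 <= B -> 0 <= C -> 0 <= t < 1 ->
  (forall k, (k <= N)%N -> A k != 0) ->
  (forall k, (k < N)%N -> exists2 x, bounded_step B x & A k.+1 = A k *m x) ->
  (forall k, (k <= N)%N -> near_rank1 (C * t ^+ k) (A k)) ->
  forall k, (k <= N)%N ->
  nm (Phi *m A k) / nm (A k) <= nm (Phi *m A N) / nm (A N)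
     + (2 + 4 * B ^+ 2) * nm Phi * C / (1 - t) * t ^+ k.
Proof.
move=> B1 C0 /andP[t0 t1] An0 stepA rkA k kN.
have tp : 0 < 1 - t by rewrite subr_gt0.
have -> : k = (N - (N - k))%N by rewrite subKn.
have : (N - k <= N)%N by rewrite leq_subr.
elim: (N - k)%N => [_|m IH mN].
  rewrite subn0 lerDl !mulr_ge0 ?exprn_ge0 ?invr_ge0 ?(ltW tp) //.
  by rewrite addr_ge0 // mulr_ge0 // sqr_ge0.
set l := (N - m.+1)%N; have El : (N - m)%N = l.+1 by rewrite /l; lia.
have lN : (l < N)%N by rewrite /l; lia.
have [x hx Ax] := stepA l lN.
move: (IH (ltnW mN)); rewrite El => {}IH.
have := alignment_step Phi B1 _ hx (rkA l (ltnW lN)).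
rewrite -Ax mulr_ge0 ?exprn_ge0 // => /(_ isT).
set K := 2 + 4 * B ^+ 2 in IH *.
have a0 : 0 < nm (A l) by rewrite nm_gt0 An0 // ltnW.
have a1 : 0 < nm (A l.+1) by rewrite nm_gt0 An0.
move=> h.
have {}h : nm (Phi *m A l) / nm (A l) <= nm (Phi *m A l.+1) / nm (A l.+1)
   + K * (C * t ^+ l) * nm Phi.
  rewrite ler_pdivrMr // -(ler_pM2r a1); apply: le_trans h _.
  rewrite le_eqVlt; apply/orP; left; apply/eqP; field.
  by rewrite gt_eqF.
apply: le_trans h _; rewrite -(lerD2r (K * (C * t ^+ l) * nm Phi)) in IH.
apply: le_trans IH _; rewrite -addrA lerD2l le_eqVlt exprS; apply/orP; left.
by apply/eqP; field; rewrite gt_eqF.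
Qed.

(* With S_k = 1 + t_0 + ... + t_k, the hypothesis t_k <= c th^k S_k makes S_k grow
   slower than th^(-k/2) once c th^k <= 1 - th^(1/2). *)
Lemma summable_feedback (c th b X : R) : 0 <= c -> 0 < th < 1 -> 0 <= X -> 1 <= b ->
  exists L, forall t : nat -> R,
  (forall k, (k <= L)%N -> 0 <= t k <= b ^+ k.+1) ->
  (forall k, (k <= L)%N -> t k <= c * th ^+ k * (1 + \sum_(j < k.+1) t j)) ->
  X * th ^+ L * (1 + \sum_(j < L.+1) t j) < 1.
Proof.
move=> c0 /andP[th0 th1] X0 b1; pose s := Num.sqrt th.
have s0 : 0 < s by rewrite sqrtr_gt0.
have ss : s ^+ 2 = th by rewrite sqr_sqrtr // ltW.
have s1 : s < 1 by nra.
have s1' : 0 < 1 - s by rewrite subr_gt0.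
have [n0 hn0] := @geometric_small th (c / (1 - s)) (introT andP (conj (ltW th0) th1)).
pose Y := 1 + n0.+1%:R * b ^+ n0.+1.
have [j0 hj0] := @geometric_small s (X * Y) (introT andP (conj (ltW s0) s1)).
exists (n0 + j0)%N => t tb tr; set L := (n0 + j0)%N in tb tr *.
pose S k := 1 + \sum_(j < k.+1) t j; rewrite -/(S L).
have S1 k : (k <= L)%N -> 1 <= S k.
  move=> kL; rewrite lerDl; apply: sumr_ge0 => i _.
  by have /andP[] := tb i (leq_trans (leq_ord i) kL).
have Sn0 : S n0 <= Y.
  rewrite lerD2l mulr_natl -[X in _ *+ X]card_ord -sumr_const.
  apply: ler_sum => i _; have iL : (i <= L)%N by have := ltn_ord i; rewrite /L; lia.
  have /andP[_ h] := tb i iL; apply: le_trans h _.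
  by rewrite ler_weXn2l.
(* Past n0 the hypothesis gives t_k <= (1 - s) S_k, that is s S_k <= S_{k-1}: each step multiplies S
   by at most 1/s. *)
have step j : (n0 + j <= L)%N -> s ^+ j * S (n0 + j)%N <= Y.
  elim: j => [_|j IH jL]; first by rewrite expr0 mul1r addn0.
  have {}IH : s ^+ j * S (n0 + j)%N <= Y by apply: IH; lia.
  apply: le_trans IH; rewrite exprS mulrAC mulrC ler_wpM2l ?exprn_ge0 ?(ltW s0) //.
  have h1 := tr _ jL; rewrite -/(S (n0 + j.+1)%N) in h1.
  have h2 : S (n0 + j.+1)%N = S (n0 + j)%N + t (n0 + j.+1)%N.
    by rewrite /S addnS [in LHS]big_ord_recr /= addrA.
  have h3 : c * th ^+ (n0 + j.+1) <= 1 - s.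
    have := hn0 (n0 + j.+1)%N (leq_addr _ _).
    by rewrite mulrAC ltr_pdivrMr // mul1r => /ltW.
  have a0 : 0 <= S (n0 + j.+1)%N by apply: le_trans (S1 _ jL).
  have := le_trans h1 (ler_wpM2r a0 h3).
  by move: h2; set a := S (n0 + j.+1)%N => h2 h4; lra.
have := step j0 (leqnn _); rewrite -/L => hL.
(* Since th = s^2, one factor s^j0 absorbs the growth of S and the other one beats X Y. *)
have thL : th ^+ L <= s ^+ j0 * s ^+ j0.
  rewrite -expr2 -exprM mulnC exprM ss /L exprD ler_piMl ?exprn_ge0 ?(ltW th0) //.
  by rewrite exprn_ile1 // ltW.
apply: le_lt_trans (hj0 j0 (leqnn _)).
have SL0 : 0 <= S L by apply: le_trans (S1 L _).
rewrite -!mulrA ler_wpM2l //; apply: le_trans (ler_wpM2r SL0 thL) _.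
by rewrite -mulrA [Y * _]mulrC ler_wpM2l // exprn_ge0 // ltW.
Qed.

End QuasiMultiplicativity.

(** * Chains of bounded steps and the lower bound for the norm of a product *)

Section Chains.
Variable R : realType.

Definition right_chain n (B : R) (N : nat) (H : nat -> 'M[R]_n) : Prop :=
  H 0%N = 1%:M /\
  forall k, (k < N)%N -> exists2 x, bounded_step B x & H k.+1 = H k *m x.

Definition left_chain n (B : R) (N : nat) (G : nat -> 'M[R]_n) : Prop :=
  right_chain B N (fun k => (G k)^T).

Lemma right_chain_nm n B N (H : nat -> 'M[R]_n) p (P : 'M_(p, n)) k :
  1 <= B -> right_chain B N H -> (k <= N)%N ->
  nm (P *m H k) <= B ^+ k * nm P /\ nm P <= B ^+ k * nm (P *m H k).
Proof.
move=> B1 [H0 stepH]; have B0 : 0 <= B by apply: le_trans B1.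
elim: k => [_|k IH kN]; first by rewrite H0 mulmx1 expr0 mul1r.
have [h1 h2] := IH (ltnW kN); have [x hx ->] := stepH k kN.
rewrite mulmxA exprS; split.
  apply: le_trans (nmM _ _) _; rewrite mulrC -mulrA; apply: ler_pM => //.
  exact: bounded_step_nm hx.
apply: le_trans h2 _; rewrite [B * _]mulrC -mulrA ler_wpM2l ?exprn_ge0 //.
exact: bounded_step_nmr.
Qed.

Lemma left_chain_nm n B N (G : nat -> 'M[R]_n) p (P : 'M_(n, p)) k :
  1 <= B -> left_chain B N G -> (k <= N)%N ->
  nm (G k *m P) <= B ^+ k * nm P /\ nm P <= B ^+ k * nm (G k *m P).
Proof.
move=> B1 hG kN; have := right_chain_nm P^T B1 hG kN.
by rewrite /= -trmx_mul !nmT.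
Qed.

Lemma dual_vector n (phi : 'rV[R]_n) : phi != 0 ->
  exists2 w : 'cV_n, phi *m w = 1%:M & nm w * nm phi <= n%:R.
Proof.
case: n phi => [|n] phi phi0; first by rewrite thinmx0 eqxx in phi0.
have [j hj] := max_entry phi (ltn0Sn n).
have p0 : 0 < nm phi by rewrite nm_gt0.
have pj : 0 < `|phi 0 j|.
  by have := lt_le_trans p0 hj; rewrite pmulr_rgt0 // ltr0n.
have pj0 : phi 0 j != 0 by rewrite -normr_gt0.
exists ((phi 0 j)^-1 *: delta_mx j 0).
  rewrite -scalemxAr; apply/matrixP => a b; rewrite !ord1 !mxE (bigD1 j) //= big1.
    by rewrite !mxE !eqxx mulr1 addr0 mulVf.
  by move=> l lj; rewrite !mxE (negPf lj) mulr0.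
by rewrite nmZ nm_delta mulr1 normfV mulrC ler_pdivrMr.
Qed.

(** With X close to u v, the vanishing of row i of X Q makes u_i times v Q small. If row i of X is a
    definite part of X, then u_i is not small, so v Q is, and with it X Q. *)
Lemma projected_rank1 n (e : R) (X Q : 'M[R]_n) i :
  0 <= e <= 1 -> near_rank1 e X -> row i (X *m Q) = 0 ->
  nm (row i X) * nm (X *m Q) <= 5 * e * nm Q * nm X ^+ 2.
Proof.
move=> /andP[e0 e1] [u [v hF]] rQ; set F := X - u *m v in hF.
have defX : X = u *m v + F by rewrite /F addrC subrK.
set a := nm X in hF *; have a0 : 0 <= a by apply: nm_ge0.
set q := nm Q; have q0 : 0 <= q by apply: nm_ge0.
set E := nm F in hF; have E0 : 0 <= E by apply: nm_ge0.
have rowF : nm (row i F) <= E by apply: nm_row_le.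
have rowX : nm (row i X) <= a by apply: nm_row_le.
set r := nm (row i X) in rowX *; have r0 : 0 <= r by apply: nm_ge0.
have Ea : E <= a by nra.
have rowuv (w : 'rV[R]_n) : row i (u *m w) = u i 0 *: w.
  by apply/rowP => k; rewrite !mxE big_ord1.
set b := `|u i 0|; set U := nm u; set V := nm v; set VQ := nm (v *m Q).
have b0 : 0 <= b by apply: normr_ge0.
have U0 : 0 <= U by apply: nm_ge0.
have V0 : 0 <= V by apply: nm_ge0.
have VQ0 : 0 <= VQ by apply: nm_ge0.
have hr : r <= b * V + E.
  rewrite /r defX linearD /= rowuv; apply: le_trans (nmD _ _) _.
  by rewrite nmZ lerD2l.
have hb : b * VQ <= E * q.
  rewrite /b /VQ -nmZ -rowuv.
  have -> : row i (u *m (v *m Q)) = - (row i F *m Q).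
    apply/eqP; rewrite -subr_eq0 opprK -row_mul mulmxA -linearD /= -mulmxDl -defX.
    by rewrite rQ.
  by rewrite nmN; apply: le_trans (nmM _ _) _; rewrite ler_wpM2r.
have hUV : U * V <= a + E.
  rewrite /U /V -nm_outer; have -> : u *m v = X - F by rewrite defX addrK.
  exact: nmB.
have hXQ : nm (X *m Q) <= U * VQ + E * q.
  rewrite defX mulmxDl; apply: le_trans (nmD _ _) _.
  by rewrite -mulmxA nm_outer lerD2l nmM.
have hVQ : VQ <= V * q by apply: nmM.
have s1 : r * nm (X *m Q) <= r * (U * VQ) + r * (E * q).
  by rewrite -mulrDr ler_wpM2l.
have s2 : r * (U * VQ) <= (b * VQ) * (U * V) + E * (U * VQ).
  have := ler_wpM2r (mulr_ge0 U0 VQ0) hr.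
  by have -> : (b * V + E) * (U * VQ) = (b * VQ) * (U * V) + E * (U * VQ) by ring.
have s3 : (b * VQ) * (U * V) <= (E * q) * (a + E) by apply: ler_pM; rewrite ?mulr_ge0.
have s4 : E * (U * VQ) <= E * ((a + E) * q).
  apply: ler_wpM2l => //; apply: le_trans (ler_wpM2l U0 hVQ) _.
  by rewrite mulrA ler_wpM2r.
have Eq0 : 0 <= E * q by rewrite mulr_ge0.
have s5 : (E * q) * (a + E) <= 2 * ((E * q) * a) by nra.
have s6 : r * (E * q) <= (E * q) * a by rewrite mulrC ler_wpM2l.
have s7 : (E * q) * a <= e * q * a ^+ 2.
  have -> : e * q * a ^+ 2 = (e * a * q) * a by ring.
  by rewrite ler_wpM2r // ler_wpM2r.
have : E * ((a + E) * q) = (E * q) * (a + E) by ring.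
by lra.
Qed.

(** By contradiction, with a heaviest row r of [G M], normalised, as test covector. The loss at
    stage k is |H_k| / |r H_k|. It is at most a constant times 1 + t_0 + ... + t_k, where t_k
    measures the part of H_k that r misses, and t_k is at most a constant times th^k times the loss.
    This is the feedback that [summable_feedback] controls: at a fixed stage L the loss stays below
    a constant times th^-L, while a very small G_M H_N would force it above. *)
Theorem quasi_multiplicative n (B C th : R) :
  (0 < n)%N -> 1 <= B -> 1 <= C -> 0 < th < 1 ->
  exists2 d, 0 < d & forall (G H : nat -> 'M[R]_n) M N,
    left_chain B M G -> right_chain B N H ->
    (forall m k, (m <= M)%N -> (k <= N)%N ->
        near_rank1 (C * th ^+ (m + k)) (G m *m H k)) ->
    d * (nm (G M) * nm (H N)) <= nm (G M *m H N).
Proof.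
move=> n0 B1 C1 th01; have /andP[th0 th1] := th01.
have thW : 0 <= th < 1 by rewrite (ltW th0).
have B0 : 0 < B by apply: lt_le_trans B1.
have C0 : 0 <= C by apply: le_trans C1.
have nR1 : 1 <= n%:R :> R by rewrite ler1n.
have nR : 0 < n%:R :> R by apply: lt_le_trans nR1.
have thp : 0 < 1 - th by rewrite subr_gt0.
pose K2 := (2 + 4 * B ^+ 2) * C / (1 - th).
have B2 : 0 <= B ^+ 2 by rewrite sqr_ge0.
have K20 : 0 <= K2.
  by apply: divr_ge0 (ltW thp); apply: mulr_ge0 => //; lra.
pose C3 := 2 * n%:R * (5 * C + K2).
have C30 : 0 <= C3 by apply: mulr_ge0; lra.
pose c1 := n%:R * (B ^+ 2 + 1); have c10 : 0 <= c1 by apply: mulr_ge0; lra.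
pose c2 := n%:R + c1 + 1.
have c20 : 0 <= c2 by rewrite /c2; lra.
have [||||L hL] := @summable_feedback R (C3 * c2) th (2 * n%:R ^+ 2 * B ^+ 2)
   ((1 + K2) * c2) => //; first by rewrite mulr_ge0.
- by rewrite mulr_ge0 ?addr_ge0.
- have : 1 <= n%:R ^+ 2 :> R by rewrite exprn_ege1.
  have : 1 <= B ^+ 2 by rewrite exprn_ege1.
  by nra.
have [M0 hM0] := @geometric_small R th (n%:R * B ^+ L ^+ 2) thW.
pose b1 := n%:R * B ^+ (M0 + L) ^+ 2; pose b2 := th ^+ L / n%:R.
have Bp k : 0 < B ^+ k by rewrite exprn_gt0.
have Bk k : 1 <= B ^+ k by rewrite exprn_ege1.
have Bmono k l : (k <= l)%N -> B ^+ k <= B ^+ l by move=> kl; rewrite ler_weXn2l.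
have b1p : 1 <= b1.
  by have := exprn_ege1 2 (Bk (M0 + L)%N); rewrite /b1; nra.
have b1i : b1^-1 <= 1 by rewrite invf_le1 // (lt_le_trans ltr01).
have b1i0 : 0 < b1^-1 by rewrite invr_gt0 (lt_le_trans ltr01).
have b20 : 0 < b2 by rewrite divr_gt0 // exprn_gt0.
have b21 : b2 <= 1.
  rewrite ler_pdivrMr // mul1r; apply: le_trans nR1.
  by rewrite exprn_ile1 // ltW.
exists (b1^-1 * b2); first by rewrite mulr_gt0.
move=> G H M N hG hH rk1.
have GHpos := fun m k (hm : (m <= M)%N) (hk : (k <= N)%N) =>
  right_chain_nm (G m) B1 hH hk.
have nmGp m : (m <= M)%N -> 0 < nm (G m).
  move=> hm; have [_] := left_chain_nm 1%:M B1 hG hm.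
  by rewrite mulmx1 nm1 => h; have := lt_le_trans nR h; rewrite pmulr_rgt0.
have nmGHp m k : (m <= M)%N -> (k <= N)%N -> 0 < nm (G m *m H k).
  move=> hm hk; have [_ h] := GHpos m k hm hk.
  by have := lt_le_trans (nmGp m hm) h; rewrite pmulr_rgt0.
have G1 : G 0%N = 1%:M by have [h _] := hG; rewrite -[LHS]trmxK h trmx1.
have H1 : H 0%N = 1%:M by case: hH.
have nmHp k : (k <= N)%N -> 0 < nm (H k).
  by move=> hk; have := nmGHp 0%N k (leq0n _) hk; rewrite G1 mul1mx.
have [GnM1 GnM2] := left_chain_nm 1%:M B1 hG (leqnn M).
have [HnN1 HnN2] := right_chain_nm 1%:M B1 hH (leqnn N).
rewrite mulmx1 nm1 in GnM1 GnM2; rewrite mul1mx nm1 in HnN1 HnN2.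
have GMp := nmGp M (leqnn M); have HNp := nmHp N (leqnn N).
have GHp := nmGHp M N (leqnn M) (leqnn N).
(* At most M0 + L steps distort norms by a bounded factor; this settles the cases M < M0 and N <
   L. *)
have easy k : (k <= M0 + L)%N ->
    nm (G M) * nm (H N) <= (B ^+ k * n%:R) * (B ^+ k * nm (G M *m H N)) ->
    b1^-1 * b2 * (nm (G M) * nm (H N)) <= nm (G M *m H N).
  move=> hk h.
  have s1 : b1^-1 * b2 * (nm (G M) * nm (H N)) <= b1^-1 * (nm (G M) * nm (H N)).
    by apply: ler_wpM2r; rewrite ?mulr_ge0 // ler_piMr // ltW.
  apply: le_trans s1 _; rewrite mulrC ler_pdivrMr ?(lt_le_trans ltr01) //.
  apply: le_trans h _; rewrite /b1 mulrC.
  have -> : B ^+ k * nm (G M *m H N) * (B ^+ k * n%:R) =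
    nm (G M *m H N) * (n%:R * (B ^+ k) ^+ 2) by ring.
  by rewrite ler_wpM2l // ler_wpM2l ?(ltW nR) // lerXn2r ?nnegrE ?(ltW (Bp _)) ?Bmono.
have [MM0|MM0] := ltnP M M0.
  apply: (easy M); first exact: leq_trans (ltnW MM0) (leq_addr _ _).
  have [_ h] := left_chain_nm (H N) B1 hG (leqnn M).
  by apply: ler_pM.
have [NL|NL] := ltnP N L.
  apply: (easy N); first exact: leq_trans (ltnW NL) (leq_addl _ _).
  have [_ h] := GHpos M N (leqnn M) (leqnn N).
  by rewrite mulrC; apply: ler_pM.
rewrite leNgt; apply/negP => small.
have {}small : nm (G M *m H N) < b2 * (nm (G M) * nm (H N)).
  apply: lt_le_trans small _; rewrite -mulrA ler_piMl // mulr_ge0 ?(ltW b20) //.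
  by rewrite mulr_ge0.
have [i hi] := max_row (G M) n0.
set r := row i (G M) in hi.
have rp : 0 < nm r by have := lt_le_trans GMp hi; rewrite pmulr_rgt0.
pose phi0 := (nm r)^-1 *: r; pose phi k := phi0 *m H k.
have nphi0 : nm phi0 = 1 by rewrite nmZ ger0_norm ?invr_ge0 // mulVf // gt_eqF.
have phib k : (k <= N)%N -> 1 <= B ^+ k * nm (phi k).
  by move=> hk; have [_] := right_chain_nm phi0 B1 hH hk; rewrite nphi0.
have phip k : (k <= N)%N -> 0 < nm (phi k).
  by move=> hk; have := lt_le_trans ltr01 (phib k hk); rewrite pmulr_rgt0.
have /choice[w hw] : forall k, exists w : 'cV_n,
    (k <= N)%N -> phi k *m w = 1%:M /\ nm w * nm (phi k) <= n%:R.
  move=> k; have [hk|] := leqP k N; last by exists 0.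
  have [|w h1 h2] := @dual_vector n (phi k); first by rewrite -nm_gt0 phip.
  by exists w.
(* The projection onto the kernel of [phi k] along [w k]. *)
pose Pi k := 1%:M - w k *m phi k.
have phiPi k : (k <= N)%N -> phi k *m Pi k = 0.
  by move=> hk; rewrite mulmxBr mulmxA (hw k hk).1 mulmx1 mul1mx subrr.
have nPi k : (k <= N)%N -> nm (Pi k) <= 2 * n%:R.
  move=> hk; apply: le_trans (nmB _ _) _.
  by rewrite nm1 nm_outer mulr_natl mulr2n lerD2l (hw k hk).2.
pose t k := nm (H k *m Pi k) / nm (phi k).
have t0 k : 0 <= t k by rewrite divr_ge0.
(* Row i of G_M H_k is a multiple of [phi k], hence is killed by [Pi k], and [projected_rank1] makes
   G_M H_k Pi_k small. [alignment_stable], applied to the transposes with [(Pi k)^T] as test matrix,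
   carries this back from m = M to m = 0. *)
have aligned k : (k <= L)%N -> nm (H k *m Pi k) <= C3 * th ^+ k * nm (H k).
  move=> kL; have kN : (k <= N)%N by apply: leq_trans NL.
  have a1 m : (m <= M)%N -> (G m *m H k)^T != 0.
    by move=> hm; rewrite -nm_gt0 nmT nmGHp.
  have a2 m : (m < M)%N ->
      exists2 x, bounded_step B x & (G m.+1 *m H k)^T = (G m *m H k)^T *m x.
    move=> hm; have [x hx xE] := hG.2 m hm; exists x => //.
    by rewrite !trmx_mul xE mulmxA.
  have a3 m : (m <= M)%N -> near_rank1 (C * th ^+ k * th ^+ m) (G m *m H k)^T.
    by move=> hm; apply: near_rank1T; rewrite -mulrA -exprD addnC; apply: rk1.
  have := @alignment_stable R _ _ B (C * th ^+ k) th M (Pi k)^T _ B1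
    (mulr_ge0 C0 (exprn_ge0 _ (ltW th0))) thW a1 a2 a3 0%N (leq0n _).
  rewrite -!trmx_mul !nmT expr0 mulr1 G1 mul1mx.
  have Hk := nmHp k kN; have GHk := nmGHp M k (leqnn M) kN.
  set X := G M *m H k in GHk *.
  have rX : row i X = r *m H k by rewrite row_mul.
  have rXPi : row i (X *m Pi k) = 0.
    rewrite row_mul rX; have := phiPi k kN; rewrite /phi /phi0 -!scalemxAl => /eqP.
    by rewrite scaler_eq0 invr_eq0 gt_eqF //= => /eqP.
  have thMk : th ^+ (M + k) <= th ^+ k.
    by rewrite exprD ler_piMl ?exprn_ge0 ?(ltW th0) // exprn_ile1 ?ltW.
  move=> h.
  have [ek|ek] := lerP (C * th ^+ (M + k)) 1; last first.
    apply: le_trans (nmM _ _) _; rewrite mulrC ler_wpM2r //.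
    apply: le_trans (nPi k kN) _; rewrite /C3 -mulrA.
    rewrite -{1}[2 * n%:R]mulr1 ler_wpM2l // ?mulr_ge0 ?(ltW nR) //.
    have e0 : 0 <= th ^+ k by rewrite exprn_ge0 // ltW.
    have Ke : 0 <= K2 * th ^+ k by rewrite mulr_ge0.
    have := ler_wpM2l C0 thMk; lra.
  have e0 : 0 <= C * th ^+ (M + k) by rewrite mulr_ge0 ?exprn_ge0 // ltW.
  have hproj := projected_rank1 (introT andP (conj e0 ek)) (rk1 M k (leqnn M) kN) rXPi.
  rewrite -/X in hproj.
  have hrX : nm X <= n%:R * B ^+ L ^+ 2 * nm (row i X).
    have [h1 _] := GHpos M k (leqnn M) kN; have [_ h2] := right_chain_nm r B1 hH kN.
    rewrite -rX in h2; apply: le_trans h1 _.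
    apply: le_trans (ler_wpM2l (ltW (Bp k)) hi) _.
    rewrite mulrCA -[leRHS]mulrA ler_wpM2l ?(ltW nR) //.
    apply: le_trans (ler_wpM2l (ltW (Bp k)) h2) _.
    rewrite [leLHS]mulrA ler_wpM2r //= -[leLHS]expr2 lerXn2r ?nnegrE ?(ltW (Bp _)) //.
    exact: Bmono.
  have h5 : nm (X *m Pi k) / nm X <= 5 * C * th ^+ k * nm (Pi k).
    rewrite ler_pdivrMr // -(ler_pM2l GHk).
    have hthM := ltW (hM0 M MM0); rewrite -exprM muln2 in hthM.
    apply: le_trans (_ : n%:R * B ^+ L ^+ 2 * (nm (row i X) * nm (X *m Pi k)) <= _).
      by rewrite mulrA ler_wpM2r.
    apply: le_trans (ler_wpM2l _ hproj) _.
      by rewrite mulr_ge0 ?exprn_ge0 ?(ltW nR) // ltW.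
    rewrite exprD -exprM muln2.
    have -> : n%:R * B ^+ L.*2 * (5 * (C * (th ^+ M * th ^+ k)) * nm (Pi k) * nm X ^+ 2)
      = (n%:R * B ^+ L.*2 * th ^+ M) * (nm X * (5 * C * th ^+ k * nm (Pi k) * nm X)) by ring.
    have thk0 : 0 <= th ^+ k by rewrite exprn_ge0 // ltW.
    by rewrite ler_piMl // !mulr_ge0.
  have h6 : nm (H k *m Pi k) / nm (H k) <= C3 * th ^+ k.
    apply: le_trans h _; apply: le_trans (lerD h5 (lexx _)) _.
    have -> : 5 * C * th ^+ k * nm (Pi k) + (2 + 4 * B ^+ 2) * nm (Pi k) *
      (C * th ^+ k) / (1 - th) = nm (Pi k) * ((5 * C + K2) * th ^+ k).
      by rewrite /K2; field; rewrite gt_eqF.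
    rewrite /C3 -[in X in _ <= X]mulrA ler_wpM2r ?nPi //.
    by rewrite mulr_ge0 ?exprn_ge0 ?(ltW th0) // addr_ge0 // mulr_ge0.
  by rewrite -ler_pdivrMr.
(* With y_k = H_k w_k one has H_k = H_k Pi_k + y_k phi_k, and y_{j+1} - y_j factors through H_j
   Pi_j, so its norm is at most c1 t_j. *)
have ratio k : (k <= L)%N ->
    nm (H k) / nm (phi k) <= c2 * (1 + \sum_(j < k.+1) t j).
  move=> kL; have kN : (k <= N)%N by apply: leq_trans NL.
  pose y j := H j *m w j.
  have yb j : (j <= N)%N -> nm (y j) <= n%:R + c1 * \sum_(l < j) t l.
    elim: j => [_|j IH jN].
      rewrite big_ord0 mulr0 addr0 /y H1 mul1mx; have [_] := hw 0%N (leq0n _).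
      by rewrite /phi H1 mulmx1 nphi0 mulr1.
    have {}IH := IH (ltnW jN); have [x hx HE] := hH.2 j jN.
    have [w1 w2] := hw j (ltnW jN); have [w1' w2'] := hw j.+1 jN.
    have phE : phi j.+1 = phi j *m x by rewrite /phi HE mulmxA.
    have -> : y j.+1 = y j + H j *m Pi j *m (x *m w j.+1 - w j).
      have -> : H j *m Pi j = H j - H j *m (w j *m phi j) by rewrite mulmxBr mulmx1.
      rewrite mulmxBl; set z := x *m w j.+1 - w j.
      have -> : H j *m (w j *m phi j) *m z = 0.
        rewrite -[LHS]mulmxA -[w j *m phi j *m z]mulmxA (_ : phi j *m z = 0) ?mulmx0 //.
        by rewrite mulmxBr mulmxA -phE w1 w1' subrr.
      by rewrite subr0 mulmxBr mulmxA -HE addrC subrK.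
    apply: le_trans (nmD _ _) _; rewrite big_ord_recr /= mulrDr addrA.
    apply: lerD => //; apply: le_trans (nmM _ _) _.
    have pj := phip j (ltnW jN); have pj1 := phip j.+1 jN.
    have hphi := bounded_step_nmr (phi j) hx; rewrite -phE in hphi.
    have hww : nm (x *m w j.+1 - w j) <= c1 / nm (phi j).
      apply: le_trans (nmB _ _) _; rewrite ler_pdivlMr // mulrDl.
      apply: le_trans (_ : B ^+ 2 * n%:R + n%:R <= _); last by rewrite /c1; lra.
      apply: lerD => //; apply: le_trans (ler_wpM2r (ltW pj) (nmM _ _)) _.
      have xB := bounded_step_nm hx.
      rewrite expr2 -!mulrA; apply: ler_pM => //; first by rewrite mulr_ge0.
      apply: le_trans (ler_wpM2l _ hphi) _ => //.
      by rewrite mulrCA ler_wpM2l // ltW.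
    apply: le_trans (ler_wpM2l _ hww) _ => //.
    by rewrite /t mulrCA.
  have hk : nm (H k) <= nm (H k *m Pi k) + nm (y k) * nm (phi k).
    have {1}-> : H k = H k *m Pi k + y k *m phi k.
      by rewrite /Pi mulmxBr mulmx1 mulmxA subrK.
    by rewrite -nm_outer nmD.
  rewrite ler_pdivrMr ?phip //; apply: le_trans hk _.
  rewrite -(ler_pdivrMr _ _ (phip k kN)) mulrDl mulfK ?gt_eqF ?phip // -/(t k).
  have := yb k kN; rewrite big_ord_recr /=.
  have s0 : 0 <= \sum_(l < k) t l by apply: sumr_ge0.
  have tk := t0 k; set s := \sum_(l < k) t l in s0 *.
  have cs : 0 <= n%:R * s by rewrite mulr_ge0 // ltW.
  have ct : 0 <= n%:R * t k by rewrite mulr_ge0 // ltW.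
  have ct1 : 0 <= c1 * t k by rewrite mulr_ge0.
  have -> : c2 * (1 + (s + t k)) = n%:R + c1 + 1 + n%:R * s + c1 * s + s + n%:R * t k + c1 * t k + t k.
    by rewrite /c2; ring.
  lra.
(* A crude bound, which [summable_feedback] uses for the finitely many terms before the decay sets
   in. *)
have tb k : (k <= L)%N -> 0 <= t k <= (2 * n%:R ^+ 2 * B ^+ 2) ^+ k.+1.
  move=> kL; have kN : (k <= N)%N by apply: leq_trans NL.
  rewrite t0 /t ler_pdivrMr ?phip //.
  have [h1 _] := right_chain_nm 1%:M B1 hH kN; rewrite mul1mx nm1 in h1.
  apply: le_trans (nmM _ _) _.
  apply: le_trans (ler_pM _ _ h1 (nPi k kN)) _ => //.
  have -> : (2 * n%:R ^+ 2 * B ^+ 2) ^+ k.+1 * nm (phi k) =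
     (2 * n%:R ^+ 2) ^+ k.+1 * B ^+ k.+2 * (B ^+ k * nm (phi k)).
    by rewrite exprMn -exprM mul2n -addnn !exprD !exprS; ring.
  apply: le_trans (_ : (2 * n%:R ^+ 2) * B ^+ k * 1 <= _); first by lra.
  apply: ler_pM; rewrite ?phib // ?mulr_ge0 ?exprn_ge0 // ?(ltW nR) // ?(ltW B0) //.
  apply: ler_pM; rewrite ?mulr_ge0 ?exprn_ge0 // ?(ltW nR) // ?(ltW B0) //.
    have : 1 <= n%:R ^+ 2 :> R by rewrite exprn_ege1.
    by move=> h; rewrite ler_eXnr //; lra.
  by apply: Bmono; apply: leqW (leqnSn _).
have tf k : (k <= L)%N -> t k <= C3 * c2 * th ^+ k * (1 + \sum_(j < k.+1) t j).
  move=> kL; have kN : (k <= N)%N by apply: leq_trans NL.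
  rewrite /t ler_pdivrMr ?phip //; apply: le_trans (aligned k kL) _.
  have h := ratio k kL; rewrite ler_pdivrMr ?phip // in h.
  have thk : 0 <= C3 * th ^+ k by rewrite mulr_ge0 ?exprn_ge0 // ltW.
  apply: le_trans (ler_wpM2l thk h) _.
  by rewrite le_eqVlt; apply/orP; left; apply/eqP; ring.
have LN := NL.
have HL := nmHp L LN; have pL := phip L LN.
(* The negated conclusion, with b2 = th^L / n, gives |phi_N| <= th^L |H_N|; [alignment_stable]
   brings this back from N to L. *)
have hphiL : nm (phi L) <= (1 + K2) * th ^+ L * nm (H L).
  have a1 m : (m <= N)%N -> H m != 0 by move=> hm; rewrite -nm_gt0 nmHp.
  have a2 m : (m <= N)%N -> near_rank1 (C * th ^+ m) (H m).
    by move=> hm; have := rk1 0%N m (leq0n _) hm; rewrite G1 mul1mx.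
  have := @alignment_stable R _ _ B C th N phi0 H B1 C0 thW a1 hH.2 a2 L LN.
  rewrite nphi0 mulr1 -/K2 -/(phi L) => h.
  rewrite -ler_pdivrMr //; apply: le_trans h _; rewrite mulrDl mul1r lerD2r.
  rewrite ler_pdivrMr // /phi0 -scalemxAl nmZ ger0_norm ?invr_ge0 // mulrC.
  rewrite ler_pdivrMr // -row_mul.
  apply: le_trans (nm_row_le _ _) _.
  apply: le_trans (ltW small) _; rewrite /b2 -mulrA [leRHS]mulrAC -[leRHS]mulrA.
  rewrite ler_wpM2l ?exprn_ge0 ?(ltW th0) // mulrC ler_pdivrMr //.
  have := ler_wpM2r (ltW HNp) hi.
  by have -> : nm r * nm (H N) * n%:R = n%:R * nm r * nm (H N) by ring.
have := hL t tb tf; rewrite ltNge => /negP; apply.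
have h := ratio L (leqnn L); rewrite ler_pdivrMr // in h.
have Kth : 0 <= (1 + K2) * th ^+ L by rewrite mulr_ge0 ?addr_ge0 // exprn_ge0 // ltW.
have := le_trans hphiL (ler_wpM2l Kth h).
rewrite -{1}[nm (phi L)]mul1r.
have -> : (1 + K2) * th ^+ L * (c2 * (1 + \sum_(j < L.+1) t j) * nm (phi L)) =
  (1 + K2) * c2 * th ^+ L * (1 + \sum_(j < L.+1) t j) * nm (phi L) by ring.
by rewrite ler_pM2r.
Qed.

End Chains.

(** * Products and traces of matrices close to rank one *)

Section RankOne.
Variable R : realType.

(** With B close to u v, the first hypothesis bounds |A u| below, the second |v C|, and A B C is
    close to the outer product of A u and v C, whose norm is the product of the two. The bound on e
    keeps the errors below the main term of order c^2. *)
Lemma concat_through_rank1 n (c e : R) (A B C : 'M[R]_n) :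
  0 < c <= 1 -> e <= c ^+ 2 / 16 -> near_rank1 e B ->
  c * (nm A * nm B) <= nm (A *m B) -> c * (nm B * nm C) <= nm (B *m C) ->
  c ^+ 2 / 4 * (nm A * nm B * nm C) <= nm (A *m B *m C).
Proof.
move=> /andP[c0 c1] ec [u [v hF]] hAB hBC; set F := B - u *m v in hF.
have [B0|B0] := eqVneq B 0.
  have -> : nm B = 0 by apply/eqP; rewrite nm_eq0 B0.
  by rewrite mulr0 mul0r mulr0.
have bp : 0 < nm B by rewrite nm_gt0.
have defB : B = u *m v + F by rewrite /F addrC subrK.
set a := nm A in hAB *; set b := nm B in hF hAB hBC bp *; set d := nm C in hBC *.
have a0 : 0 <= a by apply: nm_ge0.
have d0 : 0 <= d by apply: nm_ge0.
set E := nm F in hF; have E0 : 0 <= E by apply: nm_ge0.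
have cc : c ^+ 2 <= c by rewrite expr2; nra.
have Eb : E <= c ^+ 2 / 16 * b by nra.
set Au := nm (A *m u); set vC := nm (v *m C); set U := nm u; set V := nm v.
have Au0 : 0 <= Au by apply: nm_ge0.
have vC0 : 0 <= vC by apply: nm_ge0.
have U0 : 0 <= U by apply: nm_ge0.
have V0 : 0 <= V by apply: nm_ge0.
have h1 : nm (A *m B) <= Au * V + a * E.
  rewrite defB mulmxDr; apply: le_trans (nmD _ _) _.
  by rewrite mulmxA nm_outer lerD2l nmM.
have h2 : nm (B *m C) <= U * vC + E * d.
  rewrite defB mulmxDl; apply: le_trans (nmD _ _) _.
  by rewrite -mulmxA nm_outer lerD2l nmM.
have h3 : Au * vC <= nm (A *m B *m C) + a * E * d.
  rewrite /Au /vC -nm_outer.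
  have -> : A *m u *m (v *m C) = A *m B *m C - A *m F *m C.
    by rewrite defB mulmxDr mulmxDl !mulmxA addrK.
  apply: le_trans (nmB _ _) _; rewrite lerD2l.
  by apply: le_trans (nmM _ _) _; rewrite ler_wpM2r // nmM.
have h4 : U * V <= 17 / 16 * b.
  rewrite /U /V -nm_outer; have -> : u *m v = B - F by rewrite defB addrK.
  by apply: le_trans (nmB _ _) _; rewrite -/b -/E; nra.
have Eb' : E <= c / 16 * b by nra.
have aE : a * E <= c / 16 * (a * b) by rewrite mulrCA ler_wpM2l.
have Ed : E * d <= c / 16 * (b * d) by rewrite mulrA ler_wpM2r.
have k1 : 15 / 16 * c * (a * b) <= Au * V by lra.
have k2 : 15 / 16 * c * (b * d) <= U * vC by lra.
have k3 : (15 / 16 * c * (a * b)) * (15 / 16 * c * (b * d)) <= (Au * V) * (U * vC).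
  have c'0 : 0 <= 15 / 16 * c by lra.
  by apply: ler_pM => //; apply: mulr_ge0 => //; apply: mulr_ge0 => //; apply: ltW.
have k4 : (Au * V) * (U * vC) <= (Au * vC) * (17 / 16 * b).
  have -> : Au * V * (U * vC) = (Au * vC) * (U * V) by ring.
  by rewrite ler_wpM2l // mulr_ge0.
have k5 : 225 / 272 * (c ^+ 2 * (a * b * d)) <= Au * vC.
  have hh := le_trans k3 k4.
  have bb : 0 < 17 / 16 * b by lra.
  rewrite -(ler_pM2r bb); apply: le_trans _ hh.
  by rewrite le_eqVlt; apply/orP; left; apply/eqP; field.
have k6 : a * E * d <= c ^+ 2 / 16 * (a * b * d).
  have -> : c ^+ 2 / 16 * (a * b * d) = a * (c ^+ 2 / 16 * b) * d by ring.
  by rewrite ler_wpM2r // ler_wpM2l.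
have k7 : 0 <= c ^+ 2 * (a * b * d).
  by rewrite mulr_ge0 ?sqr_ge0 // !mulr_ge0 // ltW.
by lra.
Qed.

(** With A close to u v and s = v u, the square of A is close to s u v, so a large |A A| forces |s|
    to be of order c |A|; and tr A differs from s by the trace of the error. *)
Lemma trace_lower_bound n (c e : R) (A : 'M[R]_n) :
  0 < c <= 1 -> 0 <= e <= c / 16 -> near_rank1 e A ->
  c * nm A ^+ 2 <= nm (A *m A) -> c / 4 * nm A <= `|\tr A|.
Proof.
move=> /andP[c0 c1] /andP[e0 ec] [u [v hF]] hAA; set F := A - u *m v in hF.
have [A0|A0] := eqVneq A 0.
  have -> : nm A = 0 by apply/eqP; rewrite nm_eq0 A0.
  by rewrite mulr0.
have ap : 0 < nm A by rewrite nm_gt0.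
have defA : A = u *m v + F by rewrite /F addrC subrK.
set a := nm A in hF hAA ap *.
set E := nm F in hF; have E0 : 0 <= E by apply: nm_ge0.
have Ea : E <= c / 16 * a by nra.
set s := (v *m u) 0 0.
have vu : v *m u = s%:M by rewrite [LHS]mx11_scalar.
have h4 : nm (u *m v) <= 17 / 16 * a.
  have -> : u *m v = A - F by rewrite defA addrK.
  by apply: le_trans (nmB _ _) _; rewrite -/a -/E; nra.
set p := nm (u *m v) in h4; have p0 : 0 <= p by apply: nm_ge0.
have h5 : nm (A *m A) <= `|s| * p + (a + p) * E.
  have -> : A *m A = s *: (u *m v) + (u *m v *m F + F *m A).
    rewrite addrA {1}defA mulmxDl; congr (_ + _).
    rewrite [X in _ *m X = _]defA mulmxDr; congr (_ + _).
    by rewrite -mulmxA (mulmxA v) vu mul_scalar_mx -scalemxAr.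
  apply: le_trans (nmD _ _) _; rewrite nmZ lerD2l.
  apply: le_trans (nmD _ _) _; rewrite mulrDl addrC.
  by apply: lerD; rewrite ?nmM // mulrC nmM.
have h6 : (a + p) * E <= 33 / 16 * a * (c / 16 * a).
  by apply: ler_pM => //; [rewrite addr_ge0 // ltW | lra].
have h7 : `|s| * p <= `|s| * (17 / 16 * a) by rewrite ler_wpM2l.
have h8 : 223 / 256 * c * a <= `|s| * (17 / 16).
  rewrite -(ler_pM2r ap); move: hAA; rewrite expr2 => hAA.
  have -> : `|s| * (17 / 16) * a = `|s| * (17 / 16 * a) by ring.
  by lra.
have htr : \tr A = s + \tr F.
  by rewrite {1}defA mxtraceD mxtrace_mulC vu mxtrace_scalar.
have hF2 := trmx_bound F; rewrite -/E in hF2.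
have : `|s| <= `|\tr A| + `|\tr F|.
  have {1}-> : s = \tr A - \tr F by rewrite htr addrK.
  exact: ler_normB.
have ca : 0 <= c * a by rewrite mulr_ge0 // ltW.
by lra.
Qed.

End RankOne.

(** * Coarse geometry of a quasi-additive length *)

Section CoarseGeometry.
Variables (R : realType) (T : Type) (e : T -> T -> nat) (d : T -> T -> R) (D K : R).

Definition geodesic (p : nat -> T) (l : nat) : Prop :=
  forall i j, (i <= j)%N -> (j <= l)%N -> e (p i) (p j) = (j - i)%N.

(* The last clause says that the concatenation of two e-geodesics which is a
   (3,0)-quasigeodesic is additive for d up to D. *)
Record coarse_geometry : Prop := CoarseGeometry {
  cg_esym : forall x y, e x y = e y x;
  cg_etri : forall x y z, (e x z <= e x y + e y z)%N;
  cg_path : forall x y, exists p, [/\ p 0%N = x, p (e x y) = y & geodesic p (e x y)];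
  cg_dsym : forall x y, d x y = d y x;
  cg_dge0 : forall x y, 0 <= d x y;
  cg_dtri : forall x y z, d x z <= d x y + d y z;
  cg_step : forall x y, (e x y <= 1)%N -> d x y <= K;
  cg_corner : forall p q l m, geodesic p l -> geodesic q m -> p 0%N = q 0%N ->
    (forall i j, (i <= l)%N -> (j <= m)%N -> (i + j <= 3 * e (p i) (q j))%N) ->
    d (p 0%N) (p l) + d (p 0%N) (q m) <= d (p l) (q m) + D }.

Hypothesis cg : coarse_geometry.
Let esym := cg_esym cg.
Let etri := cg_etri cg.
Let dsym := cg_dsym cg.
Let dtri := cg_dtri cg.

Lemma geodesic_shift p l k m : geodesic p l -> (k + m <= l)%N ->
  geodesic (fun a => p (k + a)%N) m.
Proof. by move=> hp km i j ij jm; rewrite hp; lia. Qed.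

Lemma geodesic_rev p l k m : geodesic p l -> (m <= k)%N -> (k <= l)%N ->
  geodesic (fun a => p (k - a)%N) m.
Proof. by move=> hp mk kl i j ij jm; rewrite esym hp; lia. Qed.

(** [cg_corner] at p k, for the two halves of the geodesic run outwards from p k. *)
Lemma geodesic_add p l i k j : geodesic p l -> (i <= k)%N -> (k <= j)%N -> (j <= l)%N ->
  d (p i) (p k) + d (p k) (p j) <= d (p i) (p j) + D.
Proof.
move=> hp ik kj jl.
have hq : geodesic (fun a => p (k - a)%N) (k - i) by apply: (geodesic_rev hp); lia.
have hr : geodesic (fun a => p (k + a)%N) (j - k) by apply: (geodesic_shift hp); lia.
have := cg_corner cg hq hr; rewrite subn0 addn0 => /(_ erefl).
rewrite subKn // subnKC // dsym; apply=> a b ha hb.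
by rewrite hp; lia.
Qed.

(** Take k nearest to u for e, and q a geodesic from p k to u. For x on p, nearness gives a <= e (q
    a) x, and then e (p k) x <= a + e (q a) x <= 2 e (q a) x. The sum of the two is the source of
    the factor 3 in [cg_corner]. *)
Lemma projection p l u : geodesic p l ->
  exists2 k, (k <= l)%N & forall j, (j <= l)%N ->
    d (p k) u + d (p k) (p j) <= d u (p j) + D.
Proof.
move=> hp.
have [k _ kmin] := @arg_minnP _ (ord0 : 'I_l.+1) xpredT (fun k => e u (p k)) isT.
have kl : (k <= l)%N by rewrite -ltnS.
have {}kmin j : (j <= l)%N -> (e u (p k) <= e u (p j))%N.
  by rewrite -ltnS => jl; apply: (kmin (Ordinal jl)).
exists k => // j jl.
have [q [q0 qm hq]] := cg_path cg (p k) u; set m := e (p k) u in qm hq.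
have key x a : (a <= m)%N -> (e u (p k) <= e u x)%N -> (a + e (p k) x <= 3 * e (q a) x)%N.
  move=> am hx; have h1 := hq 0%N a (leq0n _) am; have h2 := hq a m am (leqnn _).
  rewrite q0 subn0 in h1; rewrite qm in h2.
  have h3 : e u (p k) = m by rewrite esym.
  have h4 := etri u (q a) x; rewrite (esym u (q a)) h2 in h4.
  by have h5 := etri (p k) (q a) x; rewrite h1 in h5; lia.
have [kj|jk] := leqP k j.
  have hr : geodesic (fun a => p (k + a)%N) (j - k) by apply: (geodesic_shift hp); lia.
  have := cg_corner cg hq hr; rewrite q0 qm addn0 => /(_ erefl).
  rewrite subnKC //; apply=> a b ha hb.
  have := key (p (k + b)%N) a ha.
  rewrite (_ : e (p k) _ = b); last by rewrite hp; lia.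
  by apply; apply: kmin; lia.
have hr : geodesic (fun a => p (k - a)%N) (k - j) by apply: (geodesic_rev hp); lia.
have := cg_corner cg hq hr; rewrite q0 qm subn0 => /(_ erefl).
rewrite subKn ?(ltnW jk) //; apply=> a b ha hb.
have := key (p (k - b)%N) a ha.
rewrite (_ : e (p k) _ = b); last by rewrite esym hp; lia.
by apply; apply: kmin; lia.
Qed.

(** Add the two inequalities of [projection] at the endpoints: what exceeds d (p 0) (p l) is twice
    the distance from u to its projection. *)
Lemma morse p l u A : geodesic p l ->
  d (p 0%N) u + d u (p l) <= d (p 0%N) (p l) + A ->
  exists2 k, (k <= l)%N & d (p k) u <= A / 2 + D.
Proof.
move=> hp hA; have [k kl hk] := projection u hp; exists k => //.
have h0 := hk 0%N (leq0n _); have hl := hk l (leqnn l).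
have := dtri (p 0%N) (p k) (p l); rewrite (dsym (p 0%N) (p k)).
by rewrite (dsym (p 0%N) u) in hA; lra.
Qed.

(* Following an isometry f along a geodesic from o to f o, stop where the
   geodesic and its f-translate separate, or at the midpoint if they do not. *)
Lemma cyclic_reduction : exists C, forall (f g : T -> T) (o : T),
  cancel f g -> cancel g f ->
  (forall x y, e (f x) (f y) = e x y) -> (forall x y, d (f x) (f y) = d x y) ->
  exists z, 2 * d o z + d z (f z) <= d o (f o) + C /\
            2 * d z (f z) <= d z (f (f z)) + C.
Proof.
(* A1 is the [morse] constant for a defect D. A2 dominates the one for a defect D + 2 A1, and also
   A1 and K, so that a single notion of nearness serves throughout. *)
pose A1 := D / 2 + D; pose A2 := (`|D| + 2 * `|A1|) / 2 + `|D| + `|A1| + `|K|.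
pose C := 10 * `|D| + 10 * A2 + 2 * `|K|.
exists C => f g o fK gK fe fd.
have ge x y : e (g x) (g y) = e x y by rewrite -fe !gK.
have gd x y : d (g x) (g y) = d x y by rewrite -fd !gK.
have [p [p0 pl hp]] := cg_path cg o (f o); set l := e o (f o) in pl hp.
have hgp : geodesic (fun a => g (p a)) l by move=> i j ij jl; rewrite ge hp.
have D0 : D <= `|D| by apply: ler_norm.
have A10 : A1 <= `|A1| by apply: ler_norm.
have K0 : K <= `|K| by apply: ler_norm.
have nD : 0 <= `|D| by []. have nA1 : 0 <= `|A1| by []. have nK : 0 <= `|K| by [].
have A20 : 0 <= A2 by rewrite /A2; lra.
(* The translate of p by g runs from g o to o. It separates from p near z, and passes close to z at
   the index j found next. *)
have [i il hi] := projection (g o) hp; set z := p i in hi.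
have hi0 := hi 0%N (leq0n _); rewrite p0 in hi0.
have hil := hi l (leqnn l); rewrite pl in hil.
have [j jl hj] : exists2 j, (j <= l)%N & d (g (p j)) z <= A1.
  apply: (morse hgp); rewrite p0 pl fK (dsym (g o) z).
  by lra.
(* P k says that f (p k) is near p at an index s >= k. Then o, p k, f (p k), f o occur almost in
   this order along a geodesic, which is the first conclusion ([first]). *)
pose P k := `[< exists2 s, (k <= s <= l)%N & d (p s) (f (p k)) <= A2 >].
have first k s : (k <= s <= l)%N -> d (p s) (f (p k)) <= A2 ->
    2 * d o (p k) + d (p k) (f (p k)) <= d o (f o) + 2 * `|D| + 2 * A2.
  move=> /andP[ks sl] h.
  have g1 := geodesic_add hp (leq0n k) ks sl; have g2 := geodesic_add hp (leq0n s) sl (leqnn l).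
  rewrite p0 in g1; rewrite p0 pl in g2.
  have := dtri (p k) (p s) (f (p k)).
  have := dtri (f (p k)) (p s) (f o); rewrite fd (dsym (f _) (p s)) (dsym (p k) o).
  by lra.
(* If P i holds, z itself works: the projection inequality at the far end bounds d (g o) (f o)
   below, and going from g o to f o through g z and f z turns this into a lower bound for d (g z) (f
   z) = d z (f (f z)). *)
have [/asboolP[s sil hs]|nPi] := boolP (P i).
  exists z; have h1 := first i s sil hs; rewrite -/z in h1 hs.
  split; first by rewrite /C; lra.
  move/andP: sil => [is_ sl].
  have g1 := geodesic_add hp is_ sl (leqnn l); rewrite pl -/z in g1.
  have g2 := geodesic_add hp (leq0n i) is_ sl; rewrite p0 -/z in g2.
  have t1 := dtri (g o) (g z) (f o); have t2 := dtri (g z) (f z) (f o).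
  have t3 : d (g z) (f z) = d z (f (f z)) by rewrite -fd gK.
  rewrite gd in t1; rewrite fd t3 in t2.
  have t4 := dtri z (p s) (f z).
  have t5 := dtri (f z) (p s) (f o); rewrite fd (dsym (f z) (p s)) in t5.
  have t6 : d z (g o) = d (f z) o by rewrite -fd gK.
  have t7 := dtri o (f z) (p s); rewrite (dsym o (f z)) (dsym (f z) (p s)) in t7.
  rewrite (dsym z o) in t2 t5 *; rewrite /C.
  by lra.
have P0 : P 0%N.
  apply/asboolP; exists l; first by rewrite leq0n leqnn.
  rewrite pl p0 (le_trans (cg_step cg _)) //.
    by have := hp l l (leqnn _) (leqnn _); rewrite pl subnn => ->.
  by rewrite /A2; lra.
have hj2 : d (p j) (f z) <= A1 by rewrite -gd fK.
have ji : (j < i)%N.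
  rewrite ltnNge; apply/negP => ij; move/negP: nPi; apply; apply/asboolP.
  by exists j; rewrite ?ij // -/z /A2; lra.
have near k : (k <= i)%N -> exists2 s, (j <= s <= l)%N & d (p s) (f (p k)) <= A2.
  move=> ki.
  have hq : geodesic (fun a => g (p (j + a)%N)) (l - j).
    by apply: (geodesic_shift hgp); rewrite subnKC.
  have [|s sl hs] := @morse _ _ (p k) (D + 2 * A1) hq.
    rewrite /= addn0 subnKC // pl fK.
    have := geodesic_add hp (leq0n k) ki il; rewrite p0 -/z.
    have := dtri (g (p j)) z (p k); have := dtri o (g (p j)) z.
    rewrite (dsym o (g _)) (dsym z (p k)) (dsym (p k) o).
    by lra.
  exists (j + s)%N; first by rewrite leq_addr /= -(subnKC jl) leq_add2l.
  by rewrite -gd fK; apply: le_trans hs _; rewrite /A2; lra.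
(* Otherwise stop at the last k0 before P fails. Just beyond it f (p k0.+1) is near some p s' with
   s' <= k0, so k0 is about the midpoint and the displacement d (p k0) (f (p k0)) is bounded. The
   second conclusion then holds because its left side is bounded. *)
have [k0 [k0i Pk0 nPk0]] : exists k0, [/\ (k0 < i)%N, P k0 & ~~ P k0.+1].
  have exP : exists k, P k && (k <= i)%N by exists 0%N; rewrite P0.
  have ubP k : P k && (k <= i)%N -> (k <= i)%N by move=> /andP[].
  case: (ex_maxnP exP ubP) => k /andP[Pk ki] kmax.
  have ki' : (k < i)%N.
    by rewrite ltn_neqAle ki andbT; apply/eqP => ki2; rewrite -ki2 Pk in nPi.
  exists k; split=> //; apply/negP => Pk1.
  by have := kmax k.+1; rewrite Pk1 ki' ltnn => /(_ isT).
have /asboolP[s hs1 hs2] := Pk0.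
have [s' /andP[js' s'l] hs'] := near k0.+1 k0i.
have s'k : (s' <= k0)%N.
  rewrite leqNgt; apply/negP => k0s'; move/negP: nPk0; apply; apply/asboolP.
  by exists s'; rewrite ?k0s'.
have h1 := first k0 s hs1 hs2.
have k0l : (k0 <= l)%N by apply: leq_trans il; apply: ltnW.
have g1 := geodesic_add hp (leq0n s') s'k k0l; rewrite p0 in g1.
have t1 := dtri o (p s') (f o).
have t2 := dtri (p s') (f (p k0.+1)) (f o); rewrite fd in t2.
have t3 := dtri (p k0.+1) (p k0) o.
have t4 : d (p k0.+1) (p k0) <= `|K|.
  rewrite (le_trans (cg_step cg _)) // esym hp ?subSnn //.
  by apply: leq_trans il.
rewrite (dsym (p k0) o) in t3.
have q0 : 0 <= d (p s') (p k0) by apply: cg_dge0.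
have q1 : 0 <= d (p k0) (f (f (p k0))) by apply: cg_dge0.
exists (p k0); rewrite /C; split; lra.
Qed.

End CoarseGeometry.

(** * Schur form and moduli of eigenvalues *)

Lemma char_poly_similar (F : comNzRingType) n (P Q A : 'M[F]_n) :
  Q *m P = 1%:M -> char_poly (P *m A *m Q) = char_poly A.
Proof.
move=> QP; have PQ := mulmx1C QP; rewrite /char_poly /char_poly_mx.
have E : 'X%:M - map_mx polyC (P *m A *m Q) =
  map_mx polyC P *m ('X%:M - map_mx polyC A) *m map_mx polyC Q.
  rewrite !map_mxM /= mulmxBr mulmxBl; congr (_ - _).
  by rewrite scalar_mxC -mulmxA -map_mxM PQ map_mx1 mulmx1.
have detPQ : \det (map_mx polyC P) * \det (map_mx polyC Q) = 1.
  by rewrite -det_mulmx -map_mxM PQ map_mx1 det1.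
by rewrite E !det_mulmx mulrAC detPQ mul1r.
Qed.

Section Trig.
Variables (F : comNzRingType) (n : nat) (T : 'M[F]_n).
Hypothesis trT : is_trig_mx T.

Lemma trig_mul0 i j : i != j -> T i j * T j i = 0.
Proof.
move=> ij; have /is_trig_mxP h := trT; move: ij; rewrite -val_eqE neq_ltn.
by case/orP => /h ->; rewrite ?mul0r ?mulr0.
Qed.

Lemma trig_trace_sqr : \tr (T *m T) = \sum_i T i i ^+ 2.
Proof.
apply: eq_bigr => i _; rewrite mxE (bigD1 i) //= big1 ?addr0 // => j ji.
by rewrite trig_mul0 // eq_sym.
Qed.
End Trig.

Section Frobenius.
Local Open Scope sesquilinear_scope.
Variable C : numClosedFieldType.

Definition fro2 m n (A : 'M[C]_(m, n)) : C := \sum_i \sum_j `|A i j| ^+ 2.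

Definition wed2 m n (A : 'M[C]_(m, n)) : C :=
  \sum_i \sum_j \sum_k \sum_l `|A i k * A j l - A i l * A j k| ^+ 2.

Lemma fro2_trace m n (A : 'M[C]_(m, n)) : fro2 A = \tr (A *m A^t*).
Proof.
by apply: eq_bigr => i _; rewrite mxE; apply: eq_bigr => j _; rewrite !mxE normCK.
Qed.

(** A Lagrange identity. It reduces the unitary invariance of [wed2] to that of traces, and for a
    Gram matrix it yields the second symmetric function of the squared singular values. *)
Lemma wed2_trace m n (A : 'M[C]_(m, n)) (M := A *m A^t*) :
  wed2 A = 2 * (\tr M ^+ 2 - \tr (M *m M)).
Proof.
have Mij i j : M i j = \sum_k A i k * (A j k)^*.
  by rewrite mxE; apply: eq_bigr => k _; rewrite !mxE.
have trMM : \tr (M *m M) = \sum_i \sum_j M i j * M j i.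
  by apply: eq_bigr => i _; rewrite mxE.
rewrite trMM expr2 /mxtrace mulr_suml -sumrB mulr_sumr; apply: eq_bigr => i _.
rewrite mulr_sumr -sumrB mulr_sumr; apply: eq_bigr => j _.
transitivity (\sum_k \sum_l (A i k * (A i k)^* * (A j l * (A j l)^*)
    + A j k * (A j k)^* * (A i l * (A i l)^*)
    - A i k * (A j k)^* * (A j l * (A i l)^*)
    - A j k * (A i k)^* * (A i l * (A j l)^*))).
  apply: eq_bigr => k _; apply: eq_bigr => l _.
  by rewrite normCK rmorphB !rmorphM /=; ring.
have dbl (a b : 'I_n -> C) : \sum_k \sum_l a k * b l = (\sum_k a k) * (\sum_l b l).
  by rewrite mulr_suml; apply: eq_bigr => k _; rewrite mulr_sumr.
under eq_bigr => k _ do rewrite !sumrB big_split.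
by rewrite !sumrB big_split /= !dbl !Mij; ring.
Qed.

Lemma frobenius_unitary n (P A : 'M[C]_n) : P \is unitarymx ->
  fro2 (P *m A *m P^t*) = fro2 A /\ wed2 (P *m A *m P^t*) = wed2 A.
Proof.
move=> uP.
have PP : P^t* *m P = 1%:M by apply: mulmx1C; apply/unitarymxP.
have E : (P *m A *m P^t*) *m (P *m A *m P^t*)^t* = P *m (A *m A^t*) *m P^t*.
  rewrite !trmx_mul !map_mxM /= trmxCK !mulmxA.
  by congr (_ *m _); congr (_ *m _); rewrite -[LHS]mulmxA PP mulmx1.
rewrite !fro2_trace !wed2_trace E; set M := A *m A^t*.
have tr1 (X : 'M[C]_n) : \tr (P *m X *m P^t*) = \tr X.
  by rewrite mxtrace_mulC mulmxA PP mul1mx.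
have mul1 (X Y : 'M[C]_n) : P *m X *m P^t* *m (P *m Y *m P^t*) = P *m (X *m Y) *m P^t*.
  by rewrite -!mulmxA (mulmxA (P^t*)) PP mul1mx.
by rewrite mul1 !tr1.
Qed.

Lemma schur_form n (A : 'M[C]_n) : (0 < n)%N ->
  exists T : 'M[C]_n, [/\ is_trig_mx T,
    char_poly A = \prod_(i < n) ('X - (T i i)%:P),
    \tr A = \tr T /\ \tr (A *m A) = \tr (T *m T) &
    fro2 A = fro2 T /\ wed2 A = wed2 T].
Proof.
move=> n0; have [P uP /=] := Schur A n0; rewrite /similar_to.
rewrite conjumx ?unitarymx_unit // invmx_unitary // => trT.
have PP : P^t* *m P = 1%:M by apply: mulmx1C; apply/unitarymxP.
exists (P *m A *m P^t*); split => //.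
- by rewrite -char_poly_trig // char_poly_similar.
- have tr1 (X : 'M[C]_n) : \tr (P *m X *m P^t*) = \tr X.
    by rewrite mxtrace_mulC mulmxA PP mul1mx.
  have -> : P *m A *m P^t* *m (P *m A *m P^t*) = P *m (A *m A) *m P^t*.
    by rewrite -!mulmxA (mulmxA (P^t*)) PP mul1mx.
  by rewrite !tr1.
- by have [-> ->] := frobenius_unitary A uP.
Qed.

Lemma fro2_diag n (T : 'M[C]_n) i : `|T i i| ^+ 2 <= fro2 T.
Proof.
rewrite /fro2 (bigD1 i) //= (bigD1 i) //= -addrA lerDl.
have sq (x : C) : 0 <= `|x| ^+ 2 by rewrite exprn_ge0.
by rewrite addr_ge0 ?sumr_ge0 // => *; rewrite ?sumr_ge0.
Qed.

(** In a triangular matrix the principal minor on i and j is T i i * T j j. *)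
Lemma wed2_diag n (T : 'M[C]_n) i j : is_trig_mx T -> i != j ->
  `|T i i * T j j| ^+ 2 <= wed2 T.
Proof.
move=> trT ij; have sq (x : C) : 0 <= `|x| ^+ 2 by rewrite exprn_ge0.
rewrite /wed2 (bigD1 i) //= (bigD1 j) //= (bigD1 i) //= (bigD1 j) //=.
rewrite trig_mul0 // subr0 -!addrA lerDl !addr_ge0 ?sumr_ge0 //.
- by move=> *; rewrite sumr_ge0.
- by move=> *; rewrite sumr_ge0 // => *; rewrite sumr_ge0.
- by move=> *; rewrite sumr_ge0 // => *; rewrite sumr_ge0 // => *; rewrite sumr_ge0.
Qed.

Lemma gram_eigenvalue_ge0 n m (A : 'M[C]_(n, m)) a :
  eigenvalue (A *m A^t*) a -> 0 <= a.
Proof.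
move=> /eigenvalueP[v Av v0].
have E : (v *m A) *m (v *m A)^t* = a *: (v *m v^t*).
  by rewrite trmx_mul map_mxM /= mulmxA -(mulmxA v) Av -scalemxAl.
have fro_row p (w : 'rV[C]_p) : (w *m w^t*) 0 0 = fro2 w.
  by rewrite fro2_trace /mxtrace big_ord1.
have E2 : fro2 (v *m A) = a * fro2 v by rewrite -!fro_row E mxE.
have sq (x : C) : 0 <= `|x| ^+ 2 by rewrite exprn_ge0.
have fro_ge0 p (w : 'rV[C]_p) : 0 <= fro2 w.
  by apply: sumr_ge0 => *; apply: sumr_ge0.
have vp : 0 < fro2 v.
  rewrite lt_def fro_ge0 andbT; apply: contra v0 => /eqP v0.
  apply/eqP/matrixP => i j; rewrite mxE; apply/eqP.
  have/eqP := v0; rewrite /fro2 psumr_eq0; last by move=> *; apply: sumr_ge0.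
  move=> /allP/(_ i (mem_index_enum _)); rewrite implyTb psumr_eq0 //.
  move=> /allP/(_ j (mem_index_enum _)); rewrite implyTb.
  by rewrite expf_eq0 normr_eq0.
have h : 0 <= a * fro2 v by rewrite -E2.
by rewrite pmulr_lge0 in h.
Qed.

End Frobenius.

Section SortedSeq.
Variable R : realType.

Lemma sum_sorted (s : seq R) : sorted (fun x y : R => y <= x) s ->
  (forall x, x \in s -> 0 <= x) ->
  \sum_(x <- s) x <= (size s)%:R * s`_0.
Proof.
case: s => [|a s]; first by rewrite big_nil mul0r.
rewrite /= (path_sortedE); last by move=> x y z yx zy; apply: le_trans zy yx.
move=> /andP[/allP ha _] _; rewrite big_cons -natr1 mulrDl mul1r addrC lerD2r.
rewrite mulr_natl; elim: s ha => [|b s IH] ha; first by rewrite big_nil.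
rewrite big_cons /= mulrS; apply: lerD; first by apply: ha; rewrite mem_head.
by apply: IH => x xs; apply: ha; rewrite inE xs orbT.
Qed.

Lemma head_le_sum (s : seq R) : (forall x, x \in s -> 0 <= x) -> s`_0 <= \sum_(x <- s) x.
Proof.
case: s => [|a s] h; first by rewrite big_nil.
rewrite big_cons lerDl big_seq; apply: sumr_ge0 => x xs; apply: h.
by rewrite inE xs orbT.
Qed.

(** The middle term is twice the second elementary symmetric function. Up to constants it is the
    product of the two largest entries, which is how sums of two logarithms are reached from
    traces. *)
Lemma pair_sums_sorted (s : seq R) : sorted (fun x y : R => y <= x) s ->
  (forall x, x \in s -> 0 <= x) ->
  2 * (s`_0 * s`_1) <= (\sum_(x <- s) x) ^+ 2 - \sum_(x <- s) x ^+ 2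
    <= (size s)%:R ^+ 2 * (s`_0 * s`_1).
Proof.
case: s => [|a s] srt pos.
  by rewrite !big_nil /= !mulr0 expr0n subr0 lexx.
have srt2 : sorted (fun x y : R => y <= x) s by apply: path_sorted srt.
have pos2 x : x \in s -> 0 <= x by move=> xs; apply: pos; rewrite inE xs orbT.
have a0 : 0 <= a by apply: pos; rewrite mem_head.
have h1 := sum_sorted srt2 pos2; have h2 := head_le_sum pos2.
have h0 : 0 <= s`_0 by case: s {srt srt2 h1 h2 pos} pos2 => //= b s; apply; rewrite mem_head.
have ha : s`_0 <= a by case: s {srt2 h1 h2 pos pos2 h0} srt => //= b s /andP[].
set S := \sum_(x <- s) x in h1 h2; set Q := \sum_(x <- s) x ^+ 2.
have Q0 : 0 <= Q by apply: sumr_ge0 => x _; rewrite sqr_ge0.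
have QS : Q <= S ^+ 2.
  rewrite /Q /S; elim: s pos2 {srt srt2 h1 h2 h0 ha S Q Q0 pos} => [|b s IH] pos2.
    by rewrite !big_nil expr0n.
  rewrite !big_cons; have b0 : 0 <= b by apply: pos2; rewrite mem_head.
  have pos3 x : x \in s -> 0 <= x by move=> xs; apply: pos2; rewrite inE xs orbT.
  have S0 : 0 <= \sum_(x <- s) x by rewrite big_seq; apply: sumr_ge0.
  by have := IH pos3; rewrite !expr2; nra.
rewrite !big_cons -/S -/Q /= -[(size s).+1%:R]natr1; set k := (size s)%:R in h1 *.
have k0 : 0 <= k by [].
have S0 : 0 <= S by apply: le_trans h2.
have -> : (a + S) ^+ 2 - (a ^+ 2 + Q) = 2 * (a * S) + (S ^+ 2 - Q) by ring.
have e1 : a * s`_0 <= a * S by apply: ler_wpM2l.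
apply/andP; split; first by lra.
have e2 : a * S <= a * (k * s`_0) by apply: ler_wpM2l.
have e3 : S ^+ 2 <= (k * s`_0) * (k * a).
  rewrite expr2; apply: ler_pM => //; apply: le_trans h1 _; exact: ler_wpM2l.
have -> : (k + 1) ^+ 2 * (a * s`_0) = 2 * (a * (k * s`_0)) + k * s`_0 * (k * a) + a * s`_0.
  by ring.
have : 0 <= a * s`_0 by apply: mulr_ge0.
by lra.
Qed.

End SortedSeq.

(** * Eigenvalue moduli compared with norms, minors and traces *)

Section Spectrum.
Local Open Scope sesquilinear_scope.
Variable R : realType.
Local Notation C := R[i].
Local Notation normc := (@ComplexField.Normc.normc R).

Lemma normcE (z : C) : `|z| = ((normc z)%:C)%C.
Proof. by case: z. Qed.

Lemma normc_ge0 (z : C) : 0 <= normc z.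
Proof. by case: z => a b; apply: sqrtr_ge0. Qed.

Lemma normcR (x : R) : normc (x%:C)%C = `|x|.
Proof. by rewrite /ComplexField.Normc.normc /= expr0n /= addr0 sqrtr_sqr. Qed.

Lemma cplx_trace n (A : 'M[R]_n) : \tr (cplx_mx A) = ((\tr A)%:C)%C.
Proof. by rewrite /mxtrace rmorph_sum; apply: eq_bigr => i _; rewrite mxE. Qed.

Lemma cplx_mul m n p (A : 'M[R]_(m, n)) (B : 'M[R]_(n, p)) :
  map_mx (fun x : R => (x%:C)%C) (A *m B) =
  map_mx (fun x : R => (x%:C)%C) A *m map_mx (fun x : R => (x%:C)%C) B.
Proof.
apply/matrixP => i j; rewrite !mxE rmorph_sum; apply: eq_bigr => k _.
by rewrite !mxE rmorphM.
Qed.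

Lemma cplx_fro2 n (A : 'M[R]_n) :
  fro2 (cplx_mx A) = ((\sum_i \sum_j A i j ^+ 2)%:C)%C.
Proof.
rewrite rmorph_sum; apply: eq_bigr => i _; rewrite rmorph_sum; apply: eq_bigr => j _.
by rewrite mxE normcE normcR -rmorphXn /= real_normK ?num_real.
Qed.

Definition wedge2 n (A : 'M[R]_n) : R :=
  \sum_i \sum_j \sum_k \sum_l minor2 A i j k l ^+ 2.

Lemma cplx_wed2 n (A : 'M[R]_n) : wed2 (cplx_mx A) = ((wedge2 A)%:C)%C.
Proof.
do 4!(rewrite rmorph_sum; apply: eq_bigr => ? _).
rewrite !mxE -!rmorphM -rmorphB normcE normcR -rmorphXn /=.
by rewrite real_normK ?num_real.
Qed.

Lemma sqr_sum_ge (I : finType) (f : I -> R) : (forall i, 0 <= f i) ->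
  \sum_i f i ^+ 2 <= (\sum_i f i) ^+ 2.
Proof.
move=> f0; rewrite expr2 mulr_suml; apply: ler_sum => i _.
by rewrite expr2 ler_wpM2l // (bigD1 i) //= lerDl sumr_ge0.
Qed.

(** The powers of n are crude here and below; after taking logarithms they only add multiples of ln
    n. *)
Lemma sum_sqr_nm n (A : 'M[R]_n) :
  \sum_i \sum_j A i j ^+ 2 <= nm A ^+ 2
  /\ nm A ^+ 2 <= n%:R ^+ 4 * \sum_i \sum_j A i j ^+ 2.
Proof.
have pairE (f : 'I_n -> 'I_n -> R) : \sum_i \sum_j f i j = \sum_(q : 'I_n * 'I_n) f q.1 q.2.
  by rewrite pair_bigA.
rewrite /nm !pairE; split.
  apply: le_trans (sqr_sum_ge _) => //; rewrite le_eqVlt; apply/orP; left; apply/eqP.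
  by apply: eq_bigr => q _; rewrite real_normK ?num_real.
set S := \sum_q _ ^+ 2 in |- *.
have entry q : `|A q.1 q.2| <= Num.sqrt S.
  rewrite -sqrtr_sqr ler_wsqrtr // /S (bigD1 q) //= lerDl; apply: sumr_ge0 => *.
  by rewrite sqr_ge0.
have S0 : 0 <= S by apply: sumr_ge0 => *; rewrite sqr_ge0.
have : \sum_(q : 'I_n * 'I_n) `|A q.1 q.2| <= n%:R ^+ 2 * Num.sqrt S.
  apply: le_trans (ler_sum _ (fun q _ => entry q)) _.
  by rewrite sumr_const card_prod card_ord -[leLHS]mulr_natl natrM -expr2.
move=> h; have -> : n%:R ^+ 4 * S = (n%:R ^+ 2 * Num.sqrt S) ^+ 2.
  by rewrite exprMn sqr_sqrtr // -exprM.
by rewrite lerXn2r ?nnegrE ?sumr_ge0 ?mulr_ge0 ?exprn_ge0 ?sqrtr_ge0.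
Qed.

Lemma wedge2_nm n (A : 'M[R]_n) :
  wedge2 A <= wedge_nm A ^+ 2
  /\ wedge_nm A ^+ 2 <= n%:R ^+ 8 * wedge2 A.
Proof.
pose I := ('I_n * 'I_n * 'I_n * 'I_n)%type.
have quadE (f : 'I_n -> 'I_n -> 'I_n -> 'I_n -> R) :
    \sum_i \sum_j \sum_k \sum_l f i j k l = \sum_(q : I) f q.1.1.1 q.1.1.2 q.1.2 q.2.
  by rewrite pair_bigA /= pair_bigA /= pair_bigA.
rewrite /wedge_nm /wedge2 !quadE; pose f (q : I) := minor2 A q.1.1.1 q.1.1.2 q.1.2 q.2.
rewrite -[X in X <= _ /\ _]/(\sum_q f q ^+ 2).
rewrite -[X in _ <= X ^+ 2 /\ _]/(\sum_q `|f q|); split.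
  apply: le_trans (sqr_sum_ge _) => //; rewrite le_eqVlt; apply/orP; left; apply/eqP.
  by apply: eq_bigr => q _; rewrite real_normK ?num_real.
rewrite -[X in X ^+ 2 <= _]/(\sum_q `|f q|) -[X in _ <= _ * X]/(\sum_q f q ^+ 2).
set S := \sum_q _ ^+ 2.
have entry q : `|f q| <= Num.sqrt S.
  rewrite -sqrtr_sqr ler_wsqrtr // /S (bigD1 q) //= lerDl; apply: sumr_ge0 => *.
  by rewrite sqr_ge0.
have S0 : 0 <= S by apply: sumr_ge0 => *; rewrite sqr_ge0.
have : \sum_q `|f q| <= n%:R ^+ 4 * Num.sqrt S.
  apply: le_trans (ler_sum _ (fun q _ => entry q)) _.
  rewrite sumr_const !card_prod card_ord -[leLHS]mulr_natl !natrM.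
  by rewrite (_ : n%:R ^+ 4 = n%:R * n%:R * n%:R * n%:R :> R) // !exprS expr0; ring.
move=> h; have -> : n%:R ^+ 8 * S = (n%:R ^+ 4 * Num.sqrt S) ^+ 2.
  by rewrite exprMn sqr_sqrtr // -exprM.
by rewrite lerXn2r ?nnegrE ?sumr_ge0 ?mulr_ge0 ?exprn_ge0 ?sqrtr_ge0.
Qed.

Lemma eig_seqE n (A : 'M[R]_n) :
  char_poly (cplx_mx A) = \prod_(z <- eig_seq A) ('X - z%:P).
Proof.
rewrite /eig_seq; case: closed_field_poly_normal => s /= hs.
by rewrite {1}hs (monicP (char_poly_monic _)) scale1r.
Qed.

Lemma mem_eig_seq n (A : 'M[R]_n) z : (z \in eig_seq A) = eigenvalue (cplx_mx A) z.
Proof. by rewrite eigenvalue_root_char eig_seqE root_prod_XsubC. Qed.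

Lemma eig_moduli_sorted n (A : 'M[R]_n) : sorted (fun x y : R => y <= x) (eig_moduli A).
Proof. by apply: sort_sorted => x y; apply: le_total. Qed.

Lemma eig_moduli_ge0 n (A : 'M[R]_n) x : x \in eig_moduli A -> 0 <= x.
Proof. by rewrite mem_sort => /mapP[z _ ->]; apply: normc_ge0. Qed.

Lemma size_eig_moduli n (A : 'M[R]_n) : size (eig_moduli A) = n.
Proof.
rewrite size_sort size_map; apply/eqP; rewrite -eqSS -(size_char_poly (cplx_mx A)).
by rewrite eig_seqE size_prod_XsubC.
Qed.

(* The eigenvalues are realised as the diagonal of a Schur form T, which has the
   same Frobenius norms and second compound norms as A. *)
Lemma eig_schur n (A : 'M[R]_n) : (0 < n)%N ->
  exists T : 'M[C]_n, [/\ is_trig_mx T,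
    perm_eq (eig_seq A) [seq T i i | i <- enum 'I_n],
    ((\tr A)%:C)%C = \tr T /\ ((\tr (A *m A))%:C)%C = \tr (T *m T) &
    fro2 T = ((\sum_i \sum_j A i j ^+ 2)%:C)%C /\ wed2 T = ((wedge2 A)%:C)%C].
Proof.
move=> n0; have [T [trT cp [t1 t2] [f1 f2]]] := schur_form (cplx_mx A) n0.
exists T; split => //.
- apply: prod_XsubC_eq; rewrite -eig_seqE cp big_map big_enum /=.
  by apply: eq_bigl => i.
- by rewrite -t1 -t2 -!cplx_trace /cplx_mx cplx_mul.
- by rewrite -f1 -f2 cplx_fro2 cplx_wed2.
Qed.

Lemma sum_eig_moduli n (A : 'M[R]_n) (T : 'M[C]_n) (f : R -> R) :
  perm_eq (eig_seq A) [seq T i i | i <- enum 'I_n] ->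
  \sum_(x <- eig_moduli A) f x = \sum_i f (normc (T i i)).
Proof.
move=> hp; rewrite (perm_big (map normc (eig_seq A))) /=; last by rewrite perm_sort.
by rewrite big_map (perm_big _ hp) big_map big_enum.
Qed.

Lemma normc_sum (I : Type) (r : seq I) (P : pred I) (F : I -> C) :
  normc (\sum_(i <- r | P i) F i) <= \sum_(i <- r | P i) normc (F i).
Proof.
rewrite -lecR -normcE rmorph_sum /=; apply: le_trans (ler_norm_sum _ _ _) _.
by apply: ler_sum => i _; rewrite normcE.
Qed.

Lemma sqr_sum_offdiag n (K : comPzRingType) (f : 'I_n -> K) :
  (\sum_i f i) ^+ 2 - \sum_i f i ^+ 2 = \sum_i \sum_(j | j != i) f i * f j.
Proof.
rewrite expr2 mulr_suml -sumrB; apply: eq_bigr => i _.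
by rewrite mulr_sumr (bigD1 i) //= expr2 addrAC subrr add0r.
Qed.

Local Notation e2mod A :=
  ((\sum_(x <- eig_moduli A) x) ^+ 2 - \sum_(x <- eig_moduli A) x ^+ 2).

(** All four are read off the diagonal of one Schur form: the trace bounds by the triangle
    inequality, the norm bounds because one diagonal entry, or one principal minor, is at most the
    invariant norm. *)
Lemma eig_bounds n (A : 'M[R]_n) : (0 < n)%N ->
  [/\ `|\tr A| <= \sum_(x <- eig_moduli A) x,
      `|\tr A ^+ 2 - \tr (A *m A)| <= e2mod A,
      \sum_(x <- eig_moduli A) x <= n%:R * nm A &
      e2mod A <= n%:R ^+ 2 * wedge_nm A].
Proof.
move=> n0; have [T [trT hp [t1 t2] [f1 f2]]] := eig_schur A n0.
rewrite !(sum_eig_moduli _ hp) sqr_sum_offdiag; split.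
- by rewrite -normcR t1; apply: normc_sum.
- have E : ((\tr A ^+ 2 - \tr (A *m A))%:C)%C = \tr T ^+ 2 - \tr (T *m T).
    by rewrite -t1 -t2 rmorphB rmorphXn.
  rewrite -normcR E trig_trace_sqr //.
  rewrite sqr_sum_offdiag; apply: le_trans (normc_sum _ _ _) _; apply: ler_sum => i _.
  apply: le_trans (normc_sum _ _ _) _; apply: ler_sum => j _.
  by rewrite ComplexField.Normc.normcM.
- rewrite mulr_natl -[X in _ *+ X]card_ord -sumr_const; apply: ler_sum => i _.
  have := fro2_diag T i; rewrite f1 normcE -rmorphXn /= lecR => h.
  rewrite -(@ler_pXn2r _ 2) ?nnegrE ?normc_ge0 //.
  exact: le_trans h (sum_sqr_nm A).1.
- rewrite expr2 -mulrA mulr_natl -[X in _ *+ X]card_ord -sumr_const.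
  apply: ler_sum => i _; rewrite mulr_natl -[X in _ *+ X]card_ord -sumr_const.
  rewrite [leRHS](bigID (fun j => j != i)) /=; apply: ler_wpDr.
    by apply: sumr_ge0 => *; apply: wedge_nm_ge0.
  apply: ler_sum => j ji; rewrite eq_sym in ji.
  have := wed2_diag trT ji; rewrite f2 normcE -rmorphXn /= lecR.
  rewrite ComplexField.Normc.normcM => h.
  rewrite -(@ler_pXn2r _ 2) ?nnegrE ?mulr_ge0 ?normc_ge0 ?wedge_nm_ge0 //.
  exact: le_trans h (wedge2_nm A).1.
Qed.

Lemma cplx_adjoint n (A : 'M[R]_n) : (cplx_mx A)^t* = cplx_mx A^T.
Proof.
by apply/matrixP => i j; rewrite !mxE; apply: conjc_real.
Qed.

(** The eigenvalues of a Gram matrix are nonnegative, so they equal their moduli, and power sums of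
    moduli are traces. *)
Lemma gram_moduli n (A : 'M[R]_n) : (0 < n)%N ->
  \sum_(x <- eig_moduli (A *m A^T)) x = \sum_i \sum_j A i j ^+ 2
  /\ 2 * e2mod (A *m A^T) = wedge2 A.
Proof.
move=> n0; set M := A *m A^T.
have cM : cplx_mx M = cplx_mx A *m (cplx_mx A)^t* by rewrite cplx_adjoint -cplx_mul.
have [T [trT hp [t1 t2] _]] := eig_schur M n0.
have Tpos i : T i i = ((normc (T i i))%:C)%C.
  rewrite -normcE ger0_norm // (@gram_eigenvalue_ge0 _ _ _ (cplx_mx A)) // -cM.
  by rewrite -mem_eig_seq (perm_mem hp); apply: map_f; rewrite mem_enum.
have s1 : \sum_(x <- eig_moduli M) x = \tr M.
  rewrite (sum_eig_moduli _ hp); apply: complexI; rewrite t1 rmorph_sum.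
  by apply: eq_bigr => i _; rewrite [RHS]Tpos.
have s2 : \sum_(x <- eig_moduli M) x ^+ 2 = \tr (M *m M).
  rewrite (sum_eig_moduli _ hp); apply: complexI; rewrite t2 trig_trace_sqr //.
  by rewrite rmorph_sum; apply: eq_bigr => i _; rewrite rmorphXn [in RHS]Tpos.
rewrite s1 s2; split; apply: complexI.
  by rewrite -cplx_fro2 fro2_trace -cM cplx_trace.
rewrite -cplx_wed2 wed2_trace -cM !cplx_trace -cplx_mul.
by rewrite cplx_trace rmorphM rmorphB rmorphXn /= rmorph_nat.
Qed.

End Spectrum.

(** * The functions mu and lambda in terms of norms *)

Section LogSpectrum.
Variables (R : realType) (n : nat).
Hypothesis n2 : (2 <= n)%N.
Let n0 : (0 < n)%N := ltnW n2.
Local Notation L := (ln (n%:R : R)).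

Lemma ln_dim_ge0 : 0 <= L.
Proof. by rewrite ln_ge0 // ler1n. Qed.

Lemma ln_sqrt (x : R) : 0 < x -> ln (Num.sqrt x) = ln x / 2.
Proof.
move=> x0; rewrite -{2}[x]sqr_sqrtr ?ltW // lnXn ?sqrtr_gt0 //.
by rewrite -[ln _ *+ 2]mulr_natr mulfK ?pnatr_eq0.
Qed.

Lemma eigenvalue_inv (A : 'M[R]_n) z : A \in unitmx ->
  z \in eig_seq A -> z != 0 /\ z^-1 \in eig_seq (invmx A).
Proof.
move=> uA; rewrite !mem_eig_seq => /eigenvalueP[v vA v0].
have AA : cplx_mx A *m cplx_mx (invmx A) = 1%:M.
  rewrite -cplx_mul mulmxV //; apply/matrixP => i j; rewrite !mxE.
  by case: (i == j).
have vv : v = z *: (v *m cplx_mx (invmx A)) by rewrite scalemxAl -vA -mulmxA AA mulmx1.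
have z0 : z != 0 by apply: contra_neq v0 => z0; rewrite vv z0 scale0r.
split=> //; apply/eigenvalueP; exists v => //.
by rewrite [in RHS]vv scalerA mulVf // scale1r.
Qed.

Lemma eig_moduli_gt0 (A : 'M[R]_n) x : A \in unitmx -> x \in eig_moduli A -> 0 < x.
Proof.
move=> uA xs; rewrite lt_def (eig_moduli_ge0 xs) andbT.
move: xs; rewrite mem_sort => /mapP[z zs ->]; have [z0 _] := eigenvalue_inv uA zs.
by apply: contra z0 => /eqP/ComplexField.Normc.eq0_normc ->.
Qed.

Lemma nth_moduli_gt0 (A : 'M[R]_n) k : A \in unitmx -> (k < n)%N -> 0 < (eig_moduli A)`_k.
Proof.
by move=> uA kn; apply: (eig_moduli_gt0 uA); rewrite mem_nth // size_eig_moduli.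
Qed.

Lemma nth_moduli_le (A : 'M[R]_n) j k : (j <= k)%N -> (k < n)%N ->
  (eig_moduli A)`_k <= (eig_moduli A)`_j.
Proof.
move=> jk kn.
have tr : transitive (fun x y : R => y <= x) by move=> x y z yx zy; apply: le_trans zy yx.
apply: (sorted_leq_nth tr _ 0 (eig_moduli_sorted A)) => //.
- by rewrite inE size_eig_moduli (leq_ltn_trans jk).
- by rewrite inE size_eig_moduli.
Qed.

Lemma gram_unit (A : 'M[R]_n) : A \in unitmx -> A *m A^T \in unitmx.
Proof. by move=> uA; rewrite unitmx_mul uA unitmx_tr. Qed.

Lemma muE (A : 'M[R]_n) k : A \in unitmx -> (k < n)%N ->
  mu A k.+1 = ln (eig_moduli (A *m A^T))`_k / 2.
Proof.
move=> uA kn; rewrite /mu /sing_values (nth_map 0) ?size_eig_moduli // ln_sqrt //.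
by apply: nth_moduli_gt0 => //; apply: gram_unit.
Qed.

Lemma mu_antimono (A : 'M[R]_n) j k : A \in unitmx -> (j <= k)%N -> (k < n)%N ->
  mu A k.+1 <= mu A j.+1.
Proof.
move=> uA jk kn; rewrite !muE ?(leq_ltn_trans jk) // ler_pM2r ?invr_gt0 //.
have uM := gram_unit uA.
by rewrite ler_ln ?posrE ?nth_moduli_gt0 ?nth_moduli_le // (leq_ltn_trans jk).
Qed.

Lemma lambda_antimono (A : 'M[R]_n) j k : A \in unitmx -> (j <= k)%N -> (k < n)%N ->
  lambda A k.+1 <= lambda A j.+1.
Proof.
move=> uA jk kn.
by rewrite ler_ln ?posrE ?nth_moduli_gt0 ?nth_moduli_le // (leq_ltn_trans jk).
Qed.

Lemma moduli_inv (A : 'M[R]_n) : A \in unitmx ->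
  (eig_moduli A)`_n.-1 = ((eig_moduli (invmx A))`_0)^-1.
Proof.
move=> uA; have uB : invmx A \in unitmx by rewrite unitmx_inv.
have pn : (n.-1 < n)%N by rewrite prednK.
have memA : (eig_moduli A)`_n.-1 \in eig_moduli A by rewrite mem_nth // size_eig_moduli.
have memB : (eig_moduli (invmx A))`_0 \in eig_moduli (invmx A).
  by rewrite mem_nth // size_eig_moduli.
have minA x : x \in eig_moduli A -> (eig_moduli A)`_n.-1 <= x.
  move=> xs; rewrite -(nth_index 0 xs).
  have := xs; rewrite -index_mem size_eig_moduli => hi.
  by apply: nth_moduli_le => //; rewrite -ltnS prednK.
have maxB x : x \in eig_moduli (invmx A) -> x <= (eig_moduli (invmx A))`_0.
  move=> xs; rewrite -(nth_index 0 xs); apply: nth_moduli_le => //.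
  by have := xs; rewrite -index_mem size_eig_moduli.
have Ap := nth_moduli_gt0 uA pn; have Bp := nth_moduli_gt0 uB n0.
have inv_mem (M : 'M[R]_n) y : M \in unitmx ->
    y \in eig_moduli M -> y^-1 \in eig_moduli (invmx M).
  move=> uM; rewrite !mem_sort => /mapP[z zs ->].
  have [_ h] := eigenvalue_inv uM zs; apply/mapP; exists z^-1 => //.
  by rewrite ComplexField.Normc.normcV.
apply/eqP; rewrite eq_le; apply/andP; split.
  by apply: minA; have := inv_mem _ _ uB memB; rewrite invmxK.
have := maxB _ (inv_mem _ _ uA memA).
by rewrite invf_ple.
Qed.

Lemma lambda_last (A : 'M[R]_n) : A \in unitmx -> lambda A n = - lambda (invmx A) 1.
Proof.
move=> uA; have uB : invmx A \in unitmx by rewrite unitmx_inv.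
apply: etrans (congr1 (@ln R) (moduli_inv uA)) _; apply: lnV; rewrite posrE.
exact: nth_moduli_gt0 uB n0.
Qed.

Lemma eig_seq_char_poly (A B : 'M[R]_n) :
  char_poly (cplx_mx A) = char_poly (cplx_mx B) -> eig_moduli A = eig_moduli B.
Proof. by rewrite /eig_moduli /eig_seq => ->. Qed.

Lemma eig_moduli_conj (P A : 'M[R]_n) : P \in unitmx ->
  eig_moduli (P *m A *m invmx P) = eig_moduli A.
Proof.
move=> uP; apply: eig_seq_char_poly; rewrite /cplx_mx !cplx_mul.
apply: char_poly_similar; rewrite -cplx_mul mulVmx //.
by apply/matrixP => i j; rewrite !mxE; case: (i == j).
Qed.

Lemma lambda_conj (P A : 'M[R]_n) k : P \in unitmx ->
  lambda (P *m A *m invmx P) k = lambda A k.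
Proof. by move=> uP; rewrite /lambda eig_moduli_conj. Qed.

Lemma mu_last (A : 'M[R]_n) : A \in unitmx -> mu A n = - mu (invmx A) 1.
Proof.
move=> uA; have uB : invmx A \in unitmx by rewrite unitmx_inv.
have pn : (n.-1 < n)%N by rewrite prednK.
have uC : invmx (A *m A^T) \in unitmx by rewrite unitmx_inv gram_unit.
have := muE uA pn; rewrite prednK // => ->.
apply: etrans (congr1 (fun x => ln x / 2) (moduli_inv (gram_unit uA))) _.
rewrite lnV ?posrE ?(nth_moduli_gt0 uC n0) // mulNr.
apply: etrans (congr1 -%R (esym (muE uB n0))); suff -> : eig_moduli (invmx A *m (invmx A)^T) = eig_moduli (invmx (A *m A^T)) by [].
(* The inverse of A A^T is A^-T A^-1, which is conjugate by A^-1 to A^-1 A^-T, the Gram matrix of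
   A^-1. *)
have -> : invmx A *m (invmx A)^T = invmx A *m invmx (A *m A^T) *m invmx (invmx A).
  have uT : A^T \in unitmx by rewrite unitmx_tr.
  rewrite invmxK -mulmxA; congr (_ *m _); rewrite trmx_inv.
  by rewrite -[RHS](mulmxK uT) -(mulmxA _ A) mulVmx ?mul1mx // gram_unit.
by rewrite eig_moduli_conj // unitmx_inv.
Qed.

Lemma mu1_nm (A : 'M[R]_n) : A \in unitmx ->
  mu A 1 <= ln (nm A) /\ ln (nm A) <= mu A 1 + 3 * L.
Proof.
move=> uA; have uM := gram_unit uA; have A0 := unitmx_nm_gt0 n0 uA.
rewrite muE //; set m := eig_moduli (A *m A^T).
have [S _] := gram_moduli A n0; have [S1 S2] := sum_sqr_nm A.
have h1 := head_le_sum (@eig_moduli_ge0 _ _ (A *m A^T)).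
have h2 := sum_sorted (eig_moduli_sorted (A *m A^T)) (@eig_moduli_ge0 _ _ (A *m A^T)).
rewrite size_eig_moduli in h2; rewrite S -/m in h1 h2.
have m0 : 0 < m`_0 by apply: nth_moduli_gt0.
have np : 0 < n%:R :> R by rewrite ltr0n.
have L0 := ln_dim_ge0.
split.
  rewrite ler_pdivrMr // mulr_natr -lnXn // ler_ln ?posrE ?exprn_gt0 //.
  exact: le_trans h1 S1.
have : ln (nm A ^+ 2) <= ln (n%:R ^+ 5 * m`_0).
  rewrite ler_ln ?posrE ?exprn_gt0 ?mulr_gt0 ?exprn_gt0 //.
  apply: le_trans S2 _; rewrite (exprSr _ 4) -mulrA ler_wpM2l // exprn_ge0 //; exact: ltW.
rewrite lnM ?posrE ?exprn_gt0 // !lnXn // -![ln _ *+ _]mulr_natr.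
by lra.
Qed.

Lemma mu12_wedge (A : 'M[R]_n) : A \in unitmx ->
  [/\ 0 < wedge_nm A, mu A 1 + mu A 2 <= ln (wedge_nm A) &
   ln (wedge_nm A) <= mu A 1 + mu A 2 + 6 * L].
Proof.
move=> uA; have uM := gram_unit uA.
rewrite !muE //; set m := eig_moduli (A *m A^T).
have [_ S] := gram_moduli A n0; have [S1 S2] := wedge2_nm A.
have /andP[] := pair_sums_sorted (eig_moduli_sorted (A *m A^T))
  (@eig_moduli_ge0 _ _ (A *m A^T)).
rewrite size_eig_moduli -/m; rewrite -/m in S; move: S.
set E := _ - _ => S h1 h2.
have m0 : 0 < m`_0 by apply: nth_moduli_gt0.
have m1 : 0 < m`_1 by apply: nth_moduli_gt0.
have mm : 0 < m`_0 * m`_1 by rewrite mulr_gt0.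
have np : 0 < n%:R :> R by rewrite ltr0n.
have L0 := ln_dim_ge0.
have w2 : m`_0 * m`_1 <= wedge_nm A ^+ 2 by lra.
have wp : 0 < wedge_nm A.
  rewrite lt_def wedge_nm_ge0 andbT; apply/eqP => w0.
  by move: (lt_le_trans mm w2); rewrite w0 expr0n ltxx.
split=> //.
  have : ln (m`_0 * m`_1) <= ln (wedge_nm A ^+ 2) by rewrite ler_ln ?posrE ?exprn_gt0.
  by rewrite lnM ?posrE // lnXn // -[ln _ *+ _]mulr_natr; lra.
(* The exponent 11 is 8 from [wedge2_nm], 2 from [pair_sums_sorted], and 1 because n >= 2 absorbs
   the factor 2. *)
have : ln (wedge_nm A ^+ 2) <= ln (n%:R ^+ 11 * (m`_0 * m`_1)).
  rewrite ler_ln ?posrE ?exprn_gt0 ?mulr_gt0 ?exprn_gt0 //.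
  apply: le_trans S2 _; rewrite -S.
  have -> : n%:R ^+ 11 * (m`_0 * m`_1) = n%:R ^+ 8 * (n%:R * (n%:R ^+ 2 * (m`_0 * m`_1))).
    by rewrite -[11%N]/(8 + 3)%N exprD; ring.
  rewrite ler_wpM2l ?exprn_ge0 ?(ltW np) //.
  have two : 2 <= n%:R :> R by rewrite ler_nat.
  by apply: ler_pM => //; lra.
rewrite lnM ?posrE ?exprn_gt0 // lnM ?posrE // !lnXn // -![ln _ *+ _]mulr_natr.
by lra.
Qed.

Lemma lambda1_nm (A : 'M[R]_n) : A \in unitmx -> lambda A 1 <= ln (nm A) + L.
Proof.
move=> uA; have A0 := unitmx_nm_gt0 n0 uA; have np : 0 < n%:R :> R by rewrite ltr0n.
have [_ _ h _] := eig_bounds A n0.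
have h1 := head_le_sum (@eig_moduli_ge0 _ _ A).
rewrite addrC -lnM ?posrE // ler_ln ?posrE ?mulr_gt0 ?nth_moduli_gt0 //.
exact: le_trans h1 h.
Qed.

Lemma lambda1_trace (A : 'M[R]_n) : A \in unitmx -> \tr A != 0 ->
  ln `|\tr A| <= lambda A 1 + L.
Proof.
move=> uA t0; have np : 0 < n%:R :> R by rewrite ltr0n.
have [h _ _ _] := eig_bounds A n0.
have h2 := sum_sorted (eig_moduli_sorted A) (@eig_moduli_ge0 _ _ A).
rewrite size_eig_moduli in h2.
rewrite addrC -lnM ?posrE ?nth_moduli_gt0 // ler_ln ?posrE ?mulr_gt0 ?nth_moduli_gt0 ?normr_gt0 //.
exact: le_trans h h2.
Qed.

Lemma lambda12_wedge (A : 'M[R]_n) : A \in unitmx ->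
  lambda A 1 + lambda A 2 <= ln (wedge_nm A) + 2 * L.
Proof.
move=> uA; have np : 0 < n%:R :> R by rewrite ltr0n.
have [wp _ _] := mu12_wedge uA.
have [_ _ _ h] := eig_bounds A n0.
have /andP[h1 _] := pair_sums_sorted (eig_moduli_sorted A) (@eig_moduli_ge0 _ _ A).
have s0 := nth_moduli_gt0 uA n0; have s1 := nth_moduli_gt0 uA n2.
have mm := mulr_gt0 s0 s1.
have : ln ((eig_moduli A)`_0 * (eig_moduli A)`_1) <= ln (n%:R ^+ 2 * wedge_nm A).
  by rewrite ler_ln ?posrE ?mulr_gt0 ?exprn_gt0 //; lra.
by rewrite !lnM ?posrE ?exprn_gt0 // /lambda /=; lra.
Qed.

Lemma lambda12_trace (A : 'M[R]_n) : A \in unitmx ->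
  \tr A ^+ 2 - \tr (A *m A) != 0 ->
  ln `|\tr A ^+ 2 - \tr (A *m A)| <= lambda A 1 + lambda A 2 + 2 * L.
Proof.
move=> uA t0; have np : 0 < n%:R :> R by rewrite ltr0n.
have [_ h _ _] := eig_bounds A n0.
have /andP[_ h1] := pair_sums_sorted (eig_moduli_sorted A) (@eig_moduli_ge0 _ _ A).
rewrite size_eig_moduli in h1.
have s0 := nth_moduli_gt0 uA n0; have s1 := nth_moduli_gt0 uA n2.
have mm := mulr_gt0 s0 s1.
have : ln `|\tr A ^+ 2 - \tr (A *m A)| <=
    ln (n%:R ^+ 2 * ((eig_moduli A)`_0 * (eig_moduli A)`_1)).
  rewrite ler_ln ?posrE ?mulr_gt0 ?exprn_gt0 ?normr_gt0 //.
  exact: le_trans h h1.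
by rewrite !lnM ?posrE ?exprn_gt0 // /lambda /=; lra.
Qed.

End LogSpectrum.

(** * Traces of second compounds and Zariski density *)

Section FiniteSpanning.
Variables (R : realType) (T : eqType) (m : nat) (P : T -> Prop) (v : T -> 'rV[R]_m).

Let M (F : seq T) : 'M[R]_(size F, m) := \matrix_(i < size F) v (tnth (in_tuple F) i).

Let v_sub F t : t \in F -> (v t <= M F)%MS.
Proof.
move=> tF; have iF : (index t F < size F)%N by rewrite index_mem.
have -> : v t = row (Ordinal iF) (M F).
  by rewrite rowK (tnth_nth t) /= nth_index.
exact: row_sub.
Qed.

(** The condition on x says by duality that x lies in the span of the v t. A finite F already spans;
    writing x as a combination y of its vectors with |y| <= p |x|, the square of x is the sum of the
    y_i times the pairings of v t_i with x, so these pairings cannot all be small compared with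
    |x|. *)
Lemma finite_spanning : exists F : seq T, (forall t, t \in F -> P t) /\
  exists2 K : R, 0 < K & forall x : 'rV[R]_m,
    (forall phi : 'cV[R]_m, (forall t, P t -> v t *m phi = 0) -> x *m phi = 0) ->
    x != 0 -> exists2 t, t \in F & nm x <= K * `|(v t *m x^T) 0 0|.
Proof.
(* A finite family of maximal rank spans every v t, since adding one more vector cannot raise the
   rank. *)
pose Q r := `[< exists F, (forall t, t \in F -> P t) /\ \rank (M F) = r >].
have exQ : exists r, Q r.
  by exists (\rank (M [::])); apply/asboolP; exists [::].
have ubQ r : Q r -> (r <= m)%N by move=> /asboolP[F [_ <-]]; apply: rank_leq_col.
case: (ex_maxnP exQ ubQ) => r /asboolP[F [FP rF]] rmax.
have span t : P t -> (v t <= M F)%MS.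
  move=> Pt; have sub : (M F <= M (t :: F))%MS.
    apply/row_subP => i; rewrite rowK; apply: v_sub.
    by rewrite inE mem_tnth orbT.
  have rk : (\rank (M (t :: F)) <= \rank (M F))%N.
    rewrite rF; apply: rmax; apply/asboolP; exists (t :: F); split=> // s.
    by rewrite inE => /orP[/eqP->|/FP].
  have := mxrank_leqif_sup sub; move=> [_ /esym h].
  apply: submx_trans (v_sub (mem_head t F)) _; rewrite h eqn_leq rk.
  by rewrite mxrankS.
exists F; split=> //; pose p := nm (pinvmx (M F)).
have p0 : 0 <= p by apply: nm_ge0.
have mp : 0 <= m%:R ^+ 2 * p by rewrite mulr_ge0 // exprn_ge0.
exists (m%:R ^+ 2 * p + 1) => [|x hx x0]; first by rewrite ltr_wpDl.
have xM : (x <= M F)%MS.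
  rewrite submxE; apply/eqP/matrixP => i j; rewrite [RHS]mxE.
  have -> : (x *m cokermx (M F)) i j = (x *m col j (cokermx (M F))) i 0.
    have -> : x *m col j (cokermx (M F)) = col j (x *m cokermx (M F)).
      by rewrite !colE; apply: mulmxA.
    by rewrite [RHS]mxE.
  rewrite hx ?mxE // => t Pt; have := span t Pt; rewrite submxE => /eqP h.
  by rewrite colE [LHS]mulmxA h mul0mx.
have np : 0 < nm x by rewrite nm_gt0.
have m0 : (0 < m)%N.
  by case: m x x0 {hx xM np mp} => // x; rewrite thinmx0 eqxx.
pose sq := \sum_j x 0 j ^+ 2.
have hsq : nm x ^+ 2 <= m%:R ^+ 2 * sq.
  have [j hj] := max_entry x m0.
  apply: le_trans (_ : (m%:R * `|x 0 j|) ^+ 2 <= _).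
    by rewrite lerXn2r ?nnegrE ?mulr_ge0.
  rewrite exprMn real_normK ?num_real // ler_wpM2l ?exprn_ge0 // /sq (bigD1 j) //= lerDl.
  by apply: sumr_ge0 => *; rewrite sqr_ge0.
have xE : x = x *m pinvmx (M F) *m M F by rewrite mulmxKpV.
set y := x *m pinvmx (M F) in xE.
have ny : nm y <= nm x * p by apply: nmM.
suff /hasP[t tF ht] : has (fun t => nm x <= (m%:R ^+ 2 * p + 1) * `|(v t *m x^T) 0 0|) F.
  by exists t.
apply/negPn/negP => /hasPn small.
have sqE : sq = \sum_i y 0 i * (v (tnth (in_tuple F) i) *m x^T) 0 0.
  have -> : sq = (x *m x^T) 0 0.
    by rewrite mxE; apply: eq_bigr => j _; rewrite mxE expr2.
  rewrite {1}xE -mulmxA mxE; apply: eq_bigr => i _; congr (_ * _).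
  by rewrite !mxE; apply: eq_bigr => j _; rewrite !mxE.
have le1 : (m%:R ^+ 2 * p + 1) * sq <= nm y * nm x.
  rewrite sqE mulr_sumr /nm big_ord1 mulr_suml; apply: ler_sum => i _.
  apply: le_trans (ler_norm _) _; rewrite !normrM mulrCA ler_wpM2l //.
  have := small _ (mem_tnth i (in_tuple F)); rewrite -ltNge => /ltW.
  by rewrite ger0_norm // addr_ge0.
have nyx : nm y * nm x <= p * nm x ^+ 2.
  by rewrite expr2 mulrA [p * _]mulrC ler_wpM2r.
have : 0 < sq.
  have m2 : 0 < m%:R ^+ 2 :> R by rewrite exprn_gt0 // ltr0n.
  by rewrite -(pmulr_rgt0 _ m2) (lt_le_trans _ hsq) // exprn_gt0.
have := ler_wpM2l p0 hsq; rewrite mulrA [p * _]mulrC.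
by lra.
Qed.

End FiniteSpanning.

Section ZariskiTrace.
Variables (R : realType) (n : nat).

Lemma polyfun_sum (I : Type) (r : seq I) (f : I -> 'M[R]_n -> R) :
  (forall i, polyfun (f i)) -> polyfun (fun A => \sum_(i <- r) f i A).
Proof.
move=> hf; elim: r => [|i r IH].
  have -> : (fun A => \sum_(i <- [::]) f i A) = (fun _ => 0).
    by apply/funext => A; rewrite big_nil.
  exact: polyfun_const.
have -> : (fun A => \sum_(j <- i :: r) f j A) = (fun A => f i A + \sum_(j <- r) f j A).
  by apply/funext => A; rewrite big_cons.
exact: polyfun_add.
Qed.

Lemma polyfun_minor2 i j k l : polyfun (fun A : 'M[R]_n => minor2 A i j k l).
Proof.
have -> : (fun A : 'M[R]_n => minor2 A i j k l) =
    (fun A => A i k * A j l + (-1) * (A i l * A j k)).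
  by apply/funext => A; rewrite /minor2 mulN1r.
by do !constructor.
Qed.

(* Cauchy-Binet for the trace of the second compound. *)
Lemma compound_trace (A B : 'M[R]_n) :
  2 * (\tr (A *m B) ^+ 2 - \tr (A *m B *m (A *m B))) =
  \sum_k \sum_l \sum_i \sum_j minor2 B k l i j * minor2 A^T k l i j.
Proof.
pose X := A *m B.
have XE i j : X i j = \sum_k A i k * B k j by rewrite mxE.
have trX : \tr X = \sum_i X i i by [].
have trXX : \tr (X *m X) = \sum_i \sum_j X i j * X j i.
  by apply: eq_bigr => i _; rewrite mxE.
rewrite -/X trXX expr2 {1}trX mulr_suml -sumrB mulr_sumr.
transitivity (\sum_i \sum_j \sum_k \sum_l minor2 B k l i j * minor2 A^T k l i j); last first.
  under eq_bigr => i _ do rewrite exchange_big /=.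
  rewrite exchange_big /=; apply: eq_bigr => k _.
  under eq_bigr => i _ do rewrite exchange_big /=.
  by rewrite exchange_big.
apply: eq_bigr => i _; rewrite trX mulr_sumr -sumrB mulr_sumr; apply: eq_bigr => j _.
have dbl (a b : 'I_n -> R) : \sum_k \sum_l a k * b l = (\sum_k a k) * (\sum_l b l).
  by rewrite mulr_suml; apply: eq_bigr => k _; rewrite mulr_sumr.
transitivity (\sum_k \sum_l (A i k * B k i * (A j l * B l j)
    + A j k * B k j * (A i l * B l i) - A j k * B k i * (A i l * B l j)
    - A i k * B k j * (A j l * B l i))).
  under [RHS]eq_bigr => k _ do rewrite !sumrB big_split.
  by rewrite !sumrB big_split /= !dbl -!XE; ring.
by apply: eq_bigr => k _; apply: eq_bigr => l _; rewrite /minor2 !mxE; ring.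
Qed.

Lemma wedge_nmT (A : 'M[R]_n) : wedge_nm A^T = wedge_nm A.
Proof.
rewrite /wedge_nm; under eq_bigr => i _ do rewrite exchange_big /=.
rewrite exchange_big /=; transitivity (\sum_k \sum_l \sum_i \sum_j `|minor2 A^T i j k l|).
  apply: eq_bigr => k _; under eq_bigr => i _ do rewrite exchange_big /=.
  by rewrite exchange_big.
do 4!(apply: eq_bigr => ? _); congr `|_|; rewrite /minor2 !mxE; congr (_ - _).
by rewrite mulrC.
Qed.

(** Let v A be the vector of 2 x 2 minors of A. A linear form in v A is a polynomial in A, so if it
    vanishes on the group it vanishes on SL, in particular at g^T. Thus [finite_spanning] applies to
    v g^T, and by [compound_trace] the pairing of v f with v g^T is, up to the factor 2, the
    expression in the conclusion. *)
Lemma zariski_trace (Gam : set 'M[R]_n) : zariski_dense_SL Gam ->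
  exists F : seq 'M[R]_n, (forall f, f \in F -> Gam f) /\
  exists2 a : R, 0 < a & forall g, \det g = 1 -> 0 < wedge_nm g ->
    exists2 f, f \in F &
      a * wedge_nm g <= `|\tr (g *m f) ^+ 2 - \tr (g *m f *m (g *m f))|.
Proof.
move=> zar; pose I := ('I_n * 'I_n * 'I_n * 'I_n)%type.
pose mi (A : 'M[R]_n) (q : I) := minor2 A q.1.1.1 q.1.1.2 q.1.2 q.2.
pose v (A : 'M[R]_n) : 'rV[R]_#|{: I}| := \row_q mi A (enum_val q).
have enumE (h : I -> R) : \sum_(q < #|{: I}|) h (enum_val q) = \sum_q h q.
  by rewrite -big_enum_val; apply: eq_bigl.
have quadE (f : 'I_n -> 'I_n -> 'I_n -> 'I_n -> R) :
    \sum_i \sum_j \sum_k \sum_l f i j k l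
    = \sum_(q : 'I_#|{: I}|) (fun q : I => f q.1.1.1 q.1.1.2 q.1.2 q.2) (enum_val q).
  rewrite (enumE (fun q : I => f q.1.1.1 q.1.1.2 q.1.2 q.2)).
  by rewrite pair_bigA /= pair_bigA /= pair_bigA.
have nmv A : nm (v A) = wedge_nm A.
  rewrite /wedge_nm quadE /nm big_ord1; apply: eq_bigr => q _.
  by rewrite mxE.
have [F [FG [K K0 hK]]] := finite_spanning Gam v.
exists F; split=> //; exists (2 * K)^-1; first by rewrite invr_gt0 mulr_gt0.
move=> g dg wg.
have v0 : v g^T != 0 by rewrite -nm_gt0 nmv wedge_nmT.
have hx (phi : 'cV[R]_#|{: I}|) : (forall t, Gam t -> v t *m phi = 0) -> v g^T *m phi = 0.
  move=> hphi; pose p A := \sum_(q : 'I_#|{: I}|) mi A (enum_val q) * phi q 0.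
  have pE A : (v A *m phi) 0 0 = p A by rewrite mxE; apply: eq_bigr => q _; rewrite mxE.
  have pp : polyfun p.
    apply: polyfun_sum => q; apply: polyfun_mul; first exact: polyfun_minor2.
    exact: polyfun_const.
  have p0 t : Gam t -> p t = 0 by move=> Gt; rewrite -pE hphi // mxE.
  apply/matrixP => a b; rewrite !ord1 pE [RHS]mxE; apply: zar pp p0 _ _.
  by rewrite det_tr.
have [t tF ht] := hK _ hx v0; exists t => //.
rewrite nmv wedge_nmT in ht.
have E : (v t *m (v g^T)^T) 0 0 = 2 * (\tr (g *m t) ^+ 2 - \tr (g *m t *m (g *m t))).
  by rewrite compound_trace quadE mxE; apply: eq_bigr => q _; rewrite !mxE.
rewrite E normrM ger0_norm // in ht.
have K2 : 0 < 2 * K by rewrite mulr_gt0.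
by rewrite mulrC ler_pdivrMr // [leRHS]mulrC -mulrA mulrCA.
Qed.

End ZariskiTrace.

(** * Counting and growth rates *)

Section Covers.
Local Open Scope classical_set_scope.
Local Open Scope card_scope.
Local Open Scope ring_scope.
Variable T : choiceType.

Definition covered (A : set T) (m : nat) : Prop :=
  exists s : seq T, (size s <= m)%N /\ forall x, A x -> x \in s.

Lemma covered_card (A : set T) m : covered A m -> exists2 n, (n <= m)%N & A #= `I_n.
Proof.
move=> [s [sm sA]].
have leA : A #<= `I_(size s).
  case: s sA {sm} => [|x0 s] sA.
    by have -> : A = set0 by apply/seteqP; split=> // x /sA.
  apply: card_le_trans (card_image_le (nth x0 (x0 :: s)) _); apply: subset_card_le.
  move=> x /sA xs; exists (index x (x0 :: s)); last exact: nth_index.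
  by rewrite -index_mem in xs.
have /finite_setP[n An] : finite_set A by apply/finite_set_leP; exists (size s).
exists n => //; apply: leq_trans sm; rewrite -card_le_II.
by rewrite -(card_le_eql An).
Qed.

Lemma card_covered (A : set T) n : A #= `I_n -> covered A n.
Proof.
move=> An; have fA : finite_set A by apply/finite_setP; exists n.
exists (finmap.enum_fset (fset_set A)); split; last first.
  by move=> x Ax; have := in_fset_set fA x; rewrite /= mem_set.
by rewrite -(card_fset_set An).
Qed.

Lemma card_le_covered (A : set T) n m : A #= `I_n -> covered A m -> (n <= m)%N.
Proof.
move=> An /covered_card[k km Ak]; rewrite (_ : n = k) //.
by apply/card_eq_II; apply: card_eq_trans Ak; rewrite card_eq_sym.
Qed.

End Covers.

Section Growth.
Local Open Scope classical_set_scope.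
Local Open Scope card_scope.
Local Open Scope ring_scope.
Variable R : realType.
Implicit Types (f : R -> nat) (a : R).

Definition growth f : \bar R := growth_rate (fun r => ((f r)%:R)%:E).

Lemma ecardE (T : Type) (A : set T) n : A #= `I_n -> ecard R A = (n%:R)%:E :> \bar R.
Proof.
move=> An; rewrite /ecard -[RHS]ereal_inf1; congr ereal_inf.
apply/seteqP; split=> [_ [k /= Ak <-]|_ ->]; last by exists n.
congr (_%:R%:E); apply/card_eq_II; apply: card_eq_trans An.
by rewrite card_eq_sym.
Qed.

Lemma growth_ecard (T : Type) (A : R -> set T) f : (forall r, A r #= `I_(f r)) ->
  growth_rate (fun r => ecard R (A r)) = growth f.
Proof. by move=> h; congr growth_rate; apply/funext => r; apply: ecardE. Qed.

Lemma growth_ge0 f : (forall r, 0 <= r -> (0 < f r)%N) -> (0 <= growth f)%E.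
Proof.
move=> f0; apply: le_ereal_inf_tmp => _ [M _ <-].
pose r := Num.max M 1; apply: le_ereal_sup_tmp.
have r1 : 1 <= r by rewrite le_max lexx orbT.
exists (ln (f r)%:R / r)%:E; first by exists r => //=; rewrite le_max lexx.
by rewrite lee_fin divr_ge0 ?ln_ge0 ?ler1n ?f0 ?(le_trans ler01).
Qed.

Lemma growth_le f a M : (forall r, M <= r -> 0 < r -> ln (f r)%:R <= a * r) ->
  (growth f <= a%:E)%E.
Proof.
move=> h; apply: ge_ereal_inf.
exists (ereal_sup [set (ln (f r)%:R / r)%:E | r in [set r | Num.max M 1 <= r]]).
  by exists (Num.max M 1).
apply: ge_ereal_sup => _ [r /= Mr <-]; move: Mr; rewrite ge_max => /andP[Mr r1].
have r0 : 0 < r by apply: lt_le_trans r1.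
by rewrite lee_fin ler_pdivrMr // h.
Qed.

Lemma growth_lt f a : (growth f < a%:E)%E ->
  exists M, forall r, M <= r -> 0 < r -> ln (f r)%:R <= a * r.
Proof.
move=> /ereal_inf_lt[_ [M _ <-] supa]; exists M => r Mr r0.
rewrite -ler_pdivrMr // -lee_fin; apply: ltW; apply: le_lt_trans supa.
by apply: ereal_sup_ubound; exists r.
Qed.

Lemma growth_exp f a : (forall r, 0 <= r -> (0 < f r)%N) ->
  (forall r s, r <= s -> (f r <= f s)%N) -> 0 <= a -> (growth f < a%:E)%E ->
  exists2 K, 1 <= K & forall r, 0 <= r -> (f r)%:R <= K * expR (a * r).
Proof.
move=> f0 fm a0 /growth_lt[M hM]; pose M1 := Num.max M 1.
exists ((f M1)%:R + 1) => [|r r0]; first by rewrite lerDr.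
have [rM|Mr] := leP r M1.
  have e1 : 1 <= expR (a * r) by rewrite -[leLHS]expR0 ler_expR mulr_ge0.
  have : (f r)%:R <= (f M1)%:R :> R by rewrite ler_nat fm.
  have F0 : 0 <= (f M1)%:R :> R by [].
  by nra.
have : (f r)%:R <= expR (a * r).
  have fp : 0 < (f r)%:R :> R by rewrite ltr0n f0.
  rewrite -[leLHS]lnK ?posrE // ler_expR; move: Mr; rewrite gt_max => /andP[/ltW Mr r1].
  by rewrite hM // (lt_trans ltr01).
have F0 : 0 <= (f M1)%:R :> R by [].
have e0 := expR_ge0 (a * r).
by nra.
Qed.

Lemma growth_poly_exp f (K s t : R) : (forall r, 0 <= r -> (0 < f r)%N) -> 0 < K -> s < t ->
  (forall r, 0 <= r -> (f r)%:R <= K * (r + 1) ^+ 2 * expR (s * r)) ->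
  (growth f <= t%:E)%E.
Proof.
(* Of the slack t - s = 4 e, one half absorbs the factor (r + 1)^2 and the other half the constants,
   for r large. *)
move=> f0 K0 st hf; pose e := (t - s) / 4; have e0 : 0 < e by rewrite divr_gt0 // subr_gt0.
pose c := `|ln (K / e ^+ 2)| + 2 * e.
apply: (@growth_le _ _ (c / (2 * e))) => r hr r0.
have fp : 0 < (f r)%:R :> R by rewrite ltr0n f0 // ltW.
have e2 : 0 < e ^+ 2 by rewrite exprn_gt0.
have Ke : 0 < K / e ^+ 2 by rewrite divr_gt0.
have poly : (r + 1) ^+ 2 <= (e ^+ 2)^-1 * expR (2 * e * (r + 1)).
  have h1 : e * (r + 1) <= expR (e * (r + 1)).
    by apply: le_trans (expR_ge1Dx _); rewrite lerDr.
  have E2 : expR (2 * e * (r + 1)) = expR (e * (r + 1)) ^+ 2.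
    by rewrite -expRM_natl mulrA.
  rewrite [leRHS]mulrC ler_pdivlMr // E2 -exprMn [(r + 1) * e]mulrC.
  have er : 0 <= e * (r + 1).
    by apply: mulr_ge0; [exact: ltW | apply: addr_ge0; rewrite ?ler01 // ltW].
  by rewrite lerXn2r ?nnegrE ?expR_ge0.
have : (f r)%:R <= K / e ^+ 2 * expR (2 * e * (r + 1) + s * r).
  apply: le_trans (hf r (ltW r0)) _; rewrite expRD mulrA ler_wpM2r ?expR_ge0 //.
  by rewrite -[leRHS]mulrA ler_wpM2l ?(ltW K0).
move=> h0.
have h : ln (f r)%:R <= ln (K / e ^+ 2) + (2 * e * (r + 1) + s * r).
  rewrite -[X in _ + X]expRK -lnM ?posrE ?expR_gt0 // ler_ln ?posrE //.
  by rewrite mulr_gt0 ?expR_gt0.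
have e20 : 0 < 2 * e by rewrite pmulr_rgt0.
have hc : c <= 2 * e * r by rewrite mulrC -(ler_pdivrMr _ _ e20).
have hn := ler_norm (ln (K / e ^+ 2)).
have st4 : t = s + 4 * e by rewrite /e; field.
rewrite st4; move: hc; rewrite /c; move: (ln (K / e ^+ 2)) hn h => x hn h hc.
by lra.
Qed.

Lemma growth_shift (f g : R -> nat) (C : R) : 0 <= C -> (forall r, 0 <= r -> (0 < f r)%N) ->
  (forall r, 0 <= r -> (0 < g r)%N) ->
  (forall r, 0 <= r -> (f r <= g (r + C)%R)%N) -> (growth f <= growth g)%E.
Proof.
move=> C0 f0 g0 fg; have := growth_ge0 g0.
case E : (growth g) => [b| |] // b0; last by rewrite leey.
apply/lee_addgt0Pr => e e0; rewrite -EFinD.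
have : (growth g < (b + e / 2)%:E)%E by rewrite E lte_fin ltrDl divr_gt0.
move=> /growth_lt[M hM].
(* Beyond this threshold the cost (b + e / 2) C of the shift is at most e r / 2. *)
apply: (@growth_le _ _ (Num.max M (2 * (b + e / 2) * C / e))) => r.
rewrite ge_max => /andP[Mr hr] r0; rewrite ler_pdivrMr // in hr.
apply: le_trans (_ : (b + e / 2) * (r + C) <= _); last by lra.
apply: le_trans (hM (r + C) _ _); last 2 first.
- by rewrite (le_trans Mr) // lerDl.
- by rewrite ltr_wpDr.
have fp : 0 < (f r)%:R :> R by rewrite ltr0n f0 // ltW.
have gp : 0 < (g (r + C))%:R :> R by rewrite ltr0n g0 // addr_ge0 // ltW.
by rewrite ler_ln ?posrE // ler_nat fg // ltW.
Qed.

(* The growth exponents satisfy gN <= max(gN / 2, gH), hence gN <= gH. *)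
Lemma growth_convolution (N H : R -> nat) (c : nat) (K b0 : R) :
  (forall r, 0 <= r -> (0 < N r)%N) -> (forall r, 0 <= r -> (0 < H r)%N) ->
  (forall r s, r <= s -> (N r <= N s)%N) -> (forall r s, r <= s -> (H r <= H s)%N) ->
  0 <= K -> (growth N <= b0%:E)%E ->
  (forall r, 0 <= r ->
     (N r <= c * (Num.truncn (K * (r + 1))%R).+1 *
       \sum_(q < (Num.truncn ((r + K) / 2)%R).+1) N (q%:R + 1)%R * H (r + K - 2 * q%:R)%R)%N) ->
  (growth N <= growth H)%E.
Proof.
move=> N0 H0 Nm Hm K0 Nb conv.
rewrite leNgt; apply/negP => HN.
have gH := growth_ge0 H0; have gN := growth_ge0 N0.
have [d dE] : exists d, growth N = d%:E.
  by move: gN Nb; case: (growth N) => [d| |] // _ _; exists d.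
have [h hE] : exists h, growth H = h%:E.
  by move: gH HN; rewrite dE; case: (growth H) => [h| |] // _ _; exists h.
rewrite hE dE lte_fin in HN; rewrite hE lee_fin in gH.
have d0 : 0 < d by apply: le_lt_trans HN.
(* Supposing h < d: a exceeds h and b exceeds d, so exponential bounds hold at these rates, while a
   and b / 2 both stay below d. As N is evaluated near q and H near r - 2 q, every term of the sum
   grows at rate at most s = max a (b / 2) < d. *)
pose a := (h + d) / 2; pose b := 4 * d / 3; pose s := Num.max a (2 * d / 3).
have a0 : 0 <= a by rewrite /a; lra.
have sa : a <= s by rewrite le_max lexx.
have sb : b / 2 <= s by rewrite le_max; apply/orP; right; rewrite /b; lra.
have sd : s < d by rewrite gt_max /a; apply/andP; split; lra.
have s0 : 0 <= s by apply: le_trans sa.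
have b_ge0 : 0 <= b by rewrite /b; lra.
have [KN KN1 hN] : exists2 KN, 1 <= KN & forall r, 0 <= r -> (N r)%:R <= KN * expR (b * r).
  by apply: growth_exp => //; rewrite dE lte_fin /b; lra.
have [KH KH1 hH] : exists2 KH, 1 <= KH & forall r, 0 <= r -> (H r)%:R <= KH * expR (a * r).
  by apply: growth_exp => //; rewrite hE lte_fin /a; lra.
have KN0 : 0 <= KN by apply: le_trans KN1.
have KH0 : 0 <= KH by apply: le_trans KH1.
pose E0 := KN * KH * expR (b + s * K).
have E00 : 0 < E0 by rewrite !mulr_gt0 ?expR_gt0 // (lt_le_trans ltr01).
have term r (q : nat) : 0 <= r -> q%:R <= (r + K) / 2 ->
    (N (q%:R + 1)%R * H (r + K - 2 * q%:R)%R)%:R <= E0 * expR (s * r).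
  move=> r0 qr; rewrite natrM.
  have q0 : 0 <= q%:R :> R by [].
  have h1 := hN (q%:R + 1) (addr_ge0 q0 ler01).
  have r'0 : 0 <= r + K - 2 * q%:R by lra.
  have h2 := hH _ r'0.
  apply: le_trans (ler_pM (ler0n _ _) (ler0n _ _) h1 h2) _.
  rewrite mulrACA -expRD /E0 -[leRHS]mulrA -expRD ler_wpM2l ?mulr_ge0 // ler_expR.
  have u1 : b * q%:R <= 2 * s * q%:R by rewrite ler_wpM2r //; lra.
  have u2 : a * (r + K - 2 * q%:R) <= s * (r + K - 2 * q%:R) by rewrite ler_wpM2r.
  by lra.
pose P := (c%:R + 1) * (K + 1) * (K + 2) * E0.
have cR : 0 <= c%:R :> R by [].
have P0 : 0 < P.
  by apply: mulr_gt0 => //; apply: mulr_gt0; [apply: mulr_gt0 |]; lra.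
have : (growth N <= ((s + d) / 2)%:E)%E.
  apply: (growth_poly_exp N0 P0 (_ : s < (s + d) / 2)); first by lra.
  move=> r r0; have := conv r r0; rewrite -(ler_nat R) => /le_trans; apply.
  rewrite !natrM natr_sum.
  have rK : 0 <= (r + K) / 2 by rewrite divr_ge0 // addr_ge0.
  have Kr : 0 <= K * (r + 1) by rewrite mulr_ge0 // addr_ge0.
  set Q := Num.truncn ((r + K) / 2); set I := Num.truncn (K * (r + 1)).
  have hQ : Q%:R <= (r + K) / 2 by rewrite truncn_le.
  have hI : I%:R <= K * (r + 1) by rewrite truncn_le.
  have hsum : \sum_(q < Q.+1) (N (q%:R + 1)%R * H (r + K - 2 * q%:R)%R)%:R
      <= Q.+1%:R * (E0 * expR (s * r)).
    rewrite [leRHS]mulr_natl -[X in _ <= _ *+ X]card_ord -[leRHS]sumr_const; apply: ler_sum => q _.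
    apply: term => //; apply: le_trans hQ; rewrite ler_nat -ltnS; exact: ltn_ord.
  have X0 : 0 <= E0 * expR (s * r) by rewrite mulr_ge0 ?expR_ge0 // ltW.
  have e1 : I.+1%:R <= (K + 1) * (r + 1) by rewrite -natr1; lra.
  have e2 : Q.+1%:R <= (K + 2) * (r + 1).
    rewrite -natr1; have : 0 <= K * r by rewrite mulr_ge0.
    lra.
  have e3 : c%:R <= c%:R + 1 :> R by lra.
  apply: le_trans (_ : (c%:R + 1) * ((K + 1) * (r + 1)) *
      ((K + 2) * (r + 1) * (E0 * expR (s * r))) <= _).
    apply: ler_pM; rewrite ?mulr_ge0 ?sumr_ge0 //.
      by apply: ler_pM.
    by apply: le_trans hsum _; rewrite ler_wpM2r.
  by rewrite le_eqVlt; apply/orP; left; apply/eqP; rewrite /P; ring.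
by rewrite dE lee_fin; lra.
Qed.

End Growth.

Lemma index_arith (R : realType) (x w ci A s K0 i : R) :
  0 <= x -> 0 <= A -> 0 <= s -> 0 <= K0 ->
  w <= ci * (x + 1) -> i <= w + A + 1 + s ->
  i <= (K0 + (ci + 1 + A + s)) * (x + 1).
Proof.
move=> x0 A0 s0 K00 hw hi.
have e1 : 0 <= s * x by rewrite mulr_ge0.
have e2 : 0 <= A * x by rewrite mulr_ge0.
have e3 : 0 <= K0 * x by rewrite mulr_ge0.
by lra.
Qed.

Lemma shell_arith (R : realType) (x y z w K r : R) :
  2 * x + y <= z + K -> z <= r -> 0 <= y -> w <= x ->
  x <= (r + K) / 2 /\ y <= r + K - 2 * w.
Proof. by move=> h1 h2 h3 h4; split; lra. Qed.

(* lra compares atoms up to conversion, which diverges on invmx: abstract them first. *)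
Ltac abstract_atom t :=
  let a := fresh "a" in set (a := t) in *; clearbody a.
Ltac lra_atoms :=
  repeat match goal with
  | |- context [@ln ?R ?x] => abstract_atom (@ln R x)
  | |- context [@mu ?R ?n ?g ?k] => abstract_atom (@mu R n g k)
  | |- context [@lambda ?R ?n ?g ?k] => abstract_atom (@lambda R n g k)
  | H : context [@ln ?R ?x] |- _ => abstract_atom (@ln R x)
  | H : context [@mu ?R ?n ?g ?k] |- _ => abstract_atom (@mu R n g k)
  | H : context [@lambda ?R ?n ?g ?k] |- _ => abstract_atom (@lambda R n g k)
  end; lra.

(** * Projective Anosov groups *)

Section WordMetric.
Variables (R : realType) (n : nat) (S : seq 'M[R]_n).
Hypothesis detS : forall s, s \in S -> \det s = 1.
Local Notation Gam := (gen_group S).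

Lemma det1_unit (g : 'M[R]_n) : \det g = 1 -> g \in unitmx.
Proof. by move=> dg; rewrite unitmxE dg unitr1. Qed.

Lemma letter_det x : is_letter S x -> \det x = 1.
Proof.
move=> /hasP[s sS /orP[]/eqP->]; first exact: detS.
by rewrite det_inv detS // invr1.
Qed.

Lemma letter_inv x : is_letter S x -> is_letter S (invmx x).
Proof.
move=> /hasP[s sS h]; apply/hasP; exists s => //.
by case/orP: h => /eqP->; rewrite ?invmxK eqxx ?orbT.
Qed.

Lemma word_prod_cat (v w : seq 'M[R]_n) : word_prod (v ++ w) = word_prod v *m word_prod w.
Proof. by elim: v => [|x v IH] /=; rewrite ?mul1mx // IH mulmxA. Qed.

Lemma word_det w : is_word S w -> \det (word_prod w) = 1.
Proof.
elim: w => [|x w IH] /=; first by rewrite det1.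
by move=> /andP[xS wS]; rewrite det_mulmx letter_det // IH // mulr1.
Qed.

Lemma invmx_mul (A B : 'M[R]_n) : A \in unitmx -> B \in unitmx ->
  invmx (A *m B) = (invmx B : 'M[R]_n) *m (invmx A : 'M[R]_n).
Proof.
move=> uA uB; have uAB : A *m B \in unitmx by rewrite unitmx_mul uA.
by rewrite -[RHS](mulmxK uAB) !mulmxA -(mulmxA (invmx B)) mulVmx // mulmx1 mulVmx // mul1mx.
Qed.

Definition winv (w : seq 'M[R]_n) : seq 'M[R]_n := rev (map invmx w).

Lemma size_winv w : size (winv w) = size w.
Proof. by rewrite size_rev size_map. Qed.

Lemma winv_word w : is_word S w -> is_word S (winv w).
Proof.
move=> wS; apply/allP => x; rewrite mem_rev => /mapP[y yw ->].
exact/letter_inv/(allP wS).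
Qed.

Lemma winv_prod w : is_word S w -> word_prod (winv w) = invmx (word_prod w).
Proof.
elim: w => [_|x w IH] /=; first by rewrite /winv /= invmx1.
move=> /andP[xS wS]; rewrite /winv map_cons rev_cons -cats1 word_prod_cat.
rewrite -/(winv w) IH //= mulmx1 invmx_mul //; apply: det1_unit; first exact: letter_det.
exact: word_det.
Qed.

Lemma Gam1 : Gam 1%:M. Proof. by exists [::]. Qed.

Lemma GamM g h : Gam g -> Gam h -> Gam (g *m h).
Proof.
move=> [v [vS <-]] [w [wS <-]]; exists (v ++ w); rewrite word_prod_cat; split=> //.
by rewrite /is_word all_cat; apply/andP.
Qed.

Lemma GamV g : Gam g -> Gam (invmx g).
Proof. by move=> [w [wS <-]]; exists (winv w); rewrite winv_word ?winv_prod. Qed.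

Lemma Gam_det g : Gam g -> \det g = 1.
Proof. by move=> [w [wS <-]]; apply: word_det. Qed.

Lemma Gam_unit g : Gam g -> g \in unitmx.
Proof. by move=> /Gam_det/det1_unit. Qed.

Definition wlen (g : 'M[R]_n) : nat := xget 0%N [set k | is_wlen S g k]%classic.

Lemma wlenP g : Gam g -> is_wlen S g (wlen g).
Proof.
move=> [w0 [w0S w0g]].
pose P k := `[< exists w, [/\ is_word S w, word_prod w = g & size w = k] >].
have exP : exists k, P k by exists (size w0); apply/asboolP; exists w0.
rewrite /wlen; case: xgetP => [y _ //|none]; case: (ex_minnP exP) => k /asboolP Pk kmin.
case: (none k); split=> // w wS wg; apply: kmin; apply/asboolP.
by exists w.
Qed.

Lemma geodesic_word g : Gam g ->
  exists w, [/\ is_word S w, word_prod w = g & size w = wlen g].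
Proof. by move=> /wlenP[]. Qed.

Lemma wlen_le w : is_word S w -> (wlen (word_prod w) <= size w)%N.
Proof.
move=> wS; have Gw : Gam (word_prod w) by exists w.
by have [_] := wlenP Gw; apply.
Qed.

Lemma wlenM g h : Gam g -> Gam h -> (wlen (g *m h) <= wlen g + wlen h)%N.
Proof.
move=> /geodesic_word[v [vS <- <-]] /geodesic_word[w [wS <- <-]].
rewrite -word_prod_cat -size_cat; apply: wlen_le.
by rewrite /is_word all_cat; apply/andP.
Qed.

Lemma wlenV g : Gam g -> wlen (invmx g) = wlen g.
Proof.
have half h : Gam h -> (wlen (invmx h) <= wlen h)%N.
  move=> /geodesic_word[w [wS <- <-]]; rewrite -winv_prod // -size_winv.
  exact/wlen_le/winv_word.
move=> Gg; apply/eqP; rewrite eqn_leq half //=.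
by have := half _ (GamV Gg); rewrite invmxK.
Qed.

Lemma wlen_subword w i j : is_word S w -> size w = wlen (word_prod w) ->
  (i <= j)%N -> (j <= size w)%N ->
  wlen (invmx (word_prod (take i w)) *m word_prod (take j w)) = (j - i)%N.
Proof.
move=> wS wg ij jw.
have wSt k : is_word S (take k w).
  by apply/allP => x /mem_take; apply: (allP wS).
have wSd k : is_word S (drop k w).
  by apply/allP => x /mem_drop; apply: (allP wS).
have unit_word v : is_word S v -> word_prod v \in unitmx.
  by move=> vS; apply/det1_unit/word_det.
set v := drop i (take j w).
have vS : is_word S v by apply/allP => x /mem_drop/mem_take; apply: (allP wS).
have tE : take j w = take i w ++ v by rewrite -[LHS](cat_take_drop i) take_takel.
have sv : size v = (j - i)%N by rewrite size_drop size_takel.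
rewrite tE word_prod_cat mulKmx ?unit_word //; apply/eqP; rewrite eqn_leq -{1}sv wlen_le //=.
have e1 : word_prod w = word_prod (take i w) *m word_prod v *m word_prod (drop j w).
  by rewrite -word_prod_cat -tE -word_prod_cat cat_take_drop.
have Gw u : is_word S u -> Gam (word_prod u) by move=> uS; exists u.
have := wlenM (GamM (Gw _ (wSt i)) (Gw _ vS)) (Gw _ (wSd j)).
have := wlenM (Gw _ (wSt i)) (Gw _ vS).
have := wlen_le (wSt i); have := wlen_le (wSd j).
rewrite -e1 -wg size_drop size_takel; last by apply: leq_trans ij jw.
move: jw ij; move: (size w) (wlen _) (wlen _) (wlen _) => a b c d.
by clear; lia.
Qed.

Definition kap (g : 'M[R]_n) : R := ln (nm g) + ln (nm (invmx g)).

Definition elt := {g : 'M[R]_n | Gam g}.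
Definition edist (x y : elt) : nat := wlen (invmx (sval x) *m sval y).
Definition kdist (x y : elt) : R := kap (invmx (sval x) *m sval y).

Lemma elt_inj (x y : elt) : sval x = sval y -> x = y.
Proof.
case: x y => [x hx] [y hy] /= xy; subst y; congr exist; exact: Prop_irrelevance.
Qed.

Lemma edist_path (x y : elt) : exists p : nat -> elt,
  [/\ p 0%N = x, p (edist x y) = y & geodesic edist p (edist x y)].
Proof.
have Gg : Gam (invmx (sval x) *m sval y) by apply: GamM (GamV (svalP x)) (svalP y).
have [w [wS wg sw]] := geodesic_word Gg.
have wSt k : is_word S (take k w) by apply/allP => z /mem_take; apply: (allP wS).
have Gp k : Gam (sval x *m word_prod (take k w)).
  by apply: GamM (svalP x) _; exists (take k w).
have ux := Gam_unit (svalP x).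
exists (fun k => exist _ _ (Gp k)); split.
- by apply: elt_inj => /=; rewrite take0 mulmx1.
- by apply: elt_inj => /=; rewrite -/(edist x y) /edist -sw take_size wg mulKVmx.
- move=> i j ij jl; rewrite /edist /= invmx_mul //; last first.
    by apply: Gam_unit; exists (take i w).
  rewrite -mulmxA mulKmx // wlen_subword // ?wg //.
  by rewrite sw.
Qed.

Hypothesis n2 : (2 <= n)%N.
Let n0 : (0 < n)%N := ltnW n2.
Hypothesis anosov : proj_anosov S.

Lemma letter_bound : exists2 B : R, 1 <= B &
  forall g, Gam g -> (wlen g <= 1)%N -> bounded_step B g.
Proof.
pose B := n%:R + \sum_(s <- S) (nm s + nm (invmx s)).
have n1 : 1 <= n%:R :> R by rewrite ler1n.
have sum0 : 0 <= \sum_(s <- S) (nm s + nm (invmx s)) by apply: sumr_ge0 => *; rewrite addr_ge0.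
have hB g : Gam g -> (wlen g <= 1)%N -> nm g <= B.
  move=> Gg; have [w [wS <- <-]] := geodesic_word Gg.
  case: w wS => [|x [|y w]] //= => [_|]; first by rewrite nm1 lerDl.
  rewrite andbT mulmx1 => /hasP[s sS h] _; rewrite /B (big_rem s) //=.
  have r0 : 0 <= \sum_(t <- rem s S) (nm t + nm (invmx t)).
    by apply: sumr_ge0 => *; rewrite addr_ge0.
  have := nm_ge0 s; have := nm_ge0 (invmx s).
  by case/orP: h => /eqP->; lra.
exists B; first by rewrite /B; lra.
move=> g Gg g1; exists (invmx g); rewrite mulmxV ?Gam_unit //; split=> //; first exact: hB.
by apply: hB; rewrite ?wlenV //; apply: GamV.
Qed.

Lemma Gam_nm_gt0 g : Gam g -> 0 < nm g.
Proof. by move=> /Gam_unit; apply: unitmx_nm_gt0. Qed.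

Lemma Gam_near_rank1 : exists2 C : R, 1 <= C & exists2 c : R, 0 < c &
  forall g, Gam g -> near_rank1 (C * expR (- (c * (wlen g)%:R))) g.
Proof.
have [c [c' [c0 c'0 hA]]] := anosov.
pose L := ln (n%:R : R); have L0 : 0 <= L by apply: ln_dim_ge0.
have np : 0 < n%:R :> R by rewrite ltr0n.
(* Of 8 L, 6 L comes from [mu12_wedge] and 2 L from the factor n^2 in [near_rank1_wedge]; the ratio
   wedge / |g|^2 itself is of order exp (mu_2 - mu_1). *)
exists (expR (c' + 8 * L)); first by rewrite -[leLHS]expR0 ler_expR; lra.
exists c => // g Gg; apply: near_rank1_wedge.
have ug := Gam_unit Gg; have gp := Gam_nm_gt0 Gg.
have [wp _ w1] := mu12_wedge n2 ug; have [m1 _] := mu1_nm n2 ug.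
have hm := hA g _ (wlenP Gg).
rewrite -ler_ln ?posrE; last 2 first.
- by rewrite mulr_gt0 // ltr0n expn_gt0 n0.
- by rewrite !mulr_gt0 ?expR_gt0.
rewrite lnM ?posrE // ?ltr0n ?expn_gt0 ?n0 // natrX lnXn // -[ln _ *+ 2]mulr_natr.
rewrite -expRD lnM ?posrE ?expR_gt0 ?exprn_gt0 // expRK lnXn // -[ln _ *+ 2]mulr_natr.
by rewrite -/L in w1 *; lra.
Qed.

(* The corner at 1 between the paths p and q; the exponential rate is divided by 3
   since the concatenation is only a (3,0)-quasigeodesic. *)
Lemma corner_nm : exists2 d : R, 0 < d & forall (p q : nat -> 'M[R]_n) l m,
  (forall i, (i <= l)%N -> Gam (p i)) -> (forall i, (i <= m)%N -> Gam (q i)) ->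
  p 0%N = 1%:M -> q 0%N = 1%:M ->
  (forall i, (i < l)%N -> wlen (invmx (p i) *m p i.+1) <= 1)%N ->
  (forall i, (i < m)%N -> wlen (invmx (q i) *m q i.+1) <= 1)%N ->
  (forall i j, (i <= l)%N -> (j <= m)%N -> (i + j <= 3 * wlen (invmx (p i) *m q j))%N) ->
  d * (nm (invmx (p l)) * nm (q m)) <= nm (invmx (p l) *m q m).
Proof.
have [B B1 hB] := letter_bound; have [C C1 [c c0 hC]] := Gam_near_rank1.
pose th := expR (- (c / 3)).
have th01 : 0 < th < 1 by rewrite expR_gt0 expR_lt1 oppr_lt0 divr_gt0.
have [d d0 hd] := quasi_multiplicative n0 B1 C1 th01; exists d => //.
move=> p q l m Gp Gq p0 q0 ps qs pq.
apply: (hd (fun i => invmx (p i)) q l m).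
- split; first by rewrite p0 invmx1 trmx1.
  move=> k kl; exists (invmx (p k.+1) *m p k)^T; last first.
    by rewrite -trmx_mul -mulmxA mulmxV ?mulmx1 //; apply/Gam_unit/Gp/ltnW.
  apply: bounded_stepT; have Gk := Gp k (ltnW kl); have Gk1 := Gp k.+1 kl.
  have Gx := GamM (GamV Gk) Gk1.
  apply: hB; first exact: GamM (GamV Gk1) Gk.
  have := ps k kl; rewrite -(wlenV Gx) invmx_mul ?unitmx_inv ?Gam_unit //.
  by rewrite invmxK.
- split=> // k kl; exists (invmx (q k) *m q k.+1); last first.
    by rewrite mulKVmx //; apply/Gam_unit/Gq/ltnW.
  apply: hB (qs k kl); exact: GamM (GamV (Gq k (ltnW kl))) (Gq k.+1 kl).
- move=> i j il jm; apply: near_rank1W (hC _ _); last exact: GamM (GamV (Gp i il)) (Gq j jm).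
  rewrite ler_wpM2l ?(le_trans ler01) // /th -expRM_natl ler_expR.
  have := pq i j il jm; rewrite -(ler_nat R) natrM.
  set u := (i + j)%:R; set v := (wlen _)%:R => uv.
  have : c * u <= c * (3 * v) by rewrite ler_pM2l.
  by lra.
Qed.

Lemma kap_ge0 g : Gam g -> 0 <= kap g.
Proof.
move=> Gg; have Gi := GamV Gg; rewrite /kap -lnM ?posrE ?Gam_nm_gt0 // ln_ge0 //.
apply: le_trans (nmM _ _); rewrite mulmxV ?Gam_unit // nm1.
by rewrite ler1n.
Qed.

Lemma kapV g : kap (invmx g) = kap g.
Proof. by rewrite /kap invmxK addrC. Qed.

Lemma lnmM g h : Gam g -> Gam h -> ln (nm (g *m h)) <= ln (nm g) + ln (nm h).
Proof.
move=> Gg Gh; rewrite -lnM ?posrE ?Gam_nm_gt0 // ler_ln ?posrE ?mulr_gt0 ?Gam_nm_gt0 ?nmM //.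
exact: GamM.
Qed.

Lemma kapM g h : Gam g -> Gam h -> kap (g *m h) <= kap g + kap h.
Proof.
move=> Gg Gh; rewrite /kap invmx_mul ?Gam_unit //.
have := lnmM Gg Gh; have := lnmM (GamV Gh) (GamV Gg); lra.
Qed.

(** [corner_nm] controls one of the two logarithms in [kap]; exchanging the two paths gives the
    other, whence D = - 2 ln d. *)
Lemma Gam_coarse_geometry : exists D K : R, coarse_geometry edist kdist D K.
Proof.
have [d d0 hd] := corner_nm; have [B B1 hB] := letter_bound.
have Gxy (x y : elt) : Gam (invmx (sval x) *m sval y) by apply: GamM (GamV (svalP x)) (svalP y).
have invxy (x y : elt) : invmx (invmx (sval x) *m sval y) = invmx (sval y) *m sval x.
  by rewrite invmx_mul ?invmxK // ?unitmx_inv Gam_unit //; apply: svalP.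
have split3 (x y z : elt) :
    invmx (sval x) *m sval z = invmx (sval x) *m sval y *m (invmx (sval y) *m sval z).
  by rewrite -mulmxA mulKVmx // Gam_unit //; apply: svalP.
exists (- (2 * ln d)), (2 * ln B); split.
- by move=> x y; rewrite /edist -invxy wlenV.
- by move=> x y z; rewrite /edist (split3 x y z) wlenM.
- exact: edist_path.
- by move=> x y; rewrite /kdist -invxy kapV.
- by move=> x y; apply: kap_ge0.
- by move=> x y z; rewrite /kdist (split3 x y z) kapM.
- move=> x y xy; have [y' [yy' yB y'B]] := hB _ (Gxy x y) xy.
  have B0 : 0 < B by apply: lt_le_trans B1.
  have Ey : invmx (invmx (sval x) *m sval y) = y'.
    by rewrite -[LHS]mulmx1 -yy' mulKmx // Gam_unit.
  have Gi := GamV (Gxy x y); rewrite Ey in Gi.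
  have : ln (nm (invmx (sval x) *m sval y)) <= ln B by rewrite ler_ln ?posrE ?Gam_nm_gt0.
  have : ln (nm y') <= ln B by rewrite ler_ln ?posrE ?Gam_nm_gt0.
  by rewrite /kdist /kap Ey; lra.
have key (p q : nat -> elt) l m : geodesic edist p l -> geodesic edist q m ->
    p 0%N = q 0%N ->
    (forall i j, (i <= l)%N -> (j <= m)%N -> (i + j <= 3 * edist (p i) (q j))%N) ->
    ln d + ln (nm (invmx (sval (p l)) *m sval (p 0%N)))
      + ln (nm (invmx (sval (p 0%N)) *m sval (q m)))
      <= ln (nm (invmx (sval (p l)) *m sval (q m))).
  move=> hp hq pq hpq; pose z := sval (p 0%N).
  pose P i := invmx z *m sval (p i); pose Q i := invmx z *m sval (q i).
  have uz : z \in unitmx by apply: Gam_unit; apply: svalP.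
  have PP (a b : elt) : invmx (invmx z *m sval a) *m (invmx z *m sval b)
      = invmx (sval a) *m sval b.
    by rewrite (invxy (p 0%N) a) -mulmxA mulKVmx.
  have := hd P Q l m; rewrite /P /Q (PP (p l) (q m)) (invxy (p 0%N) (p l)).
  have l1 := Gam_nm_gt0 (Gxy (p l) (p 0%N)); have l2 := Gam_nm_gt0 (Gxy (p 0%N) (q m)).
  have l3 := Gam_nm_gt0 (Gxy (p l) (q m)).
  move=> h; rewrite -addrA -!lnM ?posrE ?mulr_gt0 // ler_ln ?posrE ?mulr_gt0 //.
  apply: h.
  + by move=> i _; apply: (Gxy (p 0%N) (p i)).
  + by move=> i _; apply: (Gxy (p 0%N) (q i)).
  + by rewrite mulVmx.
  + by rewrite /z pq mulVmx // Gam_unit //; apply: svalP.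
  + by move=> i il; rewrite (PP (p i) (p i.+1)) -/(edist _ _) hp // subSnn.
  + by move=> i il; rewrite (PP (q i) (q i.+1)) -/(edist _ _) hq // subSnn.
  + by move=> i j il jm; rewrite (PP (p i) (q j)); apply: hpq.
move=> p q l m hp hq pq hpq.
have k1 := key p q l m hp hq pq hpq.
have k2 : ln d + ln (nm (invmx (sval (q m)) *m sval (p 0%N)))
      + ln (nm (invmx (sval (p 0%N)) *m sval (p l)))
      <= ln (nm (invmx (sval (q m)) *m sval (p l))).
  rewrite pq; apply: (key q p m l) => // i j im jl.
  rewrite addnC /edist -invxy wlenV; first exact: hpq.
  exact: Gxy.
rewrite /kdist /kap !invxy; lra_atoms.
Qed.


Lemma lnm_wlen : exists2 K : R, 0 <= K & forall g, Gam g -> ln (nm g) <= K * ((wlen g)%:R + 1).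
Proof.
have [B B1 hB] := letter_bound.
have B0 : 0 < B by apply: lt_le_trans B1.
have L0 : 0 <= ln (n%:R : R) by apply: ln_dim_ge0.
have lB : 0 <= ln B by apply: ln_ge0.
exists (ln B + ln n%:R) => [|g Gg]; first exact: addr_ge0.
have [w [wS <- <-]] := geodesic_word Gg.
elim: w wS => [_|x w IH /= /andP[xS wS]].
  by rewrite /= nm1 add0r mulr1 lerDr.
have Gx : Gam x by exists [:: x]; rewrite /is_word /= mulmx1 xS.
have Gw : Gam (word_prod w) by exists w.
have {}IH := IH wS.
apply: le_trans (lnmM Gx Gw) _; rewrite -natr1.
have wx : (wlen x <= 1)%N.
  by have := @wlen_le [:: x]; rewrite /is_word /= mulmx1 xS => /(_ isT).
have : ln (nm x) <= ln B.
  by rewrite ler_ln ?posrE ?Gam_nm_gt0 //; apply: bounded_step_nm (hB _ Gx wx).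
by lra_atoms.
Qed.

Lemma wlen_gap : exists2 c : R, 0 < c & forall g, Gam g ->
  c * (wlen g)%:R <= mu g 1 - mu g 2 + 1.
Proof.
have [c [c' [c0 c'0 hA]]] := anosov.
(* For x >= 0 one has x + c' <= (1 + c') (x + 1): rescaling the slope turns the additive constant
   into 1. *)
pose a := (1 + c')^-1; have a0 : 0 < a by rewrite invr_gt0; lra_atoms.
exists (c * a) => [|g Gg]; first exact: mulr_gt0.
have hm := hA g _ (wlenP Gg); have m2 : mu g 2 <= mu g 1.
  by apply: mu_antimono => //; apply: Gam_unit.
rewrite mulrAC ler_pdivrMr; last by lra_atoms.
have : 0 <= (mu g 1 - mu g 2) * c' by rewrite mulr_ge0 ?subr_ge0 // ltW.
by lra_atoms.
Qed.

Lemma kap_gap g : Gam g -> mu g 1 - mu g 2 <= mu g 1 - mu g n <= kap g.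
Proof.
move=> Gg; have uB := Gam_unit (GamV Gg); have ug := Gam_unit Gg.
have n1 : (1 <= n.-1)%N by rewrite -ltnS prednK.
have h : mu g n <= mu g 2.
  by have := mu_antimono ug n1; rewrite prednK //; apply.
rewrite lerD2l lerN2 h /= (mu_last n2 ug) /kap opprK.
by apply: lerD; [have [] := mu1_nm n2 ug | have [] := mu1_nm n2 uB].
Qed.

Lemma kap_mu g : Gam g -> kap g <= mu g 1 - mu g n + 6 * ln n%:R.
Proof.
move=> Gg; have uB := Gam_unit (GamV Gg); have ug := Gam_unit Gg.
rewrite (mu_last n2 ug) opprK /kap.
have [_ h1] := mu1_nm n2 ug; have [_ h2] := mu1_nm n2 uB; lra_atoms.
Qed.

(** [cyclic_reduction] for left translation by g and base point 1: at the point eta the displacement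
    is the kappa-length of eta^-1 g eta. *)
Lemma conj_reduction : exists2 C : R, 0 <= C & forall g, Gam g -> exists eta,
  [/\ Gam eta, 2 * kap eta + kap (invmx eta *m g *m eta) <= kap g + C &
    2 * kap (invmx eta *m g *m eta) <=
      kap (invmx eta *m g *m eta *m (invmx eta *m g *m eta)) + C].
Proof.
have [D [K cg]] := Gam_coarse_geometry.
have [C hC] := cyclic_reduction cg; exists `|C| => // g Gg.
pose tr (h : 'M[R]_n) (Gh : Gam h) (x : elt) : elt := exist _ _ (GamM Gh (svalP x)).
pose o : elt := exist _ _ Gam1.
have ug := Gam_unit Gg.
have inv_tr (x y : elt) :
    invmx (g *m sval x) *m (g *m sval y) = invmx (sval x) *m sval y.
  by rewrite invmx_mul ?Gam_unit //; [rewrite -mulmxA mulKmx | apply: svalP].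
have [||||z [h1 h2]] := hC (tr g Gg) (tr _ (GamV Gg)) o.
- by move=> x; apply: elt_inj => /=; rewrite mulKmx.
- by move=> x; apply: elt_inj => /=; rewrite mulKVmx.
- by move=> x y; rewrite /edist /= inv_tr.
- by move=> x y; rewrite /kdist /= inv_tr.
have uz : sval z \in unitmx by apply: Gam_unit; apply: svalP.
have C1 : C <= `|C| by apply: ler_norm.
exists (sval z); split; first exact: svalP.
- by move: h1; rewrite /kdist /= invmx1 !mul1mx mulmx1 mulmxA; lra_atoms.
- have E : invmx (sval z) *m g *m sval z *m (invmx (sval z) *m g *m sval z)
      = invmx (sval z) *m (g *m (g *m sval z)).
    by rewrite -!mulmxA mulKVmx.
  by rewrite E; move: h2; rewrite /kdist /= !mulmxA; lra_atoms.
Qed.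

(** Since ln |g^-2| <= 2 ln |g^-1|, the hypothesis leaves |g g| >= exp (- C0) |g|^2. A long g is
    close enough to rank one for [trace_lower_bound], and the trace bounds lambda_1 from below. *)
Lemma nearly_cyclic_lambda (C0 : R) : 0 <= C0 -> exists2 C : R, 0 <= C &
  forall g, Gam g -> 2 * kap g <= kap (g *m g) + C0 -> ln (nm g) <= lambda g 1 + C.
Proof.
move=> C00; have [C C1 [c c0 hC]] := Gam_near_rank1.
have [K K0 hK] := lnm_wlen; pose L := ln (n%:R : R).
have L0 : 0 <= L by apply: ln_dim_ge0.
pose a := expR (- C0); have a0 : 0 < a by apply: expR_gt0.
have a1 : a <= 1 by rewrite -expR0 ler_expR oppr_le0.
have th01 : 0 <= expR (- c) < 1 by rewrite expR_ge0 expR_lt1 oppr_lt0.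
have [N hN] := geometric_small (C * 16 / a) th01.
exists (2 * K * (N%:R + 1) + 2 * L + C0 + ln 4) => [|g Gg hg].
  by rewrite !addr_ge0 ?mulr_ge0 ?addr_ge0 // ln_ge0 // ler1n.
have ug := Gam_unit Gg; have gp := Gam_nm_gt0 Gg.
have l4 : 0 <= ln 4 :> R by rewrite ln_ge0 // ler1n.
(* For short g both sides are bounded, as lambda_1(g) >= lambda_n(g) = - lambda_1(g^-1). *)
have [gN|gN] := leqP N (wlen g); last first.
  have lm : (wlen g)%:R <= N%:R :> R by rewrite ler_nat ltnW.
  have Gi := GamV Gg; have k1 := hK g Gg; have k2 := hK _ Gi.
  rewrite wlenV // in k2; have l1 := lambda1_nm n2 (Gam_unit Gi).
  have := lambda_antimono ug (leq0n n.-1).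
  rewrite prednK // (lambda_last n2 ug) => /(_ (leqnn _)) h.
  have : K * ((wlen g)%:R + 1) <= K * (N%:R + 1) by rewrite ler_wpM2l // lerD2r.
  by rewrite -/L in l1; lra_atoms.
have e0 : 0 <= C * expR (- (c * (wlen g)%:R)) by rewrite mulr_ge0 ?expR_ge0 // (le_trans ler01).
have e1 : C * expR (- (c * (wlen g)%:R)) <= a / 16.
  have := ltW (hN _ gN); rewrite -expRM_natl mulrN [_%:R * c]mulrC => h.
  have -> : C * expR (- (c * (wlen g)%:R)) =
     (C * 16 / a * expR (- (c * (wlen g)%:R))) * (a / 16) by field; rewrite gt_eqF.
  by rewrite ler_piMl // divr_ge0 // ltW.
have hgg : a * nm g ^+ 2 <= nm (g *m g).
  have Ggg := GamM Gg Gg; have Gi := GamV Gg.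
  rewrite -ler_ln ?posrE ?mulr_gt0 ?exprn_gt0 ?Gam_nm_gt0 //.
  rewrite lnM ?posrE ?exprn_gt0 // lnXn // expRK -[ln _ *+ 2]mulr_natr.
  move: hg; rewrite /kap invmx_mul //; have := lnmM Gi Gi.
  by lra_atoms.
have h : a / 4 * nm g <= `|\tr g|.
  exact: (trace_lower_bound (introT andP (conj a0 a1)) (introT andP (conj e0 e1)) (hC g Gg) hgg).
have p4 : 0 < 4^-1 :> R by rewrite invr_gt0 ltr0n.
have tp : 0 < `|\tr g|.
  by apply: lt_le_trans h; rewrite mulr_gt0 // divr_gt0.
have := h; rewrite -ler_ln ?posrE ?mulr_gt0 ?divr_gt0 //.
rewrite lnM ?posrE ?divr_gt0 // lnM ?posrE ?invr_gt0 ?ltr0n // lnV ?posrE ?ltr0n // expRK => h2.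
rewrite normr_gt0 in tp.
have h3 : - C0 - ln 4 + ln (nm g) <= lambda g 1 + L.
  exact: le_trans h2 (lambda1_trace n2 ug tp).
have : 0 <= K * (N%:R + 1) by rewrite mulr_ge0 // addr_ge0.
by lra_atoms.
Qed.

Lemma conj_class_eq g h : Gam h ->
  conj_class Gam (h *m g *m invmx h) = conj_class Gam g.
Proof.
move=> Gh; have uh := Gam_unit Gh; apply/seteqP; split=> x [e Ge ->].
  exists (e *m h); first exact: GamM.
  by rewrite invmx_mul ?Gam_unit // !mulmxA.
exists (e *m invmx h); first exact: GamM (GamV Gh).
by rewrite invmx_mul ?unitmx_inv ?Gam_unit // invmxK !mulmxA !mulmxKV.
Qed.

Lemma invmx_conj g h : Gam g -> Gam h ->
  invmx (invmx h *m g *m h) = invmx h *m invmx g *m h.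
Proof.
move=> Gg Gh; have uh := Gam_unit Gh; have ug := Gam_unit Gg.
have ui : invmx h \in unitmx by rewrite unitmx_inv.
have uhg : invmx h *m g \in unitmx by rewrite unitmx_mul ui.
by rewrite (invmx_mul uhg uh) (invmx_mul ui ug) invmxK mulmxA.
Qed.

Lemma class_representative : exists2 C : R, 0 <= C & forall g, Gam g -> exists h,
  [/\ Gam h, conj_class Gam h = conj_class Gam g,
   mu h 1 - mu h 2 <= lambda g 1 - lambda g 2 + C &
   mu h 1 - mu h n <= lambda g 1 - lambda g n + C].
Proof.
have [C0 C00 hC0] := conj_reduction; have [C C1 hC] := nearly_cyclic_lambda C00.
pose L := ln (n%:R : R); have L0 : 0 <= L by apply: ln_dim_ge0.
exists (2 * C + 8 * L) => [|g Gg]; first by lra_atoms.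
have [eta [Ge _ h2]] := hC0 g Gg; set h := invmx eta *m g *m eta in h2.
have Gh : Gam h by apply: GamM => //; apply: GamM => //; apply: GamV.
have ue := Gam_unit Ge; have uh := Gam_unit Gh; have ug := Gam_unit Gg.
have l1 := hC h Gh h2.
have hi2 : 2 * kap (invmx h) <= kap (invmx h *m invmx h) + C0.
  by rewrite -(invmx_mul uh uh) !kapV.
have l2 := hC _ (GamV Gh) hi2.
have hE : h = invmx eta *m g *m invmx (invmx eta) by rewrite invmxK.
have lam k : lambda h k = lambda g k.
  by rewrite hE lambda_conj // unitmx_inv.
exists h; split => //.
- by rewrite hE conj_class_eq //; apply: GamV.
(* Write mu_1 - mu_2 as 2 mu_1 - (mu_1 + mu_2): the first term costs 2 C, and passing from lambda_1
   + lambda_2 to mu_1 + mu_2 through minors costs 8 L. *)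
- have [_ _ w2] := mu12_wedge n2 uh; have [m1 _] := mu1_nm n2 uh.
  have l12 := lambda12_wedge n2 uh; rewrite -/L in w2 l12.
  by rewrite !lam in l1 l12; lra_atoms.
- have [_ mh] := andP (kap_gap Gh); apply: le_trans mh _.
  have -> : lambda g n = lambda h n by rewrite lam.
  by rewrite (lambda_last n2 uh) /kap; rewrite lam in l1; lra_atoms.
Qed.

(* eta is a nearest point to 1 on the geodesic from eta to eta g. *)
Lemma nearest_corner : exists2 d : R, 0 < d & forall eta u,
  Gam eta -> is_word S u -> size u = wlen (word_prod u) ->
  (forall j, (j <= size u)%N -> (wlen eta <= wlen (eta *m word_prod (take j u)))%N) ->
  d * (nm eta * nm (word_prod u)) <= nm (eta *m word_prod u) /\
  d * (nm (invmx (word_prod u)) * nm (invmx eta)) <= nm (invmx (word_prod u) *m invmx eta).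
Proof.
have [d d0 hd] := corner_nm; exists d => // eta u Ge uS ug near.
have Gi := GamV Ge; have [v [vS vg sv]] := geodesic_word Gi.
have sub w k : is_word S w -> Gam (word_prod (take k w)).
  by move=> wS; exists (take k w); split=> //; apply/allP => z /mem_take; apply: (allP wS).
have gsub w i j : is_word S w -> size w = wlen (word_prod w) -> (i <= j <= size w)%N ->
    wlen (invmx (word_prod (take i w)) *m word_prod (take j w)) = (j - i)%N.
  by move=> wS wl /andP[ij jw]; apply: wlen_subword.
have vg' : size v = wlen (word_prod v) by rewrite vg sv.
pose p i := word_prod (take i v); pose q i := word_prod (take i u).
have p0 : p 0%N = 1%:M by rewrite /p take0.
have q0 : q 0%N = 1%:M by rewrite /q take0.
have pl : p (size v) = invmx eta by rewrite /p take_size.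
have ql : q (size u) = word_prod u by rewrite /q take_size.
have Gp i : Gam (p i) by apply: sub.
have Gq i : Gam (q i) by apply: sub.
have ps i : (i < size v)%N -> (wlen (invmx (p i) *m p i.+1) <= 1)%N.
  by move=> iv; rewrite gsub ?subSnn // iv leqnSn.
have qs i : (i < size u)%N -> (wlen (invmx (q i) *m q i.+1) <= 1)%N.
  by move=> iv; rewrite gsub ?subSnn // iv leqnSn.
(* As in [projection], with e the distance on the right: nearness of eta gives i <= e ([E1]), the
   triangle inequality gives j <= i + e ([E2]). *)
have key i j : (i <= size v)%N -> (j <= size u)%N ->
    (i + j <= 3 * wlen (invmx (p i) *m q j))%N.
  move=> iv ju; have Gpi := Gp i; have Gqj := Gq j.
  have upi := Gam_unit Gpi; have uqj := Gam_unit Gqj.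
  have E1 : (size v <= (size v - i) + wlen (invmx (p i) *m q j))%N.
    have := near j ju; rewrite -/(q j) -(wlenV Ge) -sv => h; apply: leq_trans h _.
    have -> : eta *m q j = invmx (invmx (p i) *m p (size v)) *m (invmx (p i) *m q j).
      have upv := Gam_unit (Gp (size v)).
      rewrite invmx_mul ?unitmx_inv // invmxK pl invmxK.
      by rewrite -!mulmxA mulKVmx.
    have G1 := GamM (GamV Gpi) (Gp (size v)).
    apply: leq_trans (wlenM (GamV G1) (GamM (GamV Gpi) Gqj)) _.
    by rewrite wlenV // gsub // ?iv // leqnn andbT.
  have E2 : (j <= i + wlen (invmx (p i) *m q j))%N.
    have e1 : wlen (q j) = j.
      by have := gsub u 0%N j uS ug; rewrite take0 invmx1 mul1mx subn0; apply; rewrite leq0n.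
    have e2 : wlen (p i) = i.
      by have := gsub v 0%N i vS vg'; rewrite take0 invmx1 mul1mx subn0; apply; rewrite leq0n.
    rewrite -{1}e1 -{1}e2; have -> : q j = p i *m (invmx (p i) *m q j) by rewrite mulKVmx.
    by rewrite {2}mulKVmx //; apply: wlenM => //; apply: GamM => //; apply: GamV.
  move: E1 E2 iv; move: (wlen _) (size v) => e m; clear; lia.
have h1 := hd p q (size v) (size u) (fun i _ => Gp i) (fun i _ => Gq i) p0 q0 ps qs key.
have h2 : d * (nm (invmx (q (size u))) * nm (p (size v))) <=
    nm (invmx (q (size u)) *m p (size v)).
  apply: (hd q p (size u) (size v)) => // i j iu jv.
  rewrite addnC (leq_trans (key j i jv iu)) // leq_mul2l /=.
  rewrite -wlenV ?invmx_mul ?invmxK ?unitmx_inv ?Gam_unit //.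
  exact: GamM (GamV _) _.
by rewrite pl ql in h1 h2; rewrite invmxK in h1.
Qed.

Lemma word_prod_rot (u : seq 'M[R]_n) j : is_word S u ->
  word_prod (rot j u) = invmx (word_prod (take j u)) *m word_prod u *m word_prod (take j u).
Proof.
move=> uS; have Gt : Gam (word_prod (take j u)).
  by exists (take j u); split=> //; apply/allP => z /mem_take; apply: (allP uS).
rewrite /rot word_prod_cat; congr (_ *m _).
have {3}-> : u = take j u ++ drop j u by rewrite cat_take_drop.
by rewrite word_prod_cat mulKmx // Gam_unit.
Qed.

Lemma rot_word (u : seq 'M[R]_n) j : is_word S u -> is_word S (rot j u).
Proof. by move=> uS; apply/allP => x; rewrite mem_rot; apply: (allP uS). Qed.

(** Here w is a shortest word of its class. Among all g = eta u eta^-1 with u a rotation of w,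
    choose eta of least length. The points eta (prefix of u) conjugate g to further rotations, so
    eta is nearest to 1 on the axis in both directions, and [nearest_corner] holds for u and for
    u^-1. As u is long, [concat_through_rank1] gives |g| >= b |eta||u||eta^-1|, while lambda_1(g) =
    lambda_1(u) is at most ln |u| up to a constant. *)
Lemma long_class : exists N, exists2 C : R, 0 <= C & forall g w,
  Gam g -> is_word S w -> (N <= size w)%N ->
  (exists2 e, Gam e & g = e *m word_prod w *m invmx e) ->
  (forall e, Gam e -> (size w <= wlen (e *m word_prod w *m invmx e))%N) ->
  exists i eta, [/\ Gam eta, (i < (size w).+1)%N, g = eta *m word_prod (rot i w) *m invmx eta,
    kap eta + lambda g 1 <= ln (nm g) + C &
    kap eta + lambda (invmx g) 1 <= ln (nm (invmx g)) + C].
Proof.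
have [d d0 hd] := nearest_corner; have [C C1 [c c0 hC]] := Gam_near_rank1.
pose L := ln (n%:R : R); have L0 : 0 <= L by apply: ln_dim_ge0.
pose a := Num.min d 1; have a0 : 0 < a by rewrite lt_min d0 ltr01.
have a1 : a <= 1 by rewrite ge_min lexx orbT.
have ad : a <= d by rewrite ge_min lexx.
have a01 : 0 < a <= 1 by rewrite a0.
have aa : 0 < a ^+ 2 / 4 by rewrite divr_gt0 ?exprn_gt0.
have th01 : 0 <= expR (- c) < 1 by rewrite expR_ge0 expR_lt1 oppr_lt0.
have [N hN] := geometric_small (C * 16 / a ^+ 2) th01.
exists N, (`|ln (a ^+ 2 / 4)| + L) => [|g w Gg wS Nw [e0 Ge0 ge0] wmin]; first exact: addr_ge0.
pose P k := `[< exists2 eta, Gam eta & wlen eta = k /\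
   exists i, (i <= size w)%N /\ g = eta *m word_prod (rot i w) *m invmx eta >].
have exP : exists k, P k.
  by exists (wlen e0); apply/asboolP; exists e0 => //; split=> //; exists 0%N; rewrite rot0.
case: (ex_minnP exP) => k /asboolP[eta Ge [ek [i [iw gE]]]] kmin.
exists i, eta; set u := rot i w in gE.
have uS : is_word S u by apply: rot_word.
have su : size u = size w by rewrite size_rot.
have ue := Gam_unit Ge.
have Gu : Gam (word_prod u) by exists u.
have Gw : Gam (word_prod w) by exists w.
have uu := Gam_unit Gu.
have sub v j : is_word S v -> Gam (word_prod (take j v)).
  by move=> vS; exists (take j v); split=> //; apply/allP => z /mem_take; apply: (allP vS).
have ug : size u = wlen (word_prod u).
  apply/eqP; rewrite eqn_leq wlen_le // andbT su.
  rewrite /u word_prod_rot //; have Gt := sub w i wS.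
  by have := wmin _ (GamV Gt); rewrite invmxK.
have cand h : Gam h -> (exists j, (j <= size w)%N /\ g = h *m word_prod (rot j w) *m invmx h) ->
    (wlen eta <= wlen h)%N.
  by move=> Gh hj; rewrite ek; apply: kmin; apply/asboolP; exists h.
have near j : (j <= size u)%N -> (wlen eta <= wlen (eta *m word_prod (take j u)))%N.
  move=> ju; have Gt := sub u j uS; have ut := Gam_unit Gt.
  apply: cand; first exact: GamM.
  exists (if (j + i <= size w)%N then j + i else j + i - size w)%N; split.
    by case: ifP => // _; rewrite leq_subLR leq_add // -su.
  have -> : rot (if (j + i <= size w)%N then j + i else j + i - size w)%N w = rot j u.
    by rewrite /u rot_add_mod // -su.
  by rewrite word_prod_rot // invmx_mul // !mulmxA mulmxK // mulmxK // -gE.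
(* Backwards along the axis: eta u^-1 (prefix of u) = g^-1 eta (prefix of u). As g^-1 commutes with
   g, this also conjugates g to a rotation. *)
have nearV j : (j <= size (winv u))%N ->
    (wlen eta <= wlen (eta *m word_prod (take j (winv u))))%N.
  rewrite size_winv => ju.
  have -> : word_prod (take j (winv u)) =
      invmx (word_prod u) *m word_prod (take (size u - j) u).
    have dS : is_word S (drop (size u - j) u).
      by apply/allP => z /mem_drop; apply: (allP uS).
    have tS := sub u (size u - j)%N uS.
    have Gd : Gam (word_prod (drop (size u - j) u)) by exists (drop (size u - j) u).
    rewrite /winv take_rev size_map -map_drop -/(winv _) winv_prod //.
    rewrite -{3}(cat_take_drop (size u - j) u) word_prod_cat invmx_mul ?Gam_unit //.
    by rewrite mulmxKV // Gam_unit.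
  have -> : eta *m (invmx (word_prod u) *m word_prod (take (size u - j) u)) =
     invmx g *m (eta *m word_prod (take (size u - j) u)).
    have ueu : eta *m word_prod u \in unitmx by rewrite unitmx_mul ue.
    rewrite gE invmx_mul ?unitmx_inv // invmx_mul // invmxK.
    by rewrite -!mulmxA mulKmx.
  set h := eta *m _; have Gh : Gam h by apply: GamM (sub _ _ uS).
  have uh := Gam_unit Gh; have ugg := Gam_unit Gg.
  set m := (size u - j)%N in h Gh uh *.
  have Gt := sub u m uS; have ut := Gam_unit Gt.
  have mu_ : (m <= size u)%N by apply: leq_subr.
  apply: cand; first exact: GamM (GamV Gg) Gh.
  exists (if (m + i <= size w)%N then m + i else m + i - size w)%N; split.
    by case: ifP => // _; rewrite leq_subLR leq_add // -su.
  have -> : rot (if (m + i <= size w)%N then m + i else m + i - size w)%N w = rot m u.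
    by rewrite /u rot_add_mod // -su.
  have -> : invmx (invmx g *m h) = invmx h *m g by rewrite invmx_mul ?unitmx_inv // invmxK.
  rewrite word_prod_rot //; set X := _ *m word_prod (take m u).
  have gh : h *m X *m invmx h = g.
    by rewrite /X /h invmx_mul // !mulmxA mulmxK // mulmxK // -gE.
  have hX : h *m X = g *m h by rewrite -[in RHS]gh mulmxKV.
  by rewrite -(mulmxA (invmx g) h) hX mulKmx // mulmxA mulmxV // mul1mx.
have [c1 c2] := hd eta u Ge uS ug near.
have svu : size (winv u) = wlen (word_prod (winv u)).
  by rewrite size_winv winv_prod // wlenV.
have := hd eta (winv u) Ge (winv_word uS) svu nearV; rewrite winv_prod // invmxK => -[c3 c4].
have e1 : C * expR (- (c * (size u)%:R)) <= a ^+ 2 / 16.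
  have := ltW (hN (size u) _); rewrite su => /(_ Nw).
  rewrite -expRM_natl mulrN [_%:R * c]mulrC => h.
  have -> : C * expR (- (c * (size w)%:R)) =
     (C * 16 / a ^+ 2 * expR (- (c * (size w)%:R))) * (a ^+ 2 / 16).
    by field; rewrite gt_eqF.
  by rewrite ler_piMl // divr_ge0 // sqr_ge0.
have weak x y : d * x <= y -> 0 <= x -> a * x <= y.
  by move=> h x0; apply: le_trans h; rewrite ler_wpM2r.
have Gi := GamV Gu; have Gei := GamV Ge.
have r1 := hC _ Gu; rewrite -ug in r1.
have r2 := hC _ Gi; rewrite wlenV // -ug in r2.
have f1 := concat_through_rank1 a01 e1 r1 (weak _ _ c1 (mulr_ge0 _ _)) (weak _ _ c4 (mulr_ge0 _ _)).
have f2 := concat_through_rank1 a01 e1 r2 (weak _ _ c3 (mulr_ge0 _ _)) (weak _ _ c2 (mulr_ge0 _ _)).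
have ueu : eta *m word_prod u \in unitmx by rewrite unitmx_mul ue.
have gEi : invmx g = eta *m invmx (word_prod u) *m invmx eta.
  by rewrite gE invmx_mul ?unitmx_inv // invmx_mul // invmxK mulmxA.
move: (a ^+ 2 / 4) aa f1 f2 => b b0 f1 f2.
have logf h : Gam h -> b * (nm eta * nm h * nm (invmx eta)) <= nm (eta *m h *m invmx eta) ->
    kap eta + lambda (eta *m h *m invmx eta) 1 <=
     ln (nm (eta *m h *m invmx eta)) + (`|ln b| + L).
  move=> Gh; have hp := Gam_nm_gt0 Gh; have ep := Gam_nm_gt0 Ge; have eip := Gam_nm_gt0 Gei.
  have Gehe := GamM (GamM Ge Gh) Gei; have ehp := Gam_nm_gt0 Gehe.
  rewrite -ler_ln ?posrE ?mulr_gt0 // lnM ?posrE ?mulr_gt0 // lnM ?posrE ?mulr_gt0 //.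
  rewrite lnM ?posrE // lambda_conj //; have := lambda1_nm n2 (Gam_unit Gh); rewrite -/L /kap.
  by have := ler_norm (- ln b); rewrite normrN; lra_atoms.
split=> //; first by rewrite gE; apply: logf; [exact: Gu | apply: f1].
by rewrite gEi; apply: logf; [exact: Gi | apply: f2].
Qed.

(** With the identity as a letter, [ball N] also lists the elements of length less than N. *)
Definition letters : seq 'M[R]_n := 1%:M :: S ++ map invmx S.

Fixpoint ball (N : nat) : seq 'M[R]_n :=
  if N is N'.+1 then [seq x *m g | x <- letters, g <- ball N'] else [:: 1%:M].

Lemma size_ball N : size (ball N) = (size letters ^ N)%N.
Proof. by elim: N => // N IH; rewrite expnS -IH; apply: size_allpairs. Qed.

Lemma mem_ball N g : Gam g -> (wlen g <= N)%N -> g \in ball N.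
Proof.
move=> Gg; have [w [wS <- <-]] := geodesic_word Gg.
have step M x h : x \in letters -> h \in ball M -> x *m h \in ball M.+1.
  by move=> xl hM; apply/allpairsP; exists (x, h).
elim: N w wS => [|N IH] [|x w] wS wN; rewrite ?inE //.
  rewrite -[word_prod _](mul1mx 1%:M); apply: step; first exact: mem_head.
  exact: (IH [::]).
move: wS => /andP[xS wS]; apply: step; last exact: IH.
rewrite inE mem_cat; move: xS => /hasP[s sS /orP[]/eqP->]; first by rewrite sS orbT.
by rewrite map_f // !orbT.
Qed.

(** A function of the set [C] alone, so that the count can recover an element from its class and an
    index. *)
Definition class_word (C : set 'M[R]_n) : seq 'M[R]_n :=
  xget [::] [set w | [/\ is_word S w, C (word_prod w) &
                        forall x, C x -> (size w <= wlen x)%N]]%classic.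

Lemma conj_class_Gam g x : Gam g -> conj_class Gam g x -> Gam x.
Proof. by move=> Gg [e Ge ->]; apply: GamM; [exact: GamM | exact: GamV]. Qed.

Lemma conj_class_refl g : conj_class Gam g g.
Proof. by exists 1%:M; rewrite ?invmx1 ?mul1mx ?mulmx1 //; apply: Gam1. Qed.

Lemma class_wordP g (w := class_word (conj_class Gam g)) : Gam g ->
  [/\ is_word S w, conj_class Gam g (word_prod w) &
    forall x, conj_class Gam g x -> (size w <= wlen x)%N].
Proof.
move=> Gg; rewrite /w /class_word; case: xgetP => [v _ //|none].
pose P k := `[< exists2 x, conj_class Gam g x & wlen x = k >].
have exP : exists k, P k by exists (wlen g); apply/asboolP; exists g => //; apply: conj_class_refl.
case: (ex_minnP exP) => k /asboolP[x Cx xk] kmin.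
have [v [vS vx sv]] := geodesic_word (conj_class_Gam Gg Cx).
case: (none v); split=> //; first by rewrite vx.
by move=> y Cy; rewrite sv xk; apply: kmin; apply/asboolP; exists y.
Qed.

Lemma invmx_conjr g h : Gam g -> Gam h ->
  invmx (h *m g *m invmx h) = h *m invmx g *m invmx h.
Proof. by move=> Gg Gh; have := invmx_conj Gg (GamV Gh); rewrite invmxK. Qed.

(* Representatives of a class: the rotations of a shortest word, then a finite list
   common to all classes, which takes care of the classes of small length. *)
Definition class_rep (sh : seq 'M[R]_n) (C : set 'M[R]_n) (i : nat) : 'M[R]_n :=
  if (i < (size (class_word C)).+1)%N then word_prod (rot i (class_word C))
  else nth 1%:M sh (i - (size (class_word C)).+1).

(** Classes of length at least N fall under [long_class]. In the others lambda_1 of g and of g^-1 is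
    bounded; the conjugate k given by [conj_reduction] has kappa within a constant of their sum, so
    it lies in one fixed ball, which is the list [sh]. *)
Lemma conj_decomposition : exists sh, exists2 C : R, 0 <= C & forall g, Gam g ->
  exists eta i, [/\ Gam eta, (i < (wlen g).+1 + size sh)%N,
    g = eta *m class_rep sh (conj_class Gam g) i *m invmx eta,
    kap eta + lambda g 1 <= ln (nm g) + C &
    kap eta + lambda (invmx g) 1 <= ln (nm (invmx g)) + C].
Proof.
have [N [C1 C10 hlong]] := long_class.
have [C2 C20 hred] := conj_reduction; have [C3 C30 hcyc] := nearly_cyclic_lambda C20.
have [K K0 hK] := lnm_wlen; have [c c0 hc] := wlen_gap.
pose L := ln (n%:R : R); have L0 : 0 <= L by apply: ln_dim_ge0.
pose b := 2 * (K * (N%:R + 1) + L + C3) + 1.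
have b0 : 0 <= b / c.
  by rewrite divr_ge0 ?(ltW c0) // /b !addr_ge0 ?mulr_ge0 ?addr_ge0 ?mulr_ge0 ?addr_ge0.
pose N2 := Num.bound (b / c); exists (ball N2), (C1 + C2 + L).
  by rewrite !addr_ge0.
move=> g Gg; have [wS [e Ge we] wmin] := class_wordP Gg; set w := class_word _ in wS we wmin.
have wE : class_word (conj_class Gam g) = w by [].
clearbody w.
have ug := Gam_unit Gg; have ue := Gam_unit Ge.
have Gw : Gam (word_prod w) by exists w.
have wg : (size w <= wlen g)%N by apply: wmin; apply: conj_class_refl.
have ge : g = invmx e *m word_prod w *m invmx (invmx e).
  by rewrite we invmxK !mulmxA mulVmx // mul1mx mulmxKV.
have [Nw|wN] := leqP N (size w).
  have [|e' Ge'|i [eta [Geta iw gE h1 h2]]] := hlong g w Gg wS Nw.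
  - by exists (invmx e) => //; apply: GamV.
  - apply: wmin; exists (e' *m e); first exact: GamM.
    by rewrite we invmx_mul ?Gam_unit // !mulmxA.
  exists eta, i; split=> //.
  - by rewrite (leq_trans iw) // addSn ltnS (leq_trans wg) // leq_addr.
  - by rewrite /class_rep wE iw.
  - by apply: le_trans h1 _; rewrite lerD2l -addrA lerDl addr_ge0.
  - by apply: le_trans h2 _; rewrite lerD2l -addrA lerDl addr_ge0.
have [eta [Geta h1 h2]] := hred g Gg; set k := invmx eta *m g *m eta in h1 h2.
have ueta := Gam_unit Geta; have Gei := GamV Geta.
have Gk : Gam k by apply: GamM => //; apply: GamM.
have uk := Gam_unit Gk; have Gki := GamV Gk.
have gk : g = eta *m k *m invmx eta.
  by rewrite /k !mulmxA mulmxV // mul1mx mulmxK.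
move: k gk h1 h2 Gk uk Gki => k gk h1 h2 Gk uk Gki.
have gki : invmx g = eta *m invmx k *m invmx eta.
  by rewrite gk invmx_conjr.
have lam1 : lambda g 1 = lambda k 1.
  by rewrite gk; apply: lambda_conj.
have lam1i : lambda (invmx g) 1 = lambda (invmx k) 1.
  by rewrite gki; apply: lambda_conj.
have l1 := hcyc k Gk h2.
have h2i : 2 * kap (invmx k) <= kap (invmx k *m invmx k) + C2.
  by rewrite -(invmx_mul uk uk) !kapV.
have l2 := hcyc _ Gki h2i.
have bound x : Gam x -> (wlen x <= size w)%N -> lambda x 1 <= K * (N%:R + 1) + L.
  move=> Gx xw; apply: le_trans (lambda1_nm n2 (Gam_unit Gx)) _; rewrite lerD2r.
  apply: le_trans (hK _ Gx) _; apply: (ler_wpM2l K0); rewrite lerD2r ler_nat.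
  exact: leq_trans xw (ltnW wN).
have lw : lambda g 1 = lambda (word_prod w) 1.
  by rewrite we; apply/esym/lambda_conj.
have lwi : lambda (invmx g) 1 = lambda (invmx (word_prod w)) 1.
  by rewrite we (invmx_conjr Gg Ge); apply/esym/lambda_conj.
have lb1 : lambda g 1 <= K * (N%:R + 1) + L by rewrite lw; exact: bound Gw (wlen_le wS).
have lb2 : lambda (invmx g) 1 <= K * (N%:R + 1) + L.
  rewrite lwi; apply: (bound _ (GamV Gw)); rewrite (wlenV Gw).
  exact: wlen_le wS.
have kb : kap k <= 2 * (K * (N%:R + 1) + L + C3).
  by rewrite /kap; rewrite -lam1 in l1; rewrite -lam1i in l2; lra_atoms.
have kN2 : (wlen k <= N2)%N.
  rewrite -(ler_nat R); apply: le_trans (_ : b / c <= _); last first.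
    by apply: ltW; apply: archi_boundP.
  rewrite (ler_pdivlMr _ _ c0) mulrC; apply: le_trans (hc k Gk) _.
  have /andP[g1 g2] := kap_gap Gk; rewrite /b lerD2r.
  exact: le_trans g1 (le_trans g2 kb).
have kmem := mem_ball Gk kN2.
exists eta, ((size w).+1 + index k (ball N2))%N; split.
- exact: Geta.
- by rewrite -addnS; apply: leq_add; [exact: wg | rewrite index_mem].
- have -> : class_rep (ball N2) (conj_class Gam g) ((size w).+1 + index k (ball N2)) = k.
    by rewrite /class_rep wE ltnNge leq_addr /= addKn nth_index.
  exact: gk.
(* [h1] bounds 2 kap eta + kap k by kap g; cancelling ln |g^-1| by this estimate leaves a bound by
   ln |g| alone. *)
- have i1 : ln (nm (invmx g)) <= kap eta + ln (nm (invmx k)).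
    rewrite gki; have := lnmM (GamM Geta Gki) Gei; have := lnmM Geta Gki.
    by rewrite /kap; lra_atoms.
  have i2 := lambda1_nm n2 uk; rewrite -/L in i2; rewrite lam1.
  by move: h1; rewrite {2 3}/kap; lra_atoms.
- have i1 : ln (nm g) <= kap eta + ln (nm k).
    rewrite {1}gk; have := lnmM (GamM Geta Gk) Gei; have := lnmM Geta Gk.
    by rewrite /kap; lra_atoms.
  have i2 := lambda1_nm n2 (Gam_unit Gki); rewrite -/L in i2; rewrite lam1i.
  by move: h1; rewrite {2 3}/kap; lra_atoms.
Qed.

(** What the count consumes: g is recovered from f, eta, i and the class of g f, with i in a range
    linear in the radius and eta charged twice. *)
Definition conj_decomposable (j : nat) : Prop :=
  exists (F : seq 'M[R]_n) (K : R) (rep : set 'M[R]_n -> nat -> 'M[R]_n),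
  [/\ 0 <= K, (forall f, f \in F -> Gam f) & forall g, Gam g -> exists f eta i,
   [/\ f \in F, Gam eta,
      g *m f = eta *m rep (conj_class Gam (g *m f)) i *m invmx eta,
      2 * (mu eta 1 - mu eta j) + (lambda (g *m f) 1 - lambda (g *m f) j)
        <= mu g 1 - mu g j + K &
      i%:R <= K * (mu g 1 - mu g j + 1)]].

(** Add the two estimates of [conj_decomposition], for g and g^-1; the left side becomes 2 kap eta +
    lambda_1(g) - lambda_n(g). *)
Lemma conj_decomposable_last : conj_decomposable n.
Proof.
have [sh [C C0 hC]] := conj_decomposition; have [c c0 hc] := wlen_gap.
pose L := ln (n%:R : R); have L0 : 0 <= L by apply: ln_dim_ge0.
pose K1 := (c^-1 + 1 + 0 + (size sh)%:R).
have ci : 0 <= c^-1 by rewrite invr_ge0 ltW.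
exists [:: 1%:M], (2 * C + 6 * L + K1), (class_rep sh); split.
- by rewrite !addr_ge0 ?mulr_ge0.
- by move=> f; rewrite inE => /eqP->; apply: Gam1.
move=> g Gg; have [eta [i [Geta ib gE h1 h2]]] := hC g Gg.
have ug := Gam_unit Gg; have /andP[g1 g2] := kap_gap Gg.
have d0 : 0 <= mu g 1 - mu g 2 by rewrite subr_ge0 mu_antimono.
exists 1%:M, eta, i; rewrite mulmx1; split=> //; first exact: mem_head.
- have /andP[_ e2] := kap_gap Geta; have k1 := kap_mu Gg; rewrite -/L in k1.
  have -> : lambda g n = - lambda (invmx g) 1 by apply: lambda_last.
  have K10 : 0 <= K1 by rewrite !addr_ge0.
  by move: k1; rewrite {1}/kap; lra_atoms.
- have iw : i%:R <= (wlen g)%:R + 0 + 1 + (size sh)%:R :> R.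
    by rewrite addr0 natr1 -natrD ler_nat; apply: ltnW.
  have wb : (wlen g)%:R <= c^-1 * (mu g 1 - mu g n + 1).
    rewrite mulrC ler_pdivlMr // mulrC; apply: le_trans (hc g Gg) _.
    by rewrite lerD2r.
  have K00 : 0 <= 2 * C + 6 * L by rewrite !addr_ge0 ?mulr_ge0.
  exact: index_arith (le_trans d0 g1) (lexx 0) (ler0n R _) K00 wb iw.
Qed.

(** For h = g f, double the estimate kap eta + lambda_1(h) <= ln |h| + C and subtract lambda_1(h) +
    lambda_2(h), which the choice of f bounds below by mu_1(g) + mu_2(g) up to a constant. The
    finite set F makes |h| and |g| comparable from above. *)
Lemma conj_decomposable_2 (F : seq 'M[R]_n) (a : R) : 0 < a ->
  (forall f, f \in F -> Gam f) ->
  (forall g, Gam g -> exists2 f, f \in F &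
     a * wedge_nm g <= `|\tr (g *m f) ^+ 2 - \tr (g *m f *m (g *m f))|) ->
  conj_decomposable 2.
Proof.
move=> a0 GF hF.
have [sh [C C0 hC]] := conj_decomposition; have [c c0 hc] := wlen_gap.
pose L := ln (n%:R : R); have L0 : 0 <= L by apply: ln_dim_ge0.
pose A1 := \sum_(f <- F) `|ln (nm f)|; pose A2 := \sum_(f <- F) (wlen f)%:R : R.
have A10 : 0 <= A1 by apply: sumr_ge0 => *; rewrite normr_ge0.
have A20 : 0 <= A2 by apply: sumr_ge0.
have F1 f : f \in F -> ln (nm f) <= A1.
  move=> fF; apply: le_trans (ler_norm _) _; rewrite /A1 (big_rem f) //= lerDl.
  by apply: sumr_ge0 => *; rewrite normr_ge0.
have F2 f : f \in F -> (wlen f)%:R <= A2.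
  by move=> fF; rewrite /A2 (big_rem f) //= lerDl; apply: sumr_ge0.
have ci : 0 <= c^-1 by rewrite invr_ge0 ltW.
pose K1 := (c^-1 + 1 + A2 + (size sh)%:R).
exists F, (2 * C + 10 * L + 2 * A1 + `|ln a| + K1), (class_rep sh); split=> //.
  by rewrite !addr_ge0 ?mulr_ge0.
move=> g Gg; have [f fF hf] := hF g Gg; have Gf := GF f fF.
have Gh := GamM Gg Gf; set h := g *m f in Gh hf.
have [eta [i [Geta ib hE h1 h2]]] := hC h Gh.
have ug := Gam_unit Gg; have uh := Gam_unit Gh.
have d0 : 0 <= mu g 1 - mu g 2 by rewrite subr_ge0 mu_antimono.
exists f, eta, i; split=> //.
- have /andP[e1 e2] := kap_gap Geta.
  have K10 : 0 <= K1 by rewrite !addr_ge0.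
  have [wp w1 w2] := mu12_wedge n2 ug; have [m1 m2] := mu1_nm n2 ug.
  rewrite -/L in m2 w2.
  have ep : 0 < `|\tr h ^+ 2 - \tr (h *m h)| by apply: lt_le_trans hf; rewrite mulr_gt0.
  have t1 : ln a + ln (wedge_nm g) <= lambda h 1 + lambda h 2 + 2 * L.
    have {1}<- : ln (a * wedge_nm g) = ln a + ln (wedge_nm g) by rewrite lnM.
    apply: le_trans (lambda12_trace n2 uh _); last by rewrite -normr_gt0.
    by rewrite ler_ln ?posrE ?mulr_gt0.
  have t2 : ln (nm h) <= ln (nm g) + A1.
    by apply: le_trans (lnmM Gg Gf) _; rewrite lerD2l F1.
  have t3 : - ln a <= `|ln a| by rewrite -normrN ler_norm.
  by rewrite -/h; lra_atoms.
- have iw : i%:R <= (wlen g)%:R + A2 + 1 + (size sh)%:R :> R.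
    have : i%:R <= (wlen g + wlen f + 1 + size sh)%:R :> R.
      rewrite ler_nat (leq_trans (ltnW ib)) // leq_add2r -addn1 leq_add2r.
      exact: wlenM.
    rewrite !natrD => hi; apply: le_trans hi _; rewrite !lerD2r lerD2l.
    exact: F2 fF.
  have wb : (wlen g)%:R <= c^-1 * (mu g 1 - mu g 2 + 1).
    by rewrite mulrC ler_pdivlMr // mulrC; apply: hc.
  have K00 : 0 <= 2 * C + 10 * L + 2 * A1 + `|ln a| by rewrite !addr_ge0 ?mulr_ge0.
  exact: index_arith d0 A20 (ler0n R _) K00 wb iw.
Qed.

(** * Counting elements and conjugacy classes *)

Section Counting.
Variable j : nat.
Hypothesis j2n : (2 <= j <= n)%N.

Let D (g : 'M[R]_n) : R := mu g 1 - mu g j.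
Let ell (g : 'M[R]_n) : R := lambda g 1 - lambda g j.
Let A (r : R) : set 'M[R]_n := [set g | Gam g /\ mu g 1 - mu g j <= r]%classic.
Let Cl (r : R) : set (set 'M[R]_n) :=
  [set C | exists g, [/\ Gam g, C = conj_class Gam g & lambda g 1 - lambda g j <= r]]%classic.

Let jE : j = j.-1.+1.
Proof. by case/andP: j2n => h _; rewrite prednK // ltnW. Qed.

Let jn : (j.-1 < n)%N.
Proof. by case/andP: j2n => h1 h2; rewrite prednK // ltnW. Qed.

Let D_ge0 g : Gam g -> 0 <= D g.
Proof. by move=> Gg; rewrite subr_ge0 jE mu_antimono // Gam_unit. Qed.

Let ell_ge0 g : Gam g -> 0 <= ell g.
Proof. by move=> Gg; rewrite subr_ge0 jE lambda_antimono // Gam_unit. Qed.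

Let D2_le g : Gam g -> mu g 1 - mu g 2 <= D g.
Proof.
move=> Gg; rewrite lerD2l lerN2 jE; apply: mu_antimono => //; first exact: Gam_unit.
by case/andP: j2n => h _; rewrite -ltnS prednK // ltnW.
Qed.

Lemma moduli1 k : (k < n)%N -> (eig_moduli (1%:M : 'M[R]_n))`_k = 1.
Proof.
move=> kn; have : (eig_moduli (1%:M : 'M[R]_n))`_k \in eig_moduli (1%:M : 'M[R]_n).
  by rewrite mem_nth // size_eig_moduli.
rewrite mem_sort => /mapP[z zs ->]; move: zs; rewrite mem_eig_seq.
have -> : cplx_mx (1%:M : 'M[R]_n) = 1%:M.
  by apply/matrixP => a b; rewrite !mxE; case: (a == b).
move=> /eigenvalueP[v]; rewrite mulmx1 => vz v0.
have /eqP : (1 - z) *: v = 0 by rewrite scalerBl scale1r -vz subrr.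
rewrite scaler_eq0 (negPf v0) orbF subr_eq0 => /eqP <-.
exact: ComplexField.Normc.normc1.
Qed.

Let D1 : D 1%:M = 0.
Proof.
rewrite /D jE !muE ?unitmx1 // trmx1 mulmx1 !moduli1 //.
exact: subrr.
Qed.

Let ell1 : ell 1%:M = 0.
Proof. by rewrite /ell /lambda !moduli1 // subrr. Qed.

Let A_covered : exists2 c : R, 0 < c &
  forall r, covered (A r) (size letters ^ Num.truncn ((r + 1) / c)%R)%N.
Proof.
have [c c0 hc] := wlen_gap; exists c => // r; exists (ball (Num.truncn ((r + 1) / c))).
split; first by rewrite size_ball.
move=> g [Gg gr]; apply: mem_ball => //.
have h : (wlen g)%:R <= (r + 1) / c.
  rewrite (ler_pdivlMr _ _ c0) mulrC; apply: le_trans (hc g Gg) _.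
  by rewrite lerD2r; apply: le_trans (D2_le Gg) gr.
by rewrite truncn_ge_nat // (le_trans _ h).
Qed.

(** By [wlen_gap] the elements counted lie in a word ball of radius linear in r, so the growth
    exponent is finite, as [growth_convolution] requires. The identity makes the counts positive, so
    that their logarithms are meaningful. *)
Lemma ball_counting : exists N : R -> nat,
  [/\ forall r, (A r #= `I_(N r))%card, forall r, 0 <= r -> (0 < N r)%N,
    forall r s, r <= s -> (N r <= N s)%N &
    exists b : R, (growth N <= b%:E)%E].
Proof.
have [c c0 hc] := A_covered.
have /choice[N hN] : forall r, exists m, (A r #= `I_m)%card.
  by move=> r; have [m _ h] := covered_card (hc r); exists m.
have N0 r : 0 <= r -> (0 < N r)%N.
  move=> r0; rewrite lt0n; apply/eqP => Nr0; have := hN r; rewrite Nr0 II0 card_eq0 => /eqP E.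
  have : A r 1%:M by split; [exact: Gam1 | rewrite -/(D _) D1].
  by rewrite E.
exists N; split=> //.
  move=> r s rs; apply: (card_le_covered (hN r)).
  have [l [ls hl]] := card_covered (hN s); exists l; split=> // g [Gg gr].
  by apply: hl; split=> //; apply: le_trans rs.
pose x := ln ((size letters)%:R : R).
have x0 : 0 <= x by rewrite ln_ge0 // ler1n.
exists (2 * x / c); apply: (@growth_le _ _ _ 1) => r r1 r0.
have := card_le_covered (hN r) (hc r) => le.
have rc : 0 <= (r + 1) / c by rewrite divr_ge0 ?(ltW c0) // addr_ge0 // ltW.
apply: le_trans (_ : (Num.truncn ((r + 1) / c))%:R * x <= _).
  have : (N r)%:R <= (size letters)%:R ^+ Num.truncn ((r + 1) / c) :> R.
    by rewrite -natrX ler_nat.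
  have Np : 0 < (N r)%:R :> R by rewrite ltr0n N0 // ltW.
  have lp : 0 < (size letters)%:R :> R by rewrite ltr0n.
  rewrite -ler_ln ?posrE ?exprn_gt0 // lnXn // -[ln _ *+ _]mulr_natl => h.
  exact: h.
apply: le_trans (_ : (r + 1) / c * x <= _).
  by rewrite ler_wpM2r // truncn_le.
have -> : 2 * x / c * r = (2 * r) / c * x by ring.
by rewrite ler_wpM2r // ler_wpM2r ?invr_ge0 ?(ltW c0) // mulr_natl mulr2n lerD2l.
Qed.

Hypothesis reps : exists2 C : R, 0 <= C & forall g, Gam g -> exists h,
  [/\ Gam h, conj_class Gam h = conj_class Gam g & D h <= ell g + C].

Lemma class_counting (N : R -> nat) : (forall r, (A r #= `I_(N r))%card) ->
  exists H : R -> nat,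
  [/\ forall r, (Cl r #= `I_(H r))%card, forall r, 0 <= r -> (0 < H r)%N,
    forall r s, r <= s -> (H r <= H s)%N &
    exists2 C : R, 0 <= C & forall r, 0 <= r -> (H r <= N (r + C)%R)%N].
Proof.
move=> hN; have [C C0 hC] := reps.
have cov r : covered (Cl r) (N (r + C)).
  have [l [ls hl]] := card_covered (hN (r + C)).
  exists [seq conj_class Gam h | h <- l]; rewrite size_map; split=> // _ [g [Gg -> gr]].
  have [h [Gh <- hh]] := hC g Gg; apply: map_f; apply: hl; split=> //.
  by apply: le_trans hh _; rewrite lerD2r.
have /choice[H hH] : forall r, exists m, (Cl r #= `I_m)%card.
  by move=> r; have [m _ h] := covered_card (cov r); exists m.
exists H; split=> //.
- move=> r r0; rewrite lt0n; apply/eqP => Hr0; have := hH r; rewrite Hr0 II0 card_eq0 => /eqP E.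
  have : Cl r (conj_class Gam 1%:M).
    by exists 1%:M; split; [exact: Gam1 | by [] | rewrite -/(ell _) ell1].
  by rewrite E.
- move=> r s rs; apply: (card_le_covered (hH r)).
  have [l [ls hl]] := card_covered (hH s); exists l; split=> // K [g [Gg gE gr]].
  by apply: hl; exists g; split=> //; apply: le_trans rs.
- by exists C => // r _; apply: (card_le_covered (hH r) (cov r)).
Qed.

Lemma h1_le_delta1 : (h1 Gam j <= delta1 Gam j)%E.
Proof.
have [N [hN N0 Nm _]] := ball_counting.
have [H [hH H0 Hm [C C0 HN]]] := class_counting hN.
rewrite /h1 /delta1 (growth_ecard hN) (growth_ecard hH).
exact: growth_shift C0 H0 N0 HN.
Qed.

(** Sort the elements into shells by q, the integer part of D eta. In shell q there are at most N (q
    + 1) choices of eta, and [shell_arith] leaves the class of g f a radius r + K - 2 q; the list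
    [L] multiplies the pieces back together. *)
Lemma delta1_le_h1 : conj_decomposable j -> (delta1 Gam j <= h1 Gam j)%E.
Proof.
move=> [F [K [rep [K0 GF dec]]]].
have [N [hN N0 Nm [b Nb]]] := ball_counting.
have [H [hH H0 Hm _]] := class_counting hN.
rewrite /h1 /delta1 (growth_ecard hN) (growth_ecard hH).
have /choice[s hs] := fun r => card_covered (hN r).
have /choice[t ht] := fun r => card_covered (hH r).
apply: (growth_convolution (c := size F) N0 H0 Nm Hm K0 Nb) => r r0.
set I := Num.truncn _; set Q := Num.truncn _.
pose pairs := flatten [seq [seq (eta, C) | eta <- s (q%:R + 1), C <- t (r + K - 2 * q%:R)]
   | q <- iota 0 Q.+1].
pose fi := [seq (f, i) | f <- F, i <- iota 0 I.+1].
pose L := [seq x.2.1 *m rep x.2.2 x.1.2 *m invmx x.2.1 *m invmx x.1.1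
   | x <- [seq (y, z) | y <- fi, z <- pairs]].
apply: (card_le_covered (hN r)); exists L; split.
  rewrite size_map !size_allpairs size_iota leq_mul2l; apply/orP; right.
  rewrite size_flatten /shape -map_comp sumnE big_map -(big_mkord xpredT
    (fun q => N (q%:R + 1)%R * H (r + K - 2 * q%:R)%R)%N) /index_iota subn0.
  apply: leq_sum => q _; rewrite /= size_allpairs.
  by apply: leq_mul; [have [] := hs (q%:R + 1) | have [] := ht (r + K - 2 * q%:R)].
move=> g [Gg gr]; have [f [eta [i [fF Geta gE hsum hi]]]] := dec g Gg.
have Gf := GF f fF; have Ggf := GamM Gg Gf.
have {}hsum : 2 * D eta + ell (g *m f) <= D g + K := hsum.
have {}hi : i%:R <= K * (D g + 1) := hi.
have {}gr : D g <= r := gr.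
have De := D_ge0 Geta; have le := ell_ge0 Ggf.
pose q := Num.truncn (D eta).
have /andP[q1 q2] := truncn_itv De; rewrite -/q in q1 q2.
have [DQ ellQ] := shell_arith hsum gr le q1.
have qQ : (q <= Q)%N by apply: le_truncn.
have iI : (i <= I)%N.
  rewrite truncn_ge_nat; last by rewrite mulr_ge0 // addr_ge0.
  by apply: le_trans hi _; rewrite ler_wpM2l // lerD2r.
have etas : eta \in s (q%:R + 1).
  have [_] := hs (q%:R + 1); apply; split=> //.
  by rewrite natr1; exact: (ltW q2).
have Cs : conj_class Gam (g *m f) \in t (r + K - 2 * q%:R).
  have [_] := ht (r + K - 2 * q%:R); apply; exists (g *m f); split=> //.
apply/mapP; exists ((f, i), (eta, conj_class Gam (g *m f))) => /=; last first.
  by rewrite -gE mulmxK // Gam_unit.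
apply: allpairs_f.
  by apply: allpairs_f => //; rewrite mem_iota add0n ltnS iI.
apply/flattenP; exists [seq (eta, C) | eta <- s (q%:R + 1), C <- t (r + K - 2 * q%:R)].
  by apply/mapP; exists q => //; rewrite mem_iota add0n ltnS qQ.
exact: allpairs_f.
Qed.

End Counting.
End WordMetric.

Theorem theorem2p30 (R : realType) (n : nat) (S : seq 'M[R]_n) :
  (2 <= n)%N ->
  (forall s, s \in S -> \det s = 1) ->
  proj_anosov S ->
  [/\ (h1 (gen_group S) 2 <= delta1 (gen_group S) 2)%E,
      h1 (gen_group S) n = delta1 (gen_group S) n &
      (zariski_dense_SL (gen_group S) ->
         h1 (gen_group S) 2 = delta1 (gen_group S) 2)].
Proof.
move=> n2 detS anosov.
have r2 : (2 <= 2 <= n)%N by rewrite n2.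
have rn : (2 <= n <= n)%N by rewrite n2 leqnn.
have [C C0 hC] := class_representative detS n2 anosov.
have reps2 : exists2 C : R, 0 <= C & forall g, gen_group S g -> exists h,
    [/\ gen_group S h, conj_class (gen_group S) h = conj_class (gen_group S) g &
      mu h 1 - mu h 2 <= lambda g 1 - lambda g 2 + C].
  by exists C => // g Gg; have [h [Gh hg h2 _]] := hC g Gg; exists h.
have repsn : exists2 C : R, 0 <= C & forall g, gen_group S g -> exists h,
    [/\ gen_group S h, conj_class (gen_group S) h = conj_class (gen_group S) g &
      mu h 1 - mu h n <= lambda g 1 - lambda g n + C].
  by exists C => // g Gg; have [h [Gh hg _ hn]] := hC g Gg; exists h.
have le2 := h1_le_delta1 detS n2 anosov r2 reps2.
split=> //.
  apply/eqP; rewrite eq_le (h1_le_delta1 detS n2 anosov rn repsn) /=.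
  have dec := conj_decomposable_last detS n2 anosov.
  exact: (delta1_le_h1 detS n2 anosov rn repsn dec).
move=> zar; have [F [FG [a a0 hF]]] := zariski_trace zar.
apply/eqP; rewrite eq_le le2 /=; apply: (delta1_le_h1 detS n2 anosov r2 reps2).
apply: (conj_decomposable_2 detS n2 anosov a0 FG) => g Gg.
have ug := Gam_unit detS Gg; have [wp _ _] := mu12_wedge n2 ug.
by apply: hF => //; apply: Gam_det Gg.
Qed.
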